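(* For every unimodular marked one-ended tree $[\boldsymbol T,\boldsymbol o;\boldsymbol c]$ equipped with conductances $\boldsymbol c$ (mark space $[0,\infty)$, the mark $\boldsymbol c(e)$ of each edge $e$ being well defined), if $\boldsymbol c$ is bounded on the set of leaves, then $$\max_{\boldsymbol f}|\boldsymbol f|=\inf_{\Pi}\boldsymbol c(\Pi),$$ where the maximum is over all legal equivariant flows $\boldsymbol f$ and the infimum is over all equivariant cut-sets $\Pi$.
   Context: Discrete spaces. A discrete space is a metric space in which every ball of finite radius is finite (e.g. a connected locally finite graph with graph distance). A marked pointed discrete space $(D,o;m)$ has an origin (root) $o\in D$ and a function $m:D\times D\to\Xi$ with $\Xi$ a complete separable metric space; doubly-pointed ones have two origins. Isomorphisms are isometries preserving origins and marks. $\mathcal D'_*,\mathcal D'_{**}$ are the sets of isomorphism classes (written in brackets) of pointed and doubly-pointed marked discrete spaces, with the Borel $\sigma$-field of the following metric: $1\wedge$ the infimum of $\epsilon>0$ such that, in both directions, there is an injection from the closed ball of radius $1/\epsilon$ around the origin of one space into the other, preserving origins and changing distances and marks by at most $\epsilon$. A random element $[\boldsymbol D,\boldsymbol o;\boldsymbol m]$ of $\mathcal D'_*$ is unimodular if $\mathbb E[\sum_{v\in\boldsymbol D}g[\boldsymbol D,\boldsymbol o,v;\boldsymbol m]]=\mathbb E[\sum_{v\in\boldsymbol D}g[\boldsymbol D,v,\boldsymbol o;\boldsymbol m]]$ for all measurable $g:\mathcal D'_{**}\to[0,\infty)$. Equivariant processes on a marked space. An equivariant process on $[\boldsymbol D;\boldsymbol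 m]$ assigns to (almost) every deterministic marked discrete space $(D;m)$ a random extra marking of $D\times D$ (extra randomness allowed) whose law is transported to that of the image under every mark-preserving isometry, and such that probabilities of measurable events of the resulting pointed marked space depend measurably on the isomorphism class $[D,o;m]$. An equivariant subset (of edges) is given by the edges with mark 1 in a $\{0,1\}$-valued equivariant process. One-ended trees. In a one-ended locally finite tree, each vertex $v$ starts a unique infinite simple path; its next vertex is the parent $F(v)$. Every edge is uniquely of the form $(v,F(v))$; for functions $\boldsymbol f,\boldsymbol c$ on edges write $\boldsymbol f(v):=\boldsymbol f(v,F(v))$, $\boldsymbol c(v):=\boldsymbol c(v,F(v))$, and write $v\in\Pi$ if $(v,F(v))\in\Pi$. $\boldsymbol L$ is the set of leaves of $\boldsymbol T$. A legal equivariant flow on $[\boldsymbol T;\boldsymbol c]$ is an equivariant process assigning extra marks $\boldsymbol f(e)\in\mathbb R$ to the edges such that a.s. $0\le\boldsymbol f(e)\le\boldsymbol c(e)$ for every edge $e$, and $\boldsymbol f(v,F(v))=\sum_{w\in F^{-1}(v)}\boldsymbol f(w,v)$ for every vertex $v\in\boldsymbol T\setminus\boldsymbol L$. Its norm is $|\boldsymbol f|:=\mathbb E[\boldsymbol f(\boldsymbol o)1_{\{\boldsymbol o\in\boldsymbol L\}}]$. An equivariant cut-set is an equivariant subset $\Pi$ of the edges of $[\boldsymbol T;\boldsymbol c]$ that separates the set of leaves $\boldsymbol L$ from the end of $\boldsymbol T$; $\boldsymbol c(\Pi):=\mathbb E[\boldsymbol c(\boldsymbol o)1_{\{\boldsymbol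 o\in\Pi\}}]$. *)

(* Defs.v *)
From HB Require Import structures.
From mathcomp Require Import all_boot all_order all_algebra.
From mathcomp Require Import all_classical all_reals all_analysis measurable_realfun.
Set Implicit Arguments.
Unset Strict Implicit.
Unset Printing Implicit Defensive.
Import Order.TTheory GRing.Theory Num.Theory.
Import numFieldNormedType.Exports.
Local Open Scope quotient_scope.
Local Open Scope classical_set_scope.
Local Open Scope ring_scope.

(* The distance is a plain field rather than a [metricType] structure on the
   carrier, so that the type of all spaces lives in a universe above that of
   the carriers and can itself be quotiented and carry a sigma-algebra. *)
Record discrete_space (R : realType) := DiscreteSpace {
  carrier :> Type;
  dist : carrier -> carrier -> R;
  dist_eq0 : forall x y, dist x y = 0 <-> x = y;
  dist_sym : forall x y, dist x y = dist y x;
  dist_triangle : forall x y z, dist x z <= dist x y + dist y z;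
  finite_balls : forall x r, finite_set [set y | dist x y <= r]
}.

HB.instance Definition _ (R : realType) (D : discrete_space R) :=
  gen_eqMixin (carrier D).
HB.instance Definition _ (R : realType) (D : discrete_space R) :=
  gen_choiceMixin (carrier D).

(* Mark spaces are only used through their metric balls, so any pointed
   pseudometric type is accepted here; the ones used in the statement
   ([0, +oo[, R, {0,1} and binary products) are complete and separable. *)
Record marked_space (R : realType) (M : pseudoPMetricType R) := MarkedSpace {
  space :> discrete_space R;
  mark : space -> space -> M
}.

Record pointed_space (R : realType) (M : pseudoPMetricType R) := PointedSpace {
  pspace :> marked_space M;
  origin : pspace
}.

Record pointed2_space (R : realType) (M : pseudoPMetricType R) :=
  Pointed2Space {
    p2space :> marked_space M;
    origin1 : p2space;
    origin2 : p2space
  }.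

Section isomorphism.
Context {R : realType} {M : pseudoPMetricType R}.

Definition marked_iso (X Y : marked_space M) (h : X -> Y) : Prop :=
  [/\ bijective h,
      forall x y, dist (h x) (h y) = dist x y &
      forall x y, mark (h x) (h y) = mark x y].

Definition piso (X Y : pointed_space M) : Prop :=
  exists h : X -> Y, marked_iso h /\ h (origin X) = origin Y.

Definition p2iso (X Y : pointed2_space M) : Prop :=
  exists h : X -> Y,
    [/\ marked_iso h, h (origin1 X) = origin1 Y & h (origin2 X) = origin2 Y].

Lemma marked_iso_id (X : marked_space M) : marked_iso (@id X).
Proof. by split => //; exists id. Qed.

Lemma marked_iso_comp (X Y Z : marked_space M) (h : X -> Y) (k : Y -> Z) :
  marked_iso h -> marked_iso k -> marked_iso (k \o h).
Proof.
move=> [bh dh mh] [bk dk mk]; split; first exact: bij_comp.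
- by move=> x y /=; rewrite dk dh.
- by move=> x y /=; rewrite mk mh.
Qed.

Lemma marked_iso_inv (X Y : marked_space M) (h : X -> Y) :
  marked_iso h -> exists2 k : Y -> X, marked_iso k & cancel h k.
Proof.
move=> [[k hK kK] dh mh]; exists k => //; split; first by exists h.
- by move=> x y; rewrite -dh !kK.
- by move=> x y; rewrite -mh !kK.
Qed.

Definition piso_rel : rel (pointed_space M) := fun X Y => `[< piso X Y >].
Definition p2iso_rel : rel (pointed2_space M) := fun X Y => `[< p2iso X Y >].

Lemma piso_refl : reflexive piso_rel.
Proof. by move=> X; apply/asboolP; exists id; split=> //; exact: marked_iso_id. Qed.

Lemma p2iso_refl : reflexive p2iso_rel.
Proof. by move=> X; apply/asboolP; exists id; split=> //; exact: marked_iso_id. Qed.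

Lemma piso_sym : symmetric piso_rel.
Proof.
suff H X Y : piso X Y -> piso Y X by move=> X Y; apply: asbool_equiv_eq; split; exact: H.
by move=> [h [ih ho]]; have [k ik hK] := marked_iso_inv ih; exists k; rewrite -ho hK.
Qed.

Lemma p2iso_sym : symmetric p2iso_rel.
Proof.
suff H X Y : p2iso X Y -> p2iso Y X by move=> X Y; apply: asbool_equiv_eq; split; exact: H.
move=> [h [ih h1 h2]]; have [k ik hK] := marked_iso_inv ih.
by exists k; rewrite -h1 -h2 !hK.
Qed.

Lemma piso_trans : transitive piso_rel.
Proof.
move=> Y X Z /asboolP[h [ih ho]] /asboolP[k [ik ko]]; apply/asboolP.
by exists (k \o h); split; [exact: marked_iso_comp | rewrite /= ho ko].
Qed.

Lemma p2iso_trans : transitive p2iso_rel.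
Proof.
move=> Y X Z /asboolP[h [ih h1 h2]] /asboolP[k [ik k1 k2]]; apply/asboolP.
exists (k \o h); split; first exact: marked_iso_comp.
- by rewrite /= h1 k1.
- by rewrite /= h2 k2.
Qed.

End isomorphism.

HB.instance Definition _ (R : realType) (M : pseudoPMetricType R) :=
  gen_eqMixin (pointed_space M).
HB.instance Definition _ (R : realType) (M : pseudoPMetricType R) :=
  gen_choiceMixin (pointed_space M).
HB.instance Definition _ (R : realType) (M : pseudoPMetricType R) :=
  gen_eqMixin (pointed2_space M).
HB.instance Definition _ (R : realType) (M : pseudoPMetricType R) :=
  gen_choiceMixin (pointed2_space M).

Canonical piso_equiv (R : realType) (M : pseudoPMetricType R) :=
  EquivRel (@piso_rel R M) piso_refl piso_sym piso_trans.
Canonical p2iso_equiv (R : realType) (M : pseudoPMetricType R) :=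
  EquivRel (@p2iso_rel R M) p2iso_refl p2iso_sym p2iso_trans.

Definition Dstar_quot (R : realType) (M : pseudoPMetricType R) : Type :=
  {eq_quot (@piso_rel R M)}.
Definition Dstar2_quot (R : realType) (M : pseudoPMetricType R) : Type :=
  {eq_quot (@p2iso_rel R M)}.
HB.instance Definition _ (R : realType) (M : pseudoPMetricType R) :=
  Choice.on (Dstar_quot M).
HB.instance Definition _ (R : realType) (M : pseudoPMetricType R) :=
  EqQuotient.on (Dstar_quot M).
HB.instance Definition _ (R : realType) (M : pseudoPMetricType R) :=
  Choice.on (Dstar2_quot M).
HB.instance Definition _ (R : realType) (M : pseudoPMetricType R) :=
  EqQuotient.on (Dstar2_quot M).

Section local_metric.
Context {R : realType} {M : pseudoPMetricType R}.

(* "the distance of a and b is at most e", in terms of (open) balls *)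
Definition mark_within (a b : M) (e : R) : Prop :=
  forall e', e < e' -> ball a e' b.

(* Only the values of h on the closed ball of radius 1/e around o matter. *)
Definition almost_embedding (e : R) (X Y : marked_space M) (o : X)
    (h : X -> Y) : Prop :=
  let B := [set x : X | dist o x <= e^-1] in
  [/\ {in B &, injective h},
      {in B &, forall x y, `|dist (h x) (h y) - dist x y| <= e} &
      {in B &, forall x y, mark_within (mark x y) (mark (h x) (h y)) e}].

Definition papprox (e : R) (X Y : pointed_space M) : Prop :=
  exists h : X -> Y,
    almost_embedding e (origin X) h /\ h (origin X) = origin Y.

(* The balls are centred at the first origin; the second one has to be
   preserved when it lies in the domain of the injection. *)
Definition p2approx (e : R) (X Y : pointed2_space M) : Prop :=
  exists h : X -> Y,
    [/\ almost_embedding e (origin1 X) h, h (origin1 X) = origin1 Y &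
        dist (origin1 X) (origin2 X) <= e^-1 -> h (origin2 X) = origin2 Y].

End local_metric.

(* min(1, inf {e > 0 | ...}): the value 1 is put inside the infimum because the
   set of admissible e may be empty, and [inf set0 = 0]. *)
Definition approx_dist (R : realType) (T : Type) (A : R -> T -> T -> Prop)
    (X Y : T) : R :=
  inf ([set 1] `|` [set e | [/\ 0 < e, A e X Y & A e Y X]]).

Definition dist_open (R : realType) (T : Type) (d : T -> T -> R) :
    set (set T) :=
  [set U | forall x, U x ->
    exists2 e : R, 0 < e & forall y, d x y < e -> U y].

Definition Dstar_dist (R : realType) (M : pseudoPMetricType R)
    (x y : Dstar_quot M) : R :=
  approx_dist (@papprox R M) (repr x) (repr y).
Definition Dstar2_dist (R : realType) (M : pseudoPMetricType R)
    (x y : Dstar2_quot M) : R :=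
  approx_dist (@p2approx R M) (repr x) (repr y).

(* [measurableType] requires an inhabitant: the one-point space. *)
Section inhabitants.
Context (R : realType) (M : pseudoPMetricType R).

Lemma unit_dist_eq0 (x y : unit) : 0 = 0 :> R <-> x = y.
Proof. by case: x; case: y. Qed.
Lemma unit_dist_triangle (x y z : unit) : (0 : R) <= 0 + 0.
Proof. by rewrite addr0. Qed.
Lemma unit_finite_balls (x : unit) (r : R) :
  finite_set [set y : unit | (0 : R) <= r].
Proof. exact: finite_finset. Qed.

Definition unit_space : discrete_space R :=
  @DiscreteSpace R unit (fun _ _ => 0) unit_dist_eq0 (fun _ _ => erefl)
    unit_dist_triangle unit_finite_balls.
Definition unit_marked : marked_space M :=
  @MarkedSpace R M unit_space (fun _ _ => point).

HB.instance Definition _ := isPointed.Build (Dstar_quot M)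
  (\pi_(Dstar_quot M) (@PointedSpace R M unit_marked tt)).
HB.instance Definition _ := isPointed.Build (Dstar2_quot M)
  (\pi_(Dstar2_quot M) (@Pointed2Space R M unit_marked tt tt)).
End inhabitants.

Definition Dstar (R : realType) (M : pseudoPMetricType R) :=
  g_sigma_algebraType (dist_open (@Dstar_dist R M)).
Definition Dstar2 (R : realType) (M : pseudoPMetricType R) :=
  g_sigma_algebraType (dist_open (@Dstar2_dist R M)).

HB.instance Definition _ (R : realType) (M : pseudoPMetricType R) :=
  Measurable.on (Dstar M).
HB.instance Definition _ (R : realType) (M : pseudoPMetricType R) :=
  Measurable.on (Dstar2 M).

(* [cls o] and [cls2 o v] are the classes written [X, o; m], [X, o, v; m]. *)
Definition cls (R : realType) (M : pseudoPMetricType R) (X : marked_space M)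
    (o : X) : Dstar M :=
  \pi_(Dstar_quot M) (PointedSpace o).
Definition cls2 (R : realType) (M : pseudoPMetricType R) (X : marked_space M)
    (o v : X) : Dstar2 M :=
  \pi_(Dstar2_quot M) (Pointed2Space o v).
Definition rep (R : realType) (M : pseudoPMetricType R) (x : Dstar M) :
    pointed_space M :=
  repr (x : Dstar_quot M).

(* A random element of D'_* is given by its law P. *)
Definition unimodular (R : realType) (M : pseudoPMetricType R)
    (P : probability (Dstar M) R) : Prop :=
  forall g : Dstar2 M -> R, (forall z, 0 <= g z) -> measurable_fun setT g ->
    (\int[P]_x (\esum_(v in [set: rep x]) (g (cls2 (origin (rep x)) v))%:E) =
     \int[P]_x (\esum_(v in [set: rep x]) (g (cls2 v (origin (rep x))))%:E))%E.

HB.instance Definition _ (R : realType) (M M' : pseudoPMetricType R) :=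
  PseudoMetric.on (M * M')%type.

Definition add_mark (R : realType) (M M' : pseudoPMetricType R)
    (X : marked_space M) (z : X -> X -> M') :
    marked_space (M * M')%type :=
  @MarkedSpace R (M * M')%type X (fun x y => (mark x y, z x y)).

(* These generate the product over X * X of the Borel sigma-fields of M'. *)
Definition marking_cylinders (X : Type) (M' : topologicalType) :
    set (set (X -> X -> M')) :=
  [set C | exists x y (U : set M'), open U /\ C = [set z | U (z x y)]].

Definition marking (R : realType) (X : discrete_space R)
    (M' : pseudoPMetricType R) :=
  g_sigma_algebraType (@marking_cylinders X M').
HB.instance Definition _ (R : realType) (X : discrete_space R)
    (M' : pseudoPMetricType R) := Measurable.on (marking X M').

(* The family of the laws of the extra marking (extra randomness allowed) of
   all the deterministic marked spaces. *)
Definition process (R : realType) (M M' : pseudoPMetricType R) :=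
  forall X : marked_space M, probability (marking X M') R.

(* "(almost) every": the requirements bear on the marked spaces satisfying Dom,
   a property which does not depend on the origin and has probability one; the
   values of Z on the other spaces are irrelevant. *)
Definition equivariant_process (R : realType) (M M' : pseudoPMetricType R)
    (P : probability (Dstar M) R) (Z : process M M') : Prop :=
  exists Dom : set (marked_space M),
    let E := [set x : Dstar M | Dom (rep x)] in
    [/\ forall (X Y : marked_space M) (h : X -> Y),
          marked_iso h -> Dom X -> Dom Y,
        measurable E /\ P E = 1%E,
        (* Z_X is the law of the image of Z_Y under the inverse of h *)
        forall (X Y : marked_space M) (h : X -> Y), marked_iso h -> Dom X ->
          forall A : set (marking X M'), measurable A ->
            Z X A = Z Y [set z : marking Y M' |
                          A (fun x x' => z (h x) (h x'))] &
        forall A : set (Dstar (M * M')%type), measurable A ->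
          measurable_fun E (fun x : Dstar M =>
            Z (rep x) [set z : marking (rep x) M' |
                        A (@cls R _ (add_mark z) (origin (rep x)))])].

Section tree.
Context {R : realType} {D : discrete_space R}.
Implicit Types u v w : D.

Definition adj : rel D := fun u v => dist u v == 1.

Definition graph_distance : Prop :=
  forall u v,
    (exists p : seq D,
      [/\ path adj u p, last u p = v & dist u v = (size p)%:R]) /\
    (forall p : seq D,
      path adj u p -> last u p = v -> dist u v <= (size p)%:R).

Definition acyclic : Prop :=
  forall p : seq D, ucycle adj p -> (size p < 3)%N.

Definition ray (r : nat -> D) : Prop :=
  injective r /\ forall n, adj (r n) (r n.+1).

(* In a tree, two rays define the same end iff they eventually coincide. *)
Definition same_end (r s : nat -> D) : Prop :=
  exists i j, forall k, r (i + k)%N = s (j + k)%N.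

Definition one_ended : Prop :=
  (exists r, ray r) /\ forall r s, ray r -> ray s -> same_end r s.

(* Local finiteness follows from the finiteness of balls. *)
Definition one_ended_tree : Prop :=
  [/\ graph_distance, acyclic & one_ended].

(* F(v); the default value v is never used in a one-ended tree. *)
Definition parent v : D :=
  xget v [set w | exists r, [/\ ray r, r 0%N = v & r 1%N = w]].

Definition leaf v : Prop := exists! w, adj v w.

(* Marks are functions of ordered pairs; this says that the mark of an
   unoriented edge is well defined. *)
Definition edge_symmetric (T : Type) (z : D -> D -> T) : Prop :=
  forall u v, adj u v -> z u v = z v u.

Definition separates_leaves (Pi : D -> D -> bool) : Prop :=
  forall r, ray r -> leaf (r 0%N) -> exists n, Pi (r n) (r n.+1).

End tree.
Arguments graph_distance {R} D.
Arguments acyclic {R} D.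
Arguments one_ended {R} D.
Arguments one_ended_tree {R} D.

Definition nonnegR (R : realType) : Type := set_type [set x : R | 0 <= x].
HB.instance Definition _ (R : realType) := PseudoMetric.on (nonnegR R).
HB.instance Definition _ (R : realType) := isPointed.Build (nonnegR R)
  (exist _ 0 (mem_set (lexx (0 : R)))).

Section flows.
Context {R : realType}.

Definition cond (X : marked_space (nonnegR R)) (u v : X) : R :=
  set_val (mark u v).

Definition legal_flow_on (X : marked_space (nonnegR R)) (f : X -> X -> R) :
    Prop :=
  [/\ edge_symmetric f,
      forall u v, adj u v -> 0 <= f u v <= cond u v &
      forall v, ~ leaf v ->
        f v (parent v) = \sum_(w \in [set w | parent w = v]) f w v].

Definition cut_on (X : marked_space (nonnegR R)) (Pi : X -> X -> bool) : Prop :=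
  edge_symmetric Pi /\ separates_leaves Pi.

Context (P : probability (Dstar (nonnegR R)) R).

Definition legal_equivariant_flow (f : process (nonnegR R) R) : Prop :=
  equivariant_process P f /\
  {ae P, forall x, {ae f (rep x), forall z, legal_flow_on z}}.

(* In the pseudometric of [bool], distinct points lie in no common ball; since
   [Dstar_dist] is truncated at 1, it is the same as for the metric on {0,1}. *)
Definition equivariant_cutset (Pi : process (nonnegR R) bool) : Prop :=
  equivariant_process P Pi /\
  {ae P, forall x, {ae Pi (rep x), forall z, cut_on z}}.

(* E[f(o) 1_{o in L}] *)
Definition flow_norm (f : process (nonnegR R) R) : \bar R :=
  (\int[P]_x \int[f (rep x)]_z
     (z (origin (rep x)) (parent (origin (rep x))) *
      \1_[set v | leaf v] (origin (rep x)))%:E)%E.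

(* E[c(o) 1_{o in Pi}] *)
Definition cut_capacity (Pi : process (nonnegR R) bool) : \bar R :=
  (\int[P]_x \int[Pi (rep x)]_z
     (cond (origin (rep x)) (parent (origin (rep x))) *
      (z (origin (rep x)) (parent (origin (rep x))))%:R)%:E)%E.

End flows.

(* Main.v *)
(* No randomness is needed on either side.  In a one-ended tree every vertex has
   finitely many descendants, so the maximal flow h(v) through (v, F(v)) coming
   from the leaves below v is given by h = c at the leaves and h = min(c, S)
   elsewhere, S(v) being the sum of h over the children of v.  Splitting the
   flow proportionally to h from the top downwards, a vertex at which c < S lets
   through only the fraction rho = c/S of what its children offer (rho = 1 at
   the other vertices), and
     f(v) = h(v) rho(F(v)) rho(F(F(v))) ...
   is a deterministic legal flow.  Truncating the product to the ancestors of
   height less than m gives the flow whose minimal cut Pi_m consists of the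
   topmost edges with c < S (or above a leaf) among those of height less than m;
   every leaf has exactly one element of Pi_m above it, so mass transport gives
   c(Pi_m) = E[h(o) (truncated product) 1_{o in L}], which tends to |f| by
   dominated convergence.  Conversely, for an equivariant flow and an equivariant
   cut-set, let f'(v) and p(v) be the mean flow through (v, F(v)) and the
   probability that the cut-set contains it; the p-values above a leaf sum to at
   least 1, so transporting the mass f' of the leaves along their ancestors
   yields |f'| <= E[f'(o) p(o)] <= c(Pi).

   Transport is only used one step at a time, from a vertex to its parent.  The
   parent relation is Borel because the height of a vertex is the number of
   rounds of leaf pruning it survives, and because sums over vertices of Borel
   functions of doubly-pointed spaces are Borel, by induction on Baire classes. *)

Require Import Defs.
From HB Require Import structures.
From mathcomp Require Import all_boot all_order all_algebra.
From mathcomp Require Import all_classical all_reals all_analysis measurable_realfun.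
From mathcomp Require Import ring lra zify.
Import Order.TTheory GRing.Theory Num.Theory.
Import numFieldNormedType.Exports.
Local Open Scope quotient_scope.
Local Open Scope classical_set_scope.
Local Open Scope ring_scope.

Set Implicit Arguments.
Unset Strict Implicit.
Unset Printing Implicit Defensive.

(** Parents, leaves and ends make sense only on a one-ended tree, and every integrand is read off a
    chosen representative of an isomorphism class. Two devices deal with this. Pathwise statements
    are made on a Borel set [E] of probability one that is closed under rerooting; it exists
    because, by mass transport, what holds almost surely at the root holds almost surely at all
    vertices. And the functions that are transported are total Borel functions on isomorphism
    classes, built from vertex sums, finite recursions and limits multiplied by the indicator of
    [E]; their meaning on the tree is recovered on [E] only. The truncation to heights less than m
    is forced: a vertex may have infinitely many ancestors with c < S, hence no topmost one at which
    to cut. Boundedness at the leaves provides the dominating constant when m tends to infinity,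
    while the bound of flows by cut-sets rests on monotone convergence. *)

(** * Distances defined by approximate embeddings *)

Section approx_dist_theory.
Context {R : realType} {T : Type} (A : R -> T -> T -> Prop).

Let has_inf_approx X Y :
  has_inf ([set 1] `|` [set e | [/\ 0 < e, A e X Y & A e Y X]]).
Proof.
split; first by exists 1; left.
by exists 0 => e [->//|[/ltW]].
Qed.

Lemma approx_dist_ge0 X Y : 0 <= approx_dist A X Y.
Proof.
apply: lb_le_inf; first by exists 1; left.
by move=> e [->//|[/ltW]].
Qed.

Lemma approx_dist_le1 X Y : approx_dist A X Y <= 1.
Proof. by apply: ge_inf; [exact: (has_inf_approx X Y).2 | left]. Qed.

Lemma approx_dist_le X Y e :
  0 < e -> A e X Y -> A e Y X -> approx_dist A X Y <= e.
Proof. by move=> *; apply: ge_inf; [exact: (has_inf_approx X Y).2 | right]. Qed.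

Lemma approx_dist_lt X Y e : e <= 1 -> approx_dist A X Y < e ->
  exists e', [/\ 0 < e', e' < e, A e' X Y & A e' Y X].
Proof.
move=> e1 /(inf_lt (has_inf_approx X Y).1) [e' [->|[? ? ?]] lt_e].
  by move: (lt_le_trans lt_e e1); rewrite ltxx.
by exists e'.
Qed.

Lemma approx_dist_sym X Y : approx_dist A X Y = approx_dist A Y X.
Proof.
by congr inf; apply/seteqP; split=> e [->|[? ? ?]]; by [left | right].
Qed.

Lemma approx_dist_eq0 X Y :
  (forall e, 0 < e -> A e X Y /\ A e Y X) -> approx_dist A X Y = 0.
Proof.
move=> AXY; apply/eqP; rewrite eq_le approx_dist_ge0 andbT.
apply/ler_addgt0Pr => e e0; rewrite add0r.
by have [? ?] := AXY _ e0; exact: approx_dist_le.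
Qed.

Hypothesis A_comp : forall e1 e2 X Y Z, 0 < e1 -> 0 < e2 -> e1 + e2 < 1 ->
  A e1 X Y -> A e2 Y Z -> A (e1 + e2) X Z.

(** The truncation at 1 acts twice: it settles the case where the right-hand side is at least 1, and
    otherwise it leaves room for near-optimal e1 and e2 with e1 + e2 < 1, the range in which
    [A_comp] composes approximations. *)
Lemma approx_dist_triangle X Y Z :
  approx_dist A X Z <= approx_dist A X Y + approx_dist A Y Z.
Proof.
have [ge1|lt1] := leP 1 (approx_dist A X Y + approx_dist A Y Z).
  exact: le_trans (approx_dist_le1 _ _) ge1.
apply/ler_addgt0Pr => e e0.
(* Adding d to both distances costs at most e in all and keeps their sum at most 1. *)
pose d := Num.min (e / 2) ((1 - (approx_dist A X Y + approx_dist A Y Z)) / 2).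
have d0 : 0 < d by rewrite lt_min !divr_gt0 ?subr_gt0.
have dle : d <= e / 2 by rewrite ge_min lexx.
have dle' : d <= (1 - (approx_dist A X Y + approx_dist A Y Z)) / 2.
  by rewrite ge_min lexx orbT.
have XY0 := approx_dist_ge0 X Y; have YZ0 := approx_dist_ge0 Y Z.
have [||e1 [e10 e1lt AXY AYX]] := @approx_dist_lt X Y (approx_dist A X Y + d).
- lra.
- by rewrite ltrDl.
have [||e2 [e20 e2lt AYZ AZY]] := @approx_dist_lt Y Z (approx_dist A Y Z + d).
- lra.
- by rewrite ltrDl.
have e12 : e1 + e2 < 1 by lra.
apply: (@le_trans _ _ (e1 + e2)); last lra.
apply: approx_dist_le; first by rewrite addr_gt0.
- exact: A_comp AXY AYZ.
- by rewrite addrC; apply: A_comp AZY AYX => //; rewrite addrC.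
Qed.

Lemma approx_dist_congr X X' Y : approx_dist A X X' = 0 ->
  approx_dist A X Y = approx_dist A X' Y.
Proof.
move=> XX'; apply/eqP; rewrite eq_le.
have := approx_dist_triangle X X' Y; have := approx_dist_triangle X' X Y.
by rewrite (approx_dist_sym X' X) XX' !add0r => ? ?; apply/andP.
Qed.

End approx_dist_theory.

Section pseudodistance.
Context {R : realType} {T : Type} (d : T -> T -> R).

Hypothesis d_triangle : forall x y z, d x z <= d x y + d y z.

Lemma dist_open_interior (Phi : set T) :
  dist_open d [set y | exists2 e : R, 0 < e & forall z, d y z < e -> Phi z].
Proof.
move=> y [e e0 ePhi]; exists (e / 2); first by rewrite divr_gt0.
move=> z dyz; exists (e / 2); first by rewrite divr_gt0.
by move=> w dzw; apply: ePhi; have := d_triangle y z w; lra.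
Qed.

End pseudodistance.

(** * The local pseudometrics and their invariance under isomorphism *)

Section embeddings.
Context {R : realType} {M : pseudoPMetricType R}.

Lemma distxx (X : discrete_space R) (x : X) : dist x x = 0.
Proof. exact/dist_eq0. Qed.

Lemma dist_ge0 (X : discrete_space R) (x y : X) : 0 <= dist x y.
Proof.
have := dist_triangle x y x; rewrite distxx (dist_sym y x) -mulr2n.
by rewrite pmulrn_lge0.
Qed.

Lemma mark_within_refl (a : M) e : 0 <= e -> mark_within a a e.
Proof. by move=> e0 e' ee'; apply: ball_center (PosNum (le_lt_trans e0 ee')). Qed.

Lemma mark_within_sym (a b : M) e : mark_within a b e -> mark_within b a e.
Proof. by move=> ab e' /ab/ball_sym. Qed.

Lemma mark_within_le (a b : M) e e' :
  e <= e' -> mark_within a b e -> mark_within a b e'.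
Proof. by move=> ee' ab e'' /(le_lt_trans ee') /ab. Qed.

Lemma mark_within_triangle (a b c : M) e1 e2 :
  mark_within a b e1 -> mark_within b c e2 -> mark_within a c (e1 + e2).
Proof.
move=> ab bc e' lt_e; have -> : e' =
  (e1 + (e' - (e1 + e2)) / 2) + (e2 + (e' - (e1 + e2)) / 2) by lra.
by apply: ball_triangle; [apply: ab | apply: bc]; lra.
Qed.

(** The image under [h] of the ball of radius 1/(e1+e2) must lie in the ball of radius 1/e2.
    Distances grow by at most e1, and 1/e2 - 1/(e1+e2) = e1/(e2(e1+e2)) is at least e1 because
    e2(e1+e2) < 1. The second conclusion serves to follow a second origin through the
    composition. *)
Lemma almost_embedding_comp e1 e2 (X Y Z : marked_space M) (o : X)
    (h : X -> Y) (k : Y -> Z) : 0 < e1 -> 0 < e2 -> e1 + e2 < 1 ->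
  almost_embedding e1 o h -> almost_embedding e2 (h o) k ->
  almost_embedding (e1 + e2) o (k \o h) /\
  (forall x, dist o x <= (e1 + e2)^-1 -> dist (h o) (h x) <= e2^-1).
Proof.
move=> e10 e20 lt1 [hinj hd hm] [kinj kd km].
have le1 x : dist o x <= (e1 + e2)^-1 -> dist o x <= e1^-1.
  move=> /le_trans; apply; rewrite lef_pV2 ?posrE ?addr_gt0//; lra.
have bound : (e1 + e2)^-1 + e1 <= e2^-1.
  have -> : e2^-1 = (e1 + e2)^-1 + e1 * (e2 * (e1 + e2))^-1.
    by field; rewrite !gt_eqF ?addr_gt0.
  rewrite lerD2l ler_pMr// -[1]invr1 lef_pV2 ?posrE ?mulr_gt0 ?addr_gt0//; nra.
have le2 x : dist o x <= (e1 + e2)^-1 -> dist (h o) (h x) <= e2^-1.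
  move=> ox; apply: le_trans bound.
  have := hd o x; rewrite !inE /= distxx invr_ge0 (ltW e10) => /(_ isT (le1 _ ox)).
  rewrite ler_norml => /andP[_]; lra.
split=> //; split.
- move=> x y; rewrite !inE /= => ox oy /kinj kxy.
  by apply: hinj; rewrite ?inE /= ?le1//; apply: kxy; rewrite inE /= le2.
- move=> x y; rewrite !inE /= => ox oy.
  rewrite -(subrKA (dist (h x) (h y))) addrC; apply: le_trans (ler_normD _ _) _.
  by apply: lerD; [apply: hd | apply: kd]; rewrite inE /= ?le1 ?le2.
- move=> x y; rewrite !inE /= => ox oy; apply: mark_within_triangle.
  + by apply: hm; rewrite inE /= le1.
  + by apply: km; rewrite inE /= le2.
Qed.

Lemma almost_embedding_iso e (X Y : marked_space M) (o : X) (h : X -> Y) :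
  0 < e -> marked_iso h -> almost_embedding e o h.
Proof.
move=> e0 [hb hd hm]; split.
- by move=> x y _ _; exact: bij_inj.
- by move=> x y _ _; rewrite hd subrr normr0 ltW.
- by move=> x y _ _; rewrite hm; apply: mark_within_refl; exact: ltW.
Qed.

Lemma papprox_comp e1 e2 (X Y Z : pointed_space M) :
  0 < e1 -> 0 < e2 -> e1 + e2 < 1 ->
  papprox e1 X Y -> papprox e2 Y Z -> papprox (e1 + e2) X Z.
Proof.
move=> e10 e20 lt1 [h [hX ho]] [k [kY ko]]; exists (k \o h).
rewrite -ho in kY; rewrite /= ho ko; split=> //.
by have [] := almost_embedding_comp e10 e20 lt1 hX kY.
Qed.

Lemma p2approx_comp e1 e2 (X Y Z : pointed2_space M) :
  0 < e1 -> 0 < e2 -> e1 + e2 < 1 ->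
  p2approx e1 X Y -> p2approx e2 Y Z -> p2approx (e1 + e2) X Z.
Proof.
move=> e10 e20 lt1 [h [hX ho hv]] [k [kY ko kv]]; exists (k \o h).
rewrite -ho in kY; have [kh le2] := almost_embedding_comp e10 e20 lt1 hX kY.
split=> //=; first by rewrite ho ko.
move=> ov; have {}hv : h (origin2 X) = origin2 Y.
  apply: hv; apply: le_trans ov _; rewrite lef_pV2 ?posrE ?addr_gt0//; lra.
by rewrite hv kv // -hv -ho le2.
Qed.

Lemma papprox_piso e (X Y : pointed_space M) :
  0 < e -> piso X Y -> papprox e X Y.
Proof.
by move=> e0 [h [ih ho]]; exists h; split=> //; exact: almost_embedding_iso.
Qed.

Lemma p2approx_p2iso e (X Y : pointed2_space M) :
  0 < e -> p2iso X Y -> p2approx e X Y.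
Proof.
by move=> e0 [h [ih h1 h2]]; exists h; split=> //; exact: almost_embedding_iso.
Qed.

Lemma approx_dist_piso (X Y : pointed_space M) :
  piso X Y -> approx_dist (@papprox R M) X Y = 0.
Proof.
move=> XY; apply: approx_dist_eq0 => e e0; split; apply: papprox_piso => //.
have : piso_rel X Y by exact/asboolP.
by rewrite piso_sym => /asboolP.
Qed.

Lemma approx_dist_p2iso (X Y : pointed2_space M) :
  p2iso X Y -> approx_dist (@p2approx R M) X Y = 0.
Proof.
move=> XY; apply: approx_dist_eq0 => e e0; split; apply: p2approx_p2iso => //.
have : p2iso_rel X Y by exact/asboolP.
by rewrite p2iso_sym => /asboolP.
Qed.

Lemma piso_cls (X : marked_space M) (o : X) :
  piso (PointedSpace o) (rep (cls o)).
Proof.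
have : piso_rel (repr (\pi_(Dstar_quot M) (PointedSpace o))) (PointedSpace o).
  by apply/eqmodP; rewrite reprK.
by rewrite piso_sym => /asboolP.
Qed.

Lemma p2iso_cls2 (X : marked_space M) (o v : X) :
  p2iso (Pointed2Space o v) (repr (cls2 o v : Dstar2_quot M)).
Proof.
have : p2iso_rel (repr (\pi_(Dstar2_quot M) (Pointed2Space o v)))
    (Pointed2Space o v) by apply/eqmodP; rewrite reprK.
by rewrite p2iso_sym => /asboolP.
Qed.

Lemma cls_rep (x : Dstar M) : cls (origin (rep x)) = x.
Proof. by rewrite /cls /rep; case E: (repr _) => [X o] /=; rewrite -E reprK. Qed.

Lemma cls_iso (X Y : marked_space M) (h : X -> Y) (o : X) :
  marked_iso h -> cls (h o) = cls o.
Proof.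
by move=> ih; apply/esym/eqmodP/asboolP; exists h.
Qed.

Lemma cls2_iso (X Y : marked_space M) (h : X -> Y) (o v : X) :
  marked_iso h -> cls2 (h o) (h v) = cls2 o v.
Proof.
by move=> ih; apply/esym/eqmodP/asboolP; exists h.
Qed.

Definition rep2 (x : Dstar2 M) : pointed2_space M := repr (x : Dstar2_quot M).

Lemma rep_cls_iso (X : marked_space M) (o : X) :
  exists2 h : X -> rep (cls o), marked_iso h & h o = origin (rep (cls o)).
Proof. by have [h [ih ho]] := piso_cls o; exists h. Qed.

Lemma Dstar_dist_sym (x y : Dstar M) : Dstar_dist x y = Dstar_dist y x.
Proof. exact: approx_dist_sym. Qed.

Lemma Dstar2_dist_sym (x y : Dstar2 M) : Dstar2_dist x y = Dstar2_dist y x.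
Proof. exact: approx_dist_sym. Qed.

Lemma Dstar_dist_triangle (x y z : Dstar M) :
  Dstar_dist x z <= Dstar_dist x y + Dstar_dist y z.
Proof. exact/approx_dist_triangle/papprox_comp. Qed.

Lemma Dstar2_dist_triangle (x y z : Dstar2 M) :
  Dstar2_dist x z <= Dstar2_dist x y + Dstar2_dist y z.
Proof. exact/approx_dist_triangle/p2approx_comp. Qed.

Lemma Dstar2_distxx (x : Dstar2 M) : Dstar2_dist x x = 0.
Proof. exact/approx_dist_p2iso/asboolP/p2iso_refl. Qed.

Lemma Dstar_distxx (x : Dstar M) : Dstar_dist x x = 0.
Proof. exact/approx_dist_piso/asboolP/piso_refl. Qed.

(** [Dstar_dist] is computed on chosen representatives; isomorphic spaces being at distance 0, any
    other representatives give the same value. *)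
Lemma Dstar_dist_cls (X Y : marked_space M) (o : X) (o' : Y) :
  Dstar_dist (cls o) (cls o') =
  approx_dist (@papprox R M) (PointedSpace o) (PointedSpace o').
Proof.
have congr := approx_dist_congr papprox_comp.
rewrite (congr _ _ _ (approx_dist_piso (piso_cls o))) approx_dist_sym.
rewrite (congr _ _ _ (approx_dist_piso (piso_cls o'))) approx_dist_sym.
by [].
Qed.

Lemma Dstar2_dist_cls (X Y : marked_space M) (o v : X) (o' v' : Y) :
  Dstar2_dist (cls2 o v) (cls2 o' v') =
  approx_dist (@p2approx R M) (Pointed2Space o v) (Pointed2Space o' v').
Proof.
have congr := approx_dist_congr p2approx_comp.
rewrite (congr _ _ _ (approx_dist_p2iso (p2iso_cls2 o v))) approx_dist_sym.
rewrite (congr _ _ _ (approx_dist_p2iso (p2iso_cls2 o' v'))) approx_dist_sym.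
by [].
Qed.

End embeddings.

(** * Borel sigma-fields of the local metrics *)

Section dist_measurable.
Context {R : realType} {T : pointedType} (d : T -> T -> R).
Local Notation TT := (g_sigma_algebraType (dist_open d)).

Lemma dist_open_measurable (U : set TT) : dist_open d U -> measurable U.
Proof. by move=> oU; apply: sub_sigma_algebra. Qed.

Lemma measurable_fun_dist_open d' (T' : measurableType d') (f : T' -> TT) :
  (forall U, dist_open d U -> measurable (f @^-1` U)) -> measurable_fun setT f.
Proof.
move=> fU; apply: (@measurability _ _ T' TT setT f (dist_open d)) => //.
by move=> _ [U oU <-]; rewrite setTI; exact: fU.
Qed.

Lemma measurable_fun_lsc (f : TT -> R) :
  (forall a, dist_open d [set x | a < f x]) -> measurable_fun setT f.
Proof.
move=> fa; apply: (measurability _ (RGenOInfty.measurableE R)) => //.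
move=> _ [_ [a ->] <-]; rewrite setTI; apply: dist_open_measurable.
by rewrite (_ : _ @^-1` _ = [set x | a < f x])//; apply/seteqP; split=> x /=;
  rewrite in_itv/= andbT.
Qed.

Definition dist_continuous (f : T -> R) := forall x (e : R), 0 < e ->
  exists2 e' : R, 0 < e' & forall y, d x y < e' -> `|f y - f x| <= e.

Lemma measurable_fun_dist_continuous (f : TT -> R) :
  dist_continuous f -> measurable_fun setT f.
Proof.
move=> fc; apply: measurable_fun_lsc => a x /= afx.
have [|e e0 fe] := fc x ((f x - a) / 2); first by rewrite divr_gt0 ?subr_gt0.
by exists e => // y /fe; rewrite ler_norml => /andP[? _]; lra.
Qed.

End dist_measurable.

Lemma finite_uniform {R : realDomainType} (T : choiceType) (A : set T)
    (P : T -> R -> Prop) :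
  finite_set A -> (forall x e e', e' <= e -> P x e -> P x e') ->
  (forall x, A x -> exists2 e : R, 0 < e & P x e) ->
  exists2 e : R, 0 < e & forall x, A x -> P x e.
Proof.
move=> /finite_seqP[s ->] Ple; elim: s => [_|a s IHs AP].
  by exists 1.
have [|e e0 eP] := IHs; first by move=> x xs; apply: AP; rewrite /= inE xs orbT.
have [|e' e'0 e'P] := AP a; first by rewrite /= inE eqxx.
exists (Num.min e e'); first by rewrite lt_min e0.
move=> x; rewrite /= inE => /orP[/eqP ->|xs].
  by apply: Ple e'P; rewrite ge_min lexx orbT.
by apply: Ple (eP x xs); rewrite ge_min lexx.
Qed.

Lemma finite_injective_onto (T : choiceType) (A : set T) (f : T -> T) :
  finite_set A -> {homo f : x / A x} -> (forall x y, A x -> A y -> f x = f y -> x = y) ->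
  forall y, A y -> exists2 x, A x & f x = y.
Proof.
move=> /finite_seqP[s ->] fA finj y ys.
have [|||_] := @uniq_min_size _ (map f (undup s)) (undup s).
- by rewrite map_inj_in_uniq ?undup_uniq// => u v; rewrite !mem_undup; exact: finj.
- by move=> _ /mapP[u us ->]; move: us; rewrite !mem_undup; exact: fA.
- by rewrite size_map.
move=> /(_ y); rewrite mem_undup [y \in s]ys => /mapP[x].
by rewrite mem_undup => xs ->; exists x.
Qed.

(** * Nearby spaces match on whole balls *)

Section matching.
Context {R : realType} {M : pseudoPMetricType R}.

(** Unlike in [almost_embedding], radius and precision are independent, and the ball of [Y] has to
    be covered: this allows sums over balls to be compared term by term. *)
Definition ball_match (r e : R) (X Y : pointed_space M) (h : X -> Y) : Prop :=
  let B := [set x | dist (origin X) x <= r] in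
  [/\ h (origin X) = origin Y,
      forall x x', B x -> B x' -> h x = h x' -> x = x',
      forall x x', B x -> B x' -> `|dist (h x) (h x') - dist x x'| <= e,
      forall x x', B x -> B x' ->
        mark_within (mark x x') (mark (h x) (h x')) e &
      forall y, dist (origin Y) y <= r -> exists2 x, B x & h x = y].

(** As balls are finite, no distance from the origin of [X] lies in (r, r + a] for some a > 0. A
    forward injection [h] followed by a backward one [k] changes distances to the origin by less
    than a, so [k \o h] maps the finite r-ball injectively into itself, hence onto, and [h] reaches
    every point of the r-ball of [Y]. *)
Lemma ball_match_near (X : pointed_space M) (r e : R) : 0 <= r -> 0 < e ->
  exists2 e' : R, 0 < e' & forall Y, approx_dist (@papprox R M) X Y < e' ->
    exists h : X -> Y, ball_match r e h.
Proof.
move=> r0 e0.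
have [||a a0 gap] := @finite_uniform R _ _
    (fun x a => dist (origin X) x <= r + a -> dist (origin X) x <= r)
    (finite_balls (origin X) (r + 1)).
- by move=> x a a' a'a gap le_a; apply: gap; rewrite (le_trans le_a)// lerD2l.
- move=> x _; have [xr|rx] := leP (dist (origin X) x) r; first by exists 1.
  by exists ((dist (origin X) x - r) / 2); [rewrite divr_gt0 ?subr_gt0 | lra].
(* The error c will be less than b / 2: the entry a absorbs two errors, 2e gives c <= e, and the
   last entry makes 1/c exceed r + 2, so that all the points met lie in the domains of [h] and
   [k]. *)
pose b := Num.min (Num.min 1 a) (Num.min (2 * e) (2 * (r + 2)^-1)).
have b0 : 0 < b by rewrite !lt_min ltr01 a0 !mulr_gt0 ?invr_gt0//; lra.
have b1 : b <= 1 by rewrite !ge_min lexx.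
have ba : b <= a by rewrite !ge_min lexx !orbT.
have be : b <= 2 * e by rewrite !ge_min lexx !orbT.
have br : b <= 2 * (r + 2)^-1 by rewrite !ge_min lexx !orbT.
exists (b / 2); first by rewrite divr_gt0.
move=> Y XY_lt; have [|c [c0 cb XY YX]] := approx_dist_lt _ XY_lt; first lra.
have ci0 : 0 <= c^-1 by rewrite invr_ge0 ltW.
have rc : r + 2 < c^-1.
  by rewrite -[r + 2]invrK ltf_pV2 ?posrE ?invr_gt0//; lra.
case: XY => h [[hi hd hm] ho]; case: YX => k [[ki kd km] ko].
have hB x : dist (origin X) x <= r -> dist (origin Y) (h x) <= r + c.
  move=> xr; have : `|dist (h (origin X)) (h x) - dist (origin X) x| <= c.
    by apply: hd; rewrite inE /= ?distxx //; lra.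
  by rewrite ho ler_norml => /andP[_]; lra.
have kB y : dist (origin Y) y <= r + c -> dist (origin X) (k y) <= r.
  move=> yr; have : `|dist (k (origin Y)) (k y) - dist (origin Y) y| <= c.
    by apply: kd; rewrite inE /= ?distxx //; lra.
  by rewrite ko ler_norml => /andP[_ le_c]; apply: gap => /=; lra.
exists h; split=> //.
- by move=> x x' /= xr x'r; apply: hi; rewrite inE /=; lra.
- move=> x x' /= xr x'r; apply: le_trans (hd _ _ _ _) _; rewrite ?inE /=; lra.
- move=> x x' /= xr x'r; apply: mark_within_le (hm _ _ _ _); rewrite ?inE /=; lra.
move=> y yr.
have [|||x xB kx] := @finite_injective_onto _ _ (k \o h) (finite_balls (origin X) r) _ _ (k y).
- by move=> x /= xr; apply/kB/hB.
- move=> x x' /= xr x'r kxx'; have := hB _ xr; have := hB _ x'r => hx' hx.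
  apply: hi; rewrite ?inE /=; [lra|lra|].
  by apply: ki; rewrite ?inE /=; [lra|lra|].
- by apply: kB; lra.
exists x => //; apply: ki kx; rewrite inE /=; last lra.
by have := hB _ xB; lra.
Qed.

(** With radius r + 1/e + e, the ball of radius 1/e around a point of the r-ball lies where [h] is
    controlled, and the one around its image lies where [h] is onto; [h] and its partial inverse [g]
    are the two approximations. *)
Lemma pair_match_near (x : Dstar M) (r e : R) : 0 <= r -> 0 < e ->
  exists2 e' : R, 0 < e' & forall y, Dstar_dist x y < e' ->
    exists h : rep x -> rep y, ball_match (r + e^-1 + e) e h /\
      forall u v, dist (origin (rep x)) u <= r -> dist (origin (rep x)) v <= r ->
        Dstar2_dist (cls2 u v) (cls2 (h u) (h v)) <= e.
Proof.
move=> r0 e0; set s := r + e^-1 + e.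
have ei0 : 0 < e^-1 by rewrite invr_gt0.
have [||e' e'0 near] := @ball_match_near (rep x) s e; rewrite /s //.
  by rewrite !addr_ge0// ltW.
exists e' => // y /near[h hM]; exists h; split=> // u v ur vr.
rewrite Dstar2_dist_cls; case: hM => ho hi hd hm hs.
pose g z := xget (origin (rep x)) [set w | dist (origin (rep x)) w <= s /\ h w = z].
have in_s w : dist u w <= e^-1 -> dist (origin (rep x)) w <= s.
  by move=> uw; have := dist_triangle (origin (rep x)) u w; rewrite /s; lra.
have gP z : dist (h u) z <= e^-1 -> dist (origin (rep x)) (g z) <= s /\ h (g z) = z.
  move=> hz; have [|w ws hw] := hs z.
    have : `|dist (h (origin (rep x))) (h u) - dist (origin (rep x)) u| <= e.
      by apply: hd => /=; rewrite ?distxx -/s // /s; lra.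
    rewrite ho ler_norml => /andP[_ ?].
    by have := dist_triangle (origin (rep y)) (h u) z; rewrite /s; lra.
  by rewrite /g; case: xgetP => [_ -> //|/(_ w)]; case.
have gh w : dist (origin (rep x)) w <= s -> g (h w) = w.
  move=> ws; rewrite /g; case: xgetP => [z _ [zs /hi]|/(_ w)]; last by case.
  by apply.
have us : dist (origin (rep x)) u <= s by rewrite /s; lra.
have vs : dist (origin (rep x)) v <= s by rewrite /s; lra.
apply: approx_dist_le => //.
  exists h; split=> //; split.
  - by move=> w w'; rewrite !inE /= => /in_s ? /in_s ?; exact: hi.
  - by move=> w w'; rewrite !inE /= => /in_s ? /in_s ?; exact: hd.
  - by move=> w w'; rewrite !inE /= => /in_s ? /in_s ?; exact: hm.
exists g; rewrite /= !gh//; split=> //; split.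
- move=> z z'; rewrite !inE /= => /gP[_ gz] /gP[_ gz'] gzz'.
  by rewrite -gz -gz' gzz'.
- move=> z z'; rewrite !inE /= => /gP[zs gz] /gP[zs' gz'].
  by rewrite distrC -{1}gz -{1}gz'; exact: hd.
- move=> z z'; rewrite !inE /= => /gP[zs gz] /gP[zs' gz'].
  by apply: mark_within_sym; rewrite -{2}gz -{2}gz'; exact: hm.
Qed.

End matching.

(** * Induction on Baire classes *)

Section borel_induction.
Context {R : realType} {T : pointedType} (d : T -> T -> R).
Hypotheses (dxx : forall x, d x x = 0) (d_sym : forall x y, d x y = d y x).
Hypothesis d_triangle : forall x y z, d x z <= d x y + d y z.
Local Notation TT := (g_sigma_algebraType (dist_open d)).
Implicit Types f g : T -> R.

Lemma dist_continuous_cst (c : R) : dist_continuous d (fun=> c).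
Proof. by move=> x e e0; exists 1 => // y _; rewrite subrr normr0 ltW. Qed.

Lemma dist_continuousD f g : dist_continuous d f -> dist_continuous d g ->
  dist_continuous d (fun x => f x + g x).
Proof.
move=> cf cg x e e0; have e20 : 0 < e / 2 by rewrite divr_gt0.
have [e1 e10 fe] := cf x _ e20; have [e2 e20' ge] := cg x _ e20.
exists (Num.min e1 e2); first by rewrite lt_min e10.
move=> y; rewrite lt_min => /andP[/fe fy /ge gy].
by rewrite opprD addrACA [e]splitr (le_trans (ler_normD _ _))// lerD.
Qed.

Lemma dist_continuousM f g : dist_continuous d f -> dist_continuous d g ->
  dist_continuous d (fun x => f x * g x).
Proof.
move=> cf cg x e e0; pose k := `|f x| + `|g x| + 1.
have k0 : 0 < k by rewrite ltr_wpDl ?addr_ge0.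
have m0 : 0 < Num.min 1 (e / k) by rewrite lt_min ltr01 divr_gt0.
have [e1 e10 fe] := cf x _ m0; have [e2 e20' ge] := cg x _ m0.
exists (Num.min e1 e2); first by rewrite lt_min e10.
move=> y; rewrite lt_min => /andP[/fe fy /ge gy].
have -> : f y * g y - f x * g x = (f y - f x) * g y + f x * (g y - g x) by ring.
rewrite (le_trans (ler_normD _ _))// !normrM.
have gy1 : `|g y| <= `|g x| + 1.
  rewrite -[g y](subrK (g x)) addrC (le_trans (ler_normD _ _))// lerD2l.
  by rewrite (le_trans gy)// ge_min lexx.
have {}fy : `|f y - f x| <= e / k by rewrite (le_trans fy)// ge_min lexx orbT.
have {}gy : `|g y - g x| <= e / k by rewrite (le_trans gy)// ge_min lexx orbT.
have <- : e / k * (`|g x| + 1) + `|f x| * (e / k) = e.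
  by rewrite /k; field; rewrite gt_eqF.
by apply: lerD; apply: ler_pM.
Qed.

Lemma dist_continuous_lip f : (forall x y, f y - f x <= d x y) ->
  dist_continuous d f.
Proof.
move=> lipf x e e0; exists e => // y dxy; rewrite ler_norml.
by have := lipf x y; have := lipf y x; rewrite (d_sym y x) => *; apply/andP; lra.
Qed.

Lemma dist_continuous_min (c : R) f : dist_continuous d f ->
  dist_continuous d (fun x => Num.min c (f x)).
Proof.
move=> cf x e e0; have [e' e'0 fe] := cf x _ e0; exists e' => // y /fe.
rewrite !ler_norml => /andP[? ?].
by case: (leP c (f y)); case: (leP c (f x)) => *; apply/andP; lra.
Qed.

Inductive baire : (T -> R) -> Prop :=
| baire_continuous f : dist_continuous d f -> baire f
| baire_limit (f_ : nat -> T -> R) f : (forall n, baire (f_ n)) ->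
    (forall x, f_ ^~ x @ \oo --> f x) -> baire f.

(** Double induction: one argument is held constant while the other passes to a limit. *)
Lemma baire_binop (op : R -> R -> R) :
  (forall f g, dist_continuous d f -> dist_continuous d g ->
    dist_continuous d (fun x => op (f x) (g x))) ->
  (forall (u v : nat -> R) a b, u @ \oo --> a -> v @ \oo --> b ->
    (fun n => op (u n) (v n)) @ \oo --> op a b) ->
  forall f g, baire f -> baire g -> baire (fun x => op (f x) (g x)).
Proof.
move=> op_cont op_cvg f g bf bg.
elim: bf => {}f => [cf|f_ ? IHf f_f].
  elim: bg => {}g => [cg|g_ ? IHg g_g]; first exact/baire_continuous/op_cont.
  apply: (baire_limit IHg) => x; apply: op_cvg (g_g x); exact: cvg_cst.
apply: (baire_limit IHf) => x; apply: op_cvg (f_f x) _; exact: cvg_cst.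
Qed.

Lemma baireD f g : baire f -> baire g -> baire (fun x => f x + g x).
Proof.
apply: (@baire_binop +%R); first exact: dist_continuousD.
by move=> u v a b; exact: cvgD.
Qed.

Lemma baireM f g : baire f -> baire g -> baire (fun x => f x * g x).
Proof.
apply: (@baire_binop *%R); first exact: dist_continuousM.
by move=> u v a b; exact: cvgM.
Qed.

Lemma baire_cst c : baire (fun=> c).
Proof. exact/baire_continuous/dist_continuous_cst. Qed.

(** The distance to the complement; the added 1 keeps the infimum meaningful when [U] is the whole
    space. *)
Let distC (U : set T) x := inf ([set 1] `|` [set d x y | y in ~` U]).

Let d_ge0 x y : 0 <= d x y.
Proof. by have := d_triangle x y x; rewrite dxx (d_sym y x); lra. Qed.

Let has_inf_distC (U : set T) x : has_inf ([set 1] `|` [set d x y | y in ~` U]).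
Proof.
split; first by exists 1; left.
by exists 0 => _ [->//|[y _ <-]].
Qed.

Let distC_lip U x y : distC U y - distC U x <= d x y.
Proof.
rewrite lerBlDr -lerBlDl; apply: lb_le_inf; first by exists 1; left.
move=> _ [->|[z Uz <-]].
  rewrite lerBlDr; apply: (@le_trans _ _ 1); last by rewrite lerDl.
  by apply: ge_inf; [exact: (has_inf_distC U y).2 | left].
rewrite lerBlDr; apply: (@le_trans _ _ (d y z)).
  by apply: ge_inf; [exact: (has_inf_distC U y).2 | right; exists z].
by rewrite addrC (d_sym x y); exact: d_triangle.
Qed.

(** The indicator is the limit of the minimum of 1 and n times the distance to the complement, which
    is positive inside an open set and 0 outside. *)
Lemma baire_open U : dist_open d U -> baire \1_U.
Proof.
move=> oU; apply: (@baire_limit (fun n x => Num.min 1 (n%:R * distC U x))).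
  move=> n; apply/baire_continuous/dist_continuous_min/dist_continuousM.
    exact: dist_continuous_cst.
  exact/dist_continuous_lip/distC_lip.
move=> x; rewrite indicE; have [Ux|Ux] := boolP (x \in U).
  move: Ux; rewrite inE => /oU[e e0 eU].
  have D0 : Num.min 1 e <= distC U x.
    apply: lb_le_inf; first by exists 1; left.
    move=> _ [->|[y Uy <-]]; first by rewrite ge_min lexx.
    by rewrite ge_min; apply/orP; right; rewrite leNgt; apply/negP => /eU.
  have {}D0 : 0 < distC U x by rewrite (lt_le_trans _ D0)// lt_min ltr01.
  apply: cvg_near_cst; near=> n; apply/min_idPl.
  rewrite -ler_pdivrMr// mul1r; near: n; exact: nbhs_infty_ger.
have D0 : distC U x = 0.
  apply/eqP; rewrite eq_le; apply/andP; split.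
    apply: ge_inf; first exact: (has_inf_distC U x).2.
    by right; exists x => //=; move: Ux; rewrite notin_setE.
  apply: lb_le_inf; first by exists 1; left.
  by move=> _ [->//|[y _ <-]].
rewrite D0; under eq_fun do rewrite mulr0 (min_idPr ler01).
exact: cvg_cst.
Unshelve. all: by end_near. Qed.

Lemma baire_indic (A : set TT) : measurable A -> baire \1_A.
Proof.
apply: (@smallest_sub _ (sigma_algebra setT) _ [set A | baire \1_A]); last first.
  by move=> U; exact: baire_open.
split=> /=.
- by rewrite indic0; exact: baire_cst.
- move=> B bB; rewrite setTD (_ : \1_(~` B) = fun x => 1 + (-1) * \1_B x).
    by apply: baireD; [exact: baire_cst | apply: baireM => //; exact: baire_cst].
  by apply/funext => x; rewrite !indicE in_setC; case: (x \in B) => /=; ring.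
move=> F bF; apply: (@baire_limit (fun n => \1_(\big[setU/set0]_(i < n) F i))).
  elim=> [|n IHn]; first by rewrite big_ord0 indic0; exact: baire_cst.
  rewrite big_ord_recr/=; set G := \big[_/_]_(_ < _) _ in IHn *.
  rewrite (_ : \1_(G `|` F n) = fun x => (\1_G x + \1_(F n) x) + (-1) * (\1_G x * \1_(F n) x)).
    by do ![apply: baireD | apply: baireM] => //; exact: baire_cst.
  apply/funext => x; rewrite !indicE in_setU.
  by case: (x \in G); case: (x \in F n) => /=; ring.
move=> x; apply: cvg_near_cst.
rewrite !indicE; have [|Fx] := boolP (x \in \bigcup_k F k).
  rewrite inE => -[k _ Fkx]; near=> n.
  rewrite indicE mem_set// -bigcup_mkord; exists k => //=.
  by near: n; exact: nbhs_infty_gt.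
near=> n; rewrite indicE memNset// -bigcup_mkord => -[k _ Fkx].
by move: Fx; rewrite notin_setE; apply; exists k.
Unshelve. all: by end_near. Qed.

Import HBSimple.

(** Measurable functions are limits of combinations of indicators, and the sets with a Baire
    indicator form a sigma-algebra containing the open sets. This reduces the measurability of
    vertex sums and of decorations to the continuous case. *)
Theorem borel_fun_ind (P : (T -> R) -> Prop) :
  (forall f, dist_continuous d f -> P f) ->
  (forall (f_ : nat -> T -> R) f, (forall n, P (f_ n)) ->
    (forall x, f_ ^~ x @ \oo --> f x) -> P f) ->
  forall f : TT -> R, measurable_fun setT f -> P f.
Proof.
move=> Pcont Plim f mf.
have baireP g : baire g -> P g by elim=> [{}g /Pcont//|g_ {}g _]; exact: Plim.
apply: baireP.
have [||g gf] := @approximation_sfun _ TT R (EFin \o f) setT _ _ => //.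
  exact/measurable_EFinP.
refine (@baire_limit (fun n (x : TT) => g n x) f _ _) => [n|x]; last first.
  by have /fine_cvgP[_] := gf x Logic.I.
have -> : g n = (fun x => \sum_(y \in range (g n)) y * \1_(g n @^-1` [set y]) x) :> (T -> R).
  by apply/funext => x; rewrite -fimfunE.
have [s ->] : exists s : seq R, (fun x => \sum_(y \in range (g n)) y * \1_(g n @^-1` [set y]) x) =
    (fun x => \sum_(y <- s) y * \1_(g n @^-1` [set y]) x).
  exists (finmap.enum_fset (fset_set (range (g n)))); apply/funext => x.
  by rewrite fsbig_finite.
elim: s => [|y s IHs].
  by under eq_fun do rewrite big_nil; exact: baire_cst.
under eq_fun do rewrite big_cons; apply: baireD => //; apply: baireM.
  exact: baire_cst.
by apply: baire_indic; rewrite -[_ @^-1` _]setTI; exact: measurable_funP.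
Qed.

End borel_induction.

Section continuous_maps.
Context {R : realType} {T T' : pointedType} (d : T -> T -> R) (d' : T' -> T' -> R).

Definition dist_continuous_map (f : T -> T') := forall x (e : R), 0 < e ->
  exists2 e' : R, 0 < e' & forall y, d x y < e' -> d' (f x) (f y) < e.

Lemma dist_open_preimage (f : T -> T') (U : set T') :
  dist_continuous_map f -> dist_open d' U -> dist_open d (f @^-1` U).
Proof.
move=> fc oU x /= /oU[e e0 eU]; have [e' e'0 fe] := fc x e e0.
by exists e' => // y /fe /eU.
Qed.

Lemma measurable_fun_dist_continuous_map
    (f : g_sigma_algebraType (dist_open d) -> g_sigma_algebraType (dist_open d')) :
  dist_continuous_map f -> measurable_fun setT f.
Proof.
move=> fc; apply: measurable_fun_dist_open => U oU.
by apply: dist_open_measurable; exact: dist_open_preimage fc oU.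
Qed.

End continuous_maps.

(** * Borel functions of doubly-pointed spaces *)

Section two_points.
Context {R : realType} {M : pseudoPMetricType R}.

Definition first_pt (x : Dstar2 M) : Dstar M := cls (origin1 (rep2 x)).
Definition second_pt (x : Dstar2 M) : Dstar M := cls (origin2 (rep2 x)).
Definition dist2 (x : Dstar2 M) : R := dist (origin1 (rep2 x)) (origin2 (rep2 x)).
Definition mark2 (x : Dstar2 M) : M := mark (origin1 (rep2 x)) (origin2 (rep2 x)).

Lemma first_pt_cls (X : marked_space M) (o v : X) : first_pt (cls2 o v) = cls o.
Proof.
have [h [ih ho hv]] := p2iso_cls2 o v.
by rewrite /first_pt -ho; exact: cls_iso.
Qed.

Lemma second_pt_cls (X : marked_space M) (o v : X) : second_pt (cls2 o v) = cls v.
Proof.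
have [h [ih ho hv]] := p2iso_cls2 o v.
by rewrite /second_pt -hv; exact: cls_iso.
Qed.

Lemma dist2_cls (X : marked_space M) (o v : X) : dist2 (cls2 o v) = dist o v.
Proof.
have [h [[_ hd _] ho hv]] := p2iso_cls2 o v.
by rewrite /dist2 -ho -hv hd.
Qed.

Lemma mark2_cls (X : marked_space M) (o v : X) : mark2 (cls2 o v) = mark o v.
Proof.
have [h [[_ _ hm] ho hv]] := p2iso_cls2 o v.
by rewrite /mark2 -ho -hv hm.
Qed.

(** The bound by the inverse of dist2 x + 1 makes 1/c exceed dist2 x + 1, so the second origin of
    [x] lies in the domain of the forward embedding and, as distances change by c < 1, that of [y]
    lies in the domain of the backward one. *)
Lemma Dstar2_near (x : Dstar2 M) (e : R) : 0 < e ->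
  exists2 e' : R, 0 < e' & forall y, Dstar2_dist x y < e' ->
    exists c, [/\ 0 < c, c < e, dist2 x <= c^-1 & dist2 y <= c^-1] /\
      (p2approx c (rep2 x) (rep2 y) /\ p2approx c (rep2 y) (rep2 x)).
Proof.
move=> e0; have d0 := dist_ge0 (origin1 (rep2 x)) (origin2 (rep2 x)).
exists (Num.min e (Num.min 1 (dist2 x + 1)^-1)).
  by rewrite !lt_min e0 ltr01 invr_gt0 ltr_wpDl.
move=> y xy; have [|c [c0]] := approx_dist_lt _ xy.
  by rewrite !ge_min lexx !orbT.
rewrite !lt_min => /andP[ce /andP[c1 cd]] xy' yx'.
have ci : dist2 x + 1 < c^-1.
  by rewrite -[_ + 1]invrK ltf_pV2 ?posrE ?invr_gt0 ?ltr_wpDl.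
have xc : dist2 x <= c^-1 by lra.
have ci0 : 0 <= c^-1 by rewrite invr_ge0 ltW.
exists c; split=> //; split=> //.
case: xy' => h [[_ hd _] ho /(_ xc) hv].
have : `|dist (h (origin1 (rep2 x))) (h (origin2 (rep2 x))) - dist2 x| <= c.
  by apply: hd; rewrite inE /= ?distxx.
rewrite ho hv -/(dist2 y) ler_norml => /andP[_]; lra.
Qed.

Lemma dist2_continuous : dist_continuous (@Dstar2_dist R M) dist2.
Proof.
move=> x e e0; have [e' e'0 near] := Dstar2_near x e0; exists e' => // y.
move=> /near[c [[c0 ce xc yc] [[h [[_ hd _] ho /(_ xc) hv]] _]]].
rewrite {1}/dist2 -ho -hv; apply: le_trans (ltW ce); apply: hd.
  by rewrite inE /= distxx invr_ge0 ltW.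
by rewrite inE.
Qed.

Lemma mark2_continuous (x : Dstar2 M) e : 0 < e ->
  exists2 e' : R, 0 < e' & forall y, Dstar2_dist x y < e' -> ball (mark2 x) e (mark2 y).
Proof.
move=> e0; have [e' e'0 near] := Dstar2_near x e0; exists e' => // y.
move=> /near[c [[c0 ce xc yc] [[h [[_ _ hm] ho /(_ xc) hv]] _]]].
rewrite {1}/mark2 /mark2 -ho -hv; apply: (hm _ _ _ _ e ce).
  by rewrite inE /= distxx invr_ge0 ltW.
by rewrite inE.
Qed.

Lemma first_pt_continuous :
  dist_continuous_map (@Dstar2_dist R M) (@Dstar_dist R M) first_pt.
Proof.
move=> x e e0; have [e' e'0 near] := Dstar2_near x e0; exists e' => // y.
move=> /near[c [[c0 ce xc yc] [[h [hh ho _]] [k [hk ko _]]]]].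
rewrite Dstar_dist_cls; apply: le_lt_trans ce; apply: approx_dist_le => //.
  by exists h.
by exists k.
Qed.

Lemma almost_embedding_rebase (c e : R) (X Y : marked_space M) (o v : X)
    (h : X -> Y) : c <= e -> dist o v + e^-1 <= c^-1 ->
  almost_embedding c o h -> almost_embedding e v h.
Proof.
move=> ce oc [hi hd hm].
have sub x : dist v x <= e^-1 -> dist o x <= c^-1.
  by move=> vx; have := dist_triangle o v x; lra.
split.
- by move=> x y; rewrite !inE /= => /sub ? /sub ?; apply: hi; rewrite inE.
- move=> x y; rewrite !inE /= => /sub ? /sub ?.
  by apply: le_trans ce; apply: hd; rewrite inE.
- move=> x y; rewrite !inE /= => /sub ? /sub ?.
  by apply: mark_within_le ce _; apply: hm; rewrite inE.
Qed.

(** The ball of radius 1/c around the first origin has to contain the ball of radius 1/e2 around the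
    second one, in [x] and in [y]; the term 1 in the choice of [b] absorbs the change of the
    distance between the origins. *)
Lemma second_pt_continuous :
  dist_continuous_map (@Dstar2_dist R M) (@Dstar_dist R M) second_pt.
Proof.
move=> x e e0; pose e2 := e / 2; have e20 : 0 < e2 by rewrite divr_gt0.
have d0 := dist_ge0 (origin1 (rep2 x)) (origin2 (rep2 x)).
have e2i : 0 < e2^-1 by rewrite invr_gt0.
pose b := Num.min e2 (Num.min 1 (dist2 x + 1 + e2^-1)^-1).
have b0 : 0 < b by rewrite !lt_min e20 ltr01 invr_gt0 ltr_wpDl// /dist2; lra.
have [e' e'0 near] := Dstar2_near x b0; exists e' => // y.
move=> /near[c [[c0 cb xc yc] [[h [hh ho /(_ xc) hv]] [k [hk ko /(_ yc) kv]]]]].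
move: cb; rewrite !lt_min => /andP[ce /andP[c1 cd]].
have ci : dist2 x + 1 + e2^-1 < c^-1.
  have p0 : 0 < dist2 x + 1 + e2^-1 by rewrite /dist2; lra.
  by rewrite -[_ + _ + _]invrK ltf_pV2 ?posrE ?invr_gt0.
rewrite Dstar_dist_cls; apply: (@le_lt_trans _ _ e2); last by rewrite /e2; lra.
have yx : dist2 y <= dist2 x + c.
  have : `|dist (h (origin1 (rep2 x))) (h (origin2 (rep2 x))) - dist2 x| <= c.
    case: hh => _ hd _; apply: hd; rewrite inE /= ?distxx//.
    by rewrite invr_ge0 ltW.
  by rewrite ho hv -/(dist2 y) ler_norml => /andP[_]; lra.
apply: approx_dist_le => //.
  exists h; split=> //=; apply: almost_embedding_rebase hh; first exact: ltW.
  by rewrite -/(dist2 x); lra.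
exists k; split=> //=; apply: almost_embedding_rebase hk; first exact: ltW.
by rewrite -/(dist2 y); lra.
Qed.

Lemma measurable_first_pt : measurable_fun setT first_pt.
Proof. by apply: measurable_fun_dist_continuous_map; exact: first_pt_continuous. Qed.

Lemma measurable_second_pt : measurable_fun setT second_pt.
Proof. by apply: measurable_fun_dist_continuous_map; exact: second_pt_continuous. Qed.

Lemma measurable_dist2 : measurable_fun setT dist2.
Proof. by apply: measurable_fun_dist_continuous; exact: dist2_continuous. Qed.

Lemma measurable_mark2 (phi : M -> R) :
  (forall a e, 0 < e -> exists2 e' : R, 0 < e' & forall b, ball a e' b ->
    `|phi b - phi a| <= e) ->
  measurable_fun setT (fun x => phi (mark2 x)).
Proof.
move=> cphi; apply: measurable_fun_dist_continuous => x e e0.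
have [e' e'0 phie] := cphi (mark2 x) e e0.
have [e'' e''0 near] := mark2_continuous x e'0.
by exists e'' => // y /near/phie.
Qed.

End two_points.

Section forget.
Context {R : realType} {M M' : pseudoPMetricType R}.
Local Notation MM' := (M * M')%type.

Definition fst_mark (X : marked_space MM') : marked_space M :=
  @MarkedSpace R M X (fun x y => (mark x y).1).

Definition forget2 (x : Dstar2 MM') : Dstar2 M :=
  @cls2 R M (fst_mark (rep2 x)) (origin1 (rep2 x)) (origin2 (rep2 x)).

Lemma fst_mark_iso (X Y : marked_space MM') (h : X -> Y) :
  marked_iso h -> @marked_iso R M (fst_mark X) (fst_mark Y) h.
Proof. by case=> hb hd hm; split=> // x y /=; rewrite hm. Qed.

Lemma forget2_cls (X : marked_space MM') (o v : X) :
  forget2 (cls2 o v) = @cls2 R M (fst_mark X) o v.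
Proof.
have [h [ih ho hv]] := p2iso_cls2 o v.
by rewrite /forget2 /rep2 -ho -hv; apply: cls2_iso; exact: fst_mark_iso.
Qed.

Lemma add_mark_iso (X : marked_space M) (z : X -> X -> M') :
  @marked_iso R M (fst_mark (add_mark z)) X id.
Proof. by split=> //; exists id. Qed.

Lemma almost_embedding_fst e (X Y : marked_space MM') (o : X) (h : X -> Y) :
  almost_embedding e o h ->
  @almost_embedding R M e (fst_mark X) (fst_mark Y) o h.
Proof.
case=> hi hd hm; split=> // x y xB yB e' ee'.
by have [] := hm x y xB yB e' ee'.
Qed.

Lemma measurable_forget2 : measurable_fun setT forget2.
Proof.
apply: measurable_fun_dist_continuous_map => x e e0.
have [e' e'0 near] := Dstar2_near x e0; exists e' => // y.
move=> /near[c [[c0 ce xc yc] [[h [hh ho hv]] [k [hk ko kv]]]]].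
rewrite Dstar2_dist_cls; apply: le_lt_trans ce; apply: approx_dist_le => //.
  by exists h; split=> //; exact: almost_embedding_fst.
by exists k; split=> //; exact: almost_embedding_fst.
Qed.

End forget.

(** * Sums over the vertices of a marked space *)

Lemma cvg_sum_seq (R : realType) (I : Type) (s : seq I) (u : nat -> I -> R)
    (l : I -> R) : (forall i, u ^~ i @ \oo --> l i) ->
  (fun n => \sum_(i <- s) u n i) @ \oo --> \sum_(i <- s) l i.
Proof.
move=> ul; elim: s => [|i s IHs].
  by rewrite big_nil; under eq_fun do rewrite big_nil; exact: cvg_cst.
by rewrite big_cons; under eq_fun do rewrite big_cons; exact: cvgD.
Qed.

Section vertex_sum.
Context {R : realType} {M : pseudoPMetricType R}.

(** A finitely supported sum, worth 0 when infinitely many terms are nonzero; the kernels summed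
    below vanish beyond a fixed distance. *)
Definition vsum (g : Dstar2 M -> R) (x : Dstar M) : R :=
  \sum_(v \in [set: rep x]) g (cls2 (origin (rep x)) v).

Lemma vsum_cls (g : Dstar2 M -> R) (X : marked_space M) (o : X) :
  vsum g (cls o) = \sum_(v \in [set: X]) g (cls2 o v).
Proof.
have [h ih ho] := rep_cls_iso o; rewrite /vsum (reindex_fsbigT h); last by case: ih.
by apply: eq_fsbigr => v _; rewrite -ho cls2_iso.
Qed.

Lemma vsum_ball (g : Dstar2 M -> R) (r : R) x : (forall x, r < dist2 x -> g x = 0) ->
  vsum g x = \sum_(v \in [set v | dist (origin (rep x)) v <= r])
    g (cls2 (origin (rep x)) v).
Proof.
move=> g0; apply/esym/fsbig_widen => // v [_ /= /negP]; rewrite -ltNge => rv.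
by rewrite g0// dist2_cls.
Qed.

Lemma vsum_continuous (g : Dstar2 M -> R) (r : R) : 0 <= r ->
  (forall x, r < dist2 x -> g x = 0) ->
  dist_continuous (@Dstar2_dist R M) g -> dist_continuous (@Dstar_dist R M) (vsum g).
Proof.
move=> r0 g0 gc x e e0.
pose V := [set v | dist (origin (rep x)) v <= r + 1].
have finV : finite_set V := finite_balls _ _.
pose n := size (finmap.enum_fset (fset_set V)).
have en0 : 0 < e / n.+1%:R by rewrite divr_gt0.
have [||a a0 gV] := @finite_uniform R _ V (fun v a => forall y,
    Dstar2_dist (cls2 (origin (rep x)) v) y <= a ->
    `|g y - g (cls2 (origin (rep x)) v)| <= e / n.+1%:R) finV.
- by move=> v a a' a'a gv y ya; apply: gv; exact: le_trans ya a'a.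
- move=> v _; have [a a0 ga] := gc (cls2 (origin (rep x)) v) _ en0.
  by exists (a / 2) => [|y ya]; [rewrite divr_gt0 | apply: ga; lra].
pose b := Num.min a 1; have b0 : 0 < b by rewrite lt_min a0 ltr01.
have ba : b <= a by rewrite ge_min lexx.
have b1 : b <= 1 by rewrite ge_min lexx orbT.
have [|e' e'0 near] := @pair_match_near _ _ x (r + 1) b _ b0; first lra.
exists e' => // y /near[h [[ho hi hd _ hs] hpair]].
have bi0 : 0 < b^-1 by rewrite invr_gt0.
have sumy : vsum g y = \sum_(v \in V) g (cls2 (origin (rep y)) (h v)).
  rewrite -(@fsbig_image _ _ _ _ _ V h (fun w => g (cls2 (origin (rep y)) w))).
    apply/esym/fsbig_widen => // w [_ /= hVw].
    apply: contrapT => gw; apply: hVw.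
    have wr : dist (origin (rep y)) w <= r.
      by rewrite leNgt; apply/negP => rw; apply: gw; rewrite g0// dist2_cls.
    have [|u ur huw] := hs w; first lra.
    exists u => //; have : `|dist (h (origin (rep x))) (h u) - dist (origin (rep x)) u| <= b.
      by apply: hd => //=; rewrite distxx; lra.
    by rewrite ho huw ler_norml /V /= => /andP[? _]; lra.
  by move=> u v; rewrite !inE /V /= => ur vr; apply: hi => /=; lra.
have sumx : vsum g x = \sum_(v \in V) g (cls2 (origin (rep x)) v).
  by apply: vsum_ball => z rz; apply: g0; lra.
rewrite sumx sumy !fsbig_finite// -sumrB (le_trans (ler_norm_sum _ _ _))//.
have le_en v : V v ->
    `|g (cls2 (origin (rep y)) (h v)) - g (cls2 (origin (rep x)) v)| <= e / n.+1%:R.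
  move=> Vv; apply: gV => //; rewrite -ho (le_trans (hpair _ _ _ _))// distxx; lra.
have le_e : \sum_(v <- finmap.enum_fset (fset_set V)) (e / n.+1%:R) <= e.
  rewrite big_const_seq count_predT iter_addr addr0 -/n -[leLHS]mulr_natr.
  by rewrite -mulrA ger_pMr// mulrC ler_pdivrMr// mul1r ler_nat.
apply: le_trans le_e.
by rewrite big_seq [leRHS]big_seq; apply: ler_sum => v;
  rewrite in_fset_set// inE; exact: le_en.
Qed.

(** Baire induction on [g] alone would lose the bounded support, so a continuous cutoff [chi], equal
    to 1 up to distance r and to 0 beyond r + 1, is kept as a factor throughout. *)
Lemma measurable_vsum (g : Dstar2 M -> R) (r : R) :
  (forall x, r < dist2 x -> g x = 0) ->
  measurable_fun setT g -> measurable_fun setT (vsum g).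
Proof.
wlog r0 : r / 0 <= r => [th g0|g0].
  by apply: (th `|r|) => // x rx; apply: g0; rewrite (le_lt_trans (ler_norm r)).
pose u x := r + 1 + -1 * @dist2 R M x.
(* This is u clamped to [0, 1]. *)
pose chi x := Num.min 1 (u x) + -1 * Num.min 0 (u x).
have chi1 x : dist2 x <= r -> chi x = 1.
  move=> xr; have u1 : 1 <= u x by rewrite /u; lra.
  by rewrite /chi (min_idPl u1) min_l; lra.
have chi0 x : r + 1 < dist2 x -> chi x = 0.
  move=> xr; have u1 : u x <= 0 by rewrite /u; lra.
  by rewrite /chi (min_idPr u1) min_r; lra.
have cchi : dist_continuous (@Dstar2_dist R M) chi.
  have cu : dist_continuous (@Dstar2_dist R M) u.
    apply: dist_continuousD; first exact: dist_continuous_cst.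
    by apply: dist_continuousM; [exact: dist_continuous_cst | exact: dist2_continuous].
  apply: dist_continuousD; first exact: dist_continuous_min.
  apply: dist_continuousM; first exact: dist_continuous_cst.
  exact: dist_continuous_min.
have chig0 f x : r + 1 < dist2 x -> chi x * f x = 0.
  by move=> /chi0 ->; rewrite mul0r.
move=> mg; have -> : g = (fun x => chi x * g x).
  apply/funext => x; have [/chi1 ->|rx] := leP (dist2 x) r; first by rewrite mul1r.
  by rewrite g0// mulr0.
move: (g) mg; apply: (@borel_fun_ind _ _ (@Dstar2_dist R M) _ _ _
  (fun f => measurable_fun setT (vsum (fun x => chi x * f x)))).
- exact: Dstar2_distxx.
- exact: Dstar2_dist_sym.
- exact: Dstar2_dist_triangle.
- move=> f cf; apply: measurable_fun_dist_continuous.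
  apply: (@vsum_continuous _ (r + 1)); [lra | exact: chig0 |].
  exact: dist_continuousM.
move=> f_ f mf_ f_f; apply: (measurable_fun_cvg mf_) => x _.
rewrite (vsum_ball _ (chig0 f)) fsbig_finite; last exact: finite_balls.
rewrite (_ : (fun n => _) = (fun n => \sum_(v <- finmap.enum_fset
    (fset_set [set v | dist (origin (rep x)) v <= r + 1]))
    (chi (cls2 (origin (rep x)) v) * f_ n (cls2 (origin (rep x)) v)))).
  apply: cvg_sum_seq => v; apply: cvgM; [exact: cvg_cst | exact: f_f].
apply/funext => n; rewrite (vsum_ball _ (chig0 (f_ n))) fsbig_finite//.
exact: finite_balls.
Qed.

End vertex_sum.

Section metric_limit.
Context {R : realType} {T : pointedType} (d : T -> T -> R).
Hypothesis d_sym : forall x y, d x y = d y x.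
Hypothesis d_triangle : forall x y z, d x z <= d x y + d y z.

(** The open set [V k] gathers the points close to a centre whose ball of twice the radius lies in
    [U]; the limit is in [U] exactly when, for some k, the sequence is eventually in [V k]. *)
Lemma measurable_fun_dist_limit disp (S : measurableType disp)
    (F_ : nat -> S -> g_sigma_algebraType (dist_open d))
    (F : S -> g_sigma_algebraType (dist_open d)) :
  (forall n, measurable_fun setT (F_ n)) ->
  (forall x e, 0 < e -> exists N, forall n, (N <= n)%N -> d (F_ n x) (F x) < e) ->
  measurable_fun setT F.
Proof.
move=> mF_ F_F; apply: measurable_fun_dist_open => U oU.
pose V (k : nat) : set T := [set y | exists2 p, d p y < k.+1%:R^-1 &
  forall z, d p z < 2 * k.+1%:R^-1 -> U z].
have oV k : dist_open d (V k).
  move=> y [p py pU]; exists (k.+1%:R^-1 - d p y); first by rewrite subr_gt0.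
  move=> z yz; exists p => //.
  by rewrite (le_lt_trans (d_triangle p y z))// -ltrBrDl.
have -> : F @^-1` U =
    \bigcup_k \bigcup_N \bigcap_(n in [set n | (N <= n)%N]) (F_ n @^-1` V k).
  apply/seteqP; split=> x /=.
    move=> UF; have [e e0 eU] := oU _ UF.
    have [k ke] : exists k : nat, 2 * k.+1%:R^-1 < e.
      exists (Num.truncn (2 / e)).
      have := truncnS_gt (2 / e).
      by rewrite ltr_pdivrMr// => ke; rewrite ltr_pdivrMr// mulrC.
    have [|N FN] := F_F x k.+1%:R^-1; first by rewrite invr_gt0.
    exists k => //; exists N => // n /= /FN Fn; exists (F x); first by rewrite d_sym.
    by move=> z Fz; apply: eU; exact: lt_trans Fz ke.
  move=> [k _ [N _ FV]].
  have [|N' FN'] := F_F x k.+1%:R^-1; first by rewrite invr_gt0.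
  have [|p pF pU] := FV (maxn N N'); first exact: leq_maxl.
  apply: pU; have := FN' _ (leq_maxr N N').
  have := d_triangle p (F_ (maxn N N') x) (F x); move: pF.
  by move: (_^-1) => t *; lra.
apply: bigcup_measurable => k _; apply: bigcup_measurable => N _.
apply: bigcap_measurable => [|n _]; first by exists N => /=.
by rewrite -[_ @^-1` _]setTI; apply: mF_ => //; exact: dist_open_measurable.
Qed.

End metric_limit.

(** * Marks given by functions of two points *)

Section add_function_marks.
Context {R : realType} {M : pseudoPMetricType R}.

(** A deterministic process is such a decoration, and its measurability as an equivariant process is
    that of [decorated]. *)
Definition decorate (M' : pseudoPMetricType R) (f : Dstar2 M -> M')
    (X : marked_space M) : marked_space (M * M')%type :=
  @add_mark R M M' X (fun u v => f (cls2 u v)).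

Definition decorated (M' : pseudoPMetricType R) (f : Dstar2 M -> M')
    (x : Dstar M) : Dstar (M * M')%type :=
  @cls R _ (decorate f (rep x)) (origin (rep x)).

Lemma near_Rmark (a b : M) (s t : R) e : mark_within a b e -> `|s - t| <= e ->
  @mark_within R (M * R)%type (a, s) (b, t) e.
Proof.
move=> ab st e' ee'; split=> /=; first exact: ab.
by rewrite -ball_normE /=; exact: le_lt_trans st ee'.
Qed.

(** A match of large balls preserves the new marks up to c because [f] is continuous at each of the
    finitely many pairs of points of the r-ball. *)
Lemma decorated_continuous (f : Dstar2 M -> R) :
  dist_continuous (@Dstar2_dist R M) f ->
  dist_continuous_map (@Dstar_dist R M) (@Dstar_dist R (M * R)%type) (decorated f).
Proof.
move=> cf x e e0; pose c := e / 2; have c0 : 0 < c by rewrite divr_gt0.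
have ci0 : 0 < c^-1 by rewrite invr_gt0.
pose r := c^-1 + c; pose V := [set v | dist (origin (rep x)) v <= r].
have [|||a a0 fV] := @finite_uniform R _ (V `*` V) (fun uv a => forall y,
    Dstar2_dist (cls2 uv.1 uv.2) y <= a -> `|f y - f (cls2 uv.1 uv.2)| <= c).
- by apply: finite_setX; exact: finite_balls.
- by move=> v a a' a'a fv y ya; apply: fv; exact: le_trans ya a'a.
- move=> v _; have [a a0 ga] := cf (cls2 v.1 v.2) _ c0.
  by exists (a / 2) => [|y ya]; [rewrite divr_gt0 | apply: ga; lra].
pose b := Num.min a c; have b0 : 0 < b by rewrite lt_min a0.
have ba : b <= a by rewrite ge_min lexx.
have bc : b <= c by rewrite ge_min lexx orbT.
have bi0 : 0 < b^-1 by rewrite invr_gt0.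
have [|e' e'0 near] := @pair_match_near _ _ x r b _ b0; first by rewrite /r; lra.
exists e' => // y /near[h [[ho hi hd hm hs] hpair]].
rewrite Dstar_dist_cls; apply: (@le_lt_trans _ _ c); last by rewrite /c; lra.
have cr : c^-1 <= r by rewrite /r; lra.
have fh u v : dist (origin (rep x)) u <= r -> dist (origin (rep x)) v <= r ->
    `|f (cls2 (h u) (h v)) - f (cls2 u v)| <= c.
  by move=> ur vr; apply: (fV (u, v)) => //=; rewrite (le_trans (hpair _ _ _ _)).
pose g z := xget (origin (rep x)) [set w | dist (origin (rep x)) w <= r /\ h w = z].
have gP z : dist (origin (rep y)) z <= c^-1 ->
    dist (origin (rep x)) (g z) <= r /\ h (g z) = z.
  move=> zc; have [|w /= ws hw] := hs z; first by rewrite /r; lra.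
  have wr : dist (origin (rep x)) w <= r.
    have : `|dist (h (origin (rep x))) (h w) - dist (origin (rep x)) w| <= b.
      by apply: hd => //=; rewrite distxx /r; lra.
    by rewrite ho hw ler_norml /r => /andP[? _]; lra.
  by rewrite /g; case: xgetP => [_ -> //|/(_ w)]; case.
apply: approx_dist_le => //.
  exists h; split=> //; split=> u v; rewrite !inE /= => uc vc.
  - by apply: hi => /=; rewrite /r; lra.
  - by apply: le_trans bc; apply: hd => /=; rewrite /r; lra.
  - apply: near_Rmark; last by rewrite distrC; exact: (fh _ _ (le_trans uc cr) (le_trans vc cr)).
    apply: mark_within_le bc _; apply: hm => /=; rewrite /r; lra.
have go : g (origin (rep y)) = origin (rep x).
  have [|gr hg] := gP (origin (rep y)); first by rewrite distxx; lra.
  by apply: hi => /=; rewrite ?distxx ?hg ?ho//; lra.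
exists g; split=> //; split=> u v; rewrite !inE /= => /gP[ur gu] /gP[vr gv].
- by move=> guv; rewrite -gu -gv guv.
- have : `|dist (h (g u)) (h (g v)) - dist (g u) (g v)| <= b.
    by apply: hd => /=; lra.
  by rewrite gu gv distrC => /le_trans; exact.
- apply: near_Rmark; last by have := fh (g u) (g v) ur vr; rewrite gu gv.
  have : mark_within (mark (g u) (g v)) (mark (h (g u)) (h (g v))) b.
    by apply: hm => /=; lra.
  by rewrite gu gv => /mark_within_sym/mark_within_le; exact.
Qed.

Lemma measurable_decorated (f : Dstar2 M -> R) :
  measurable_fun setT f -> measurable_fun setT (decorated f).
Proof.
move: f; apply: (@borel_fun_ind _ _ (@Dstar2_dist R M)).
- exact: Dstar2_distxx.
- exact: Dstar2_dist_sym.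
- exact: Dstar2_dist_triangle.
- move=> f cf; apply: measurable_fun_dist_continuous_map.
  exact: decorated_continuous.
move=> f_ f mf_ f_f; apply: (@measurable_fun_dist_limit _ _ _ _ _ _ _ _ _ mf_).
- exact: Dstar_dist_sym.
- exact: Dstar_dist_triangle.
move=> x e e0; pose c := e / 2; have c0 : 0 < c by rewrite divr_gt0.
pose V := [set v | dist (origin (rep x)) v <= c^-1].
(* The condition 1 <= n a stands for n >= 1/a, so that one rank serves all pairs of points of the
   ball. *)
have [|||a a0 fV] := @finite_uniform R _ (V `*` V) (fun uv a => forall n,
    1 <= n%:R * a -> `|f_ n (cls2 uv.1 uv.2) - f (cls2 uv.1 uv.2)| <= c).
- by apply: finite_setX; exact: finite_balls.
- move=> v a a' a'a fv n na; apply: fv; apply: le_trans na _.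
  exact: ler_wpM2l.
- move=> v _; have /cvgrPdist_le/(_ _ c0)[N _ fN] := f_f (cls2 v.1 v.2).
  exists N.+1%:R^-1 => [|n]; first by rewrite invr_gt0.
  rewrite ler_pdivlMr// mul1r ler_nat => Nn; rewrite distrC; apply: fN => /=.
  exact: ltnW.
exists (Num.truncn a^-1).+1 => n Nn.
have na : 1 <= n%:R * a.
  rewrite -ler_pdivrMr// mul1r ltW// (lt_le_trans (truncnS_gt _))// ler_nat//.
rewrite Dstar_dist_cls; apply: (@le_lt_trans _ _ c); last by rewrite /c; lra.
apply: approx_dist_le => //; exists id; split=> //; split=> // u v; rewrite !inE /= => uc vc.
- by rewrite subrr normr0 ltW.
- apply: near_Rmark; first by apply: mark_within_refl; exact: ltW.
  exact: (fV (u, v)).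
- by rewrite subrr normr0 ltW.
- apply: near_Rmark; first by apply: mark_within_refl; exact: ltW.
  by rewrite distrC; exact: (fV (u, v)).
Qed.

(* A [bool]-valued function is rarely a limit of continuous ones, so
   {0,1}-valued decorations are read off the real-valued ones: on indicator
   functions, marks at distance less than 1 agree. *)
Lemma measurable_decorated_bool (A : set (Dstar2 M)) : measurable A ->
  measurable_fun setT (decorated (fun x : Dstar2 M => x \in A)).
Proof.
move=> mA; pose TR := decorated (\1_A : Dstar2 M -> R).
pose Tb := decorated (fun x : Dstar2 M => x \in A).
have mTR : measurable_fun setT TR by apply: measurable_decorated.
apply: measurable_fun_dist_open => U oU.
pose V : set (Dstar (M * R)%type) := [set y | exists2 e : R, 0 < e &
  forall z, Dstar_dist y z < e -> forall x, z = TR x -> U (Tb x)].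
have oV : dist_open (@Dstar_dist R (M * R)%type) V.
  exact: (dist_open_interior Dstar_dist_triangle).
have -> : Tb @^-1` U = TR @^-1` V.
  apply/seteqP; split=> x /=; last first.
    by move=> [e e0 /(_ (TR x))]; rewrite Dstar_distxx => /(_ e0 x erefl).
  move=> /oU[e e0 eU]; exists (Num.min e 1); first by rewrite lt_min e0 ltr01.
  move=> z xx' x' zE; apply: eU; move: xx'; rewrite {}zE !Dstar_dist_cls.
  move=> lt_e1; have [|c [c0]] := approx_dist_lt _ lt_e1.
    by rewrite ge_min lexx orbT.
  rewrite lt_min => /andP[ce c1] xx' x'x.
  have agree (a b : M) (p q : Dstar2 M) :
      @mark_within R (M * R)%type (a, \1_A p) (b, \1_A q) c ->
      @mark_within R (M * bool)%type (a, p \in A) (b, q \in A) c.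
    move=> ab e' ce'; split=> /=; first by have [] := ab e' ce'.
    have [_] := ab 1 c1; rewrite -ball_normE /= !indicE.
    have e'0 : 0 < e' := lt_trans c0 ce'.
    case: (p \in A); case: (q \in A) => /=.
    - by move=> _; exact: (ball_center true (PosNum e'0)).
    - by rewrite subr0 normr1 ltxx.
    - by rewrite sub0r normrN normr1 ltxx.
    - by move=> _; exact: (ball_center false (PosNum e'0)).
  apply: le_lt_trans ce; apply: approx_dist_le => //.
    case: xx' => h [[hi hd hm] ho]; exists h; split=> //; split=> // u v uc vc.
    by apply: agree; exact: hm.
  case: x'x => h [[hi hd hm] ho]; exists h; split=> //; split=> // u v uc vc.
  by apply: agree; exact: hm.
rewrite -[_ @^-1` _]setTI; apply: mTR => //; exact: dist_open_measurable.
Qed.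

End add_function_marks.

(** * One-ended trees *)

#[local] Arguments parent {R D} v.

Lemma finite_bound (T : choiceType) (A : set T) (P : nat -> T -> Prop) :
  finite_set A -> (forall n x, P n x -> P n.+1 x) ->
  (forall x, A x -> exists n, P n x) -> exists n, forall x, A x -> P n x.
Proof.
move=> /finite_seqP[s ->] PS; have Ple n m x : (n <= m)%N -> P n x -> P m x.
  by move=> /subnK <-; elim: (m - n)%N => // k IHk /IHk; exact: PS.
elim: s => [_|a s IHs AP]; first by exists 0%N.
have [|n nP] := IHs; first by move=> x xs; apply: AP; rewrite /= inE xs orbT.
have [|m mP] := AP a; first by rewrite /= inE eqxx.
exists (maxn n m) => x; rewrite /= inE => /orP[/eqP ->|xs].
  exact: Ple (leq_maxr _ _) mP.
exact: Ple (leq_maxl _ _) (nP x xs).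
Qed.

Section nonbacktracking.
Context {R : realType} {D : discrete_space R}.

Lemma adj_sym (u v : D) : adj u v = adj v u.
Proof. by rewrite /adj dist_sym. Qed.

Lemma adj_irr (u : D) : ~~ adj u u.
Proof. by rewrite /adj distxx eq_sym oner_eq0. Qed.

Lemma finite_adj (v : D) : finite_set [set w | adj v w].
Proof.
by apply: sub_finite_set (finite_balls v 1) => w /= /eqP ->.
Qed.

(** The first return to an earlier vertex closes a cycle of distinct vertices; acyclicity leaves
    lengths 1 and 2, excluded by the irreflexivity of adjacency and the absence of backtracking. *)
Lemma nonbacktracking_inj (b : nat -> D) : acyclic D ->
  (forall i, adj (b i) (b i.+1)) -> (forall i, b i.+2 <> b i) -> injective b.
Proof.
move=> acycD badj bnb; apply: contrapT => /existsNP[i /existsNP[j]].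
move=> /not_implyP[bij ij].
have : exists j, `[< exists2 i, (i < j)%N & b i = b j >].
  by case: (ltngtP i j) => [lt|lt|//]; [exists j | exists i]; apply/asboolP;
    [exists i | exists j].
move=> {i j bij ij} ex; case: (ex_minnP ex) => j /asboolP[i ij bij] jmin.
have inj k l : (k < l)%N -> (l < j)%N -> b k <> b l.
  move=> kl lj bkl; suff : (j <= l)%N by rewrite leqNgt lj.
  by apply: jmin; apply/asboolP; exists k.
pose n := (j - i)%N; pose c := mkseq (fun k => b (i + k.+1)%N) n.
have jE : j = (i + n)%N by rewrite subnKC// ltnW.
have n0 : (0 < n)%N by rewrite subn_gt0.
have pathc m : path adj (b i) (mkseq (fun k => b (i + k.+1)%N) m) /\
    last (b i) (mkseq (fun k => b (i + k.+1)%N) m) = b (i + m)%N.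
  elim: m => [|m [IHp IHl]]; first by rewrite addn0.
  by rewrite mkseqS rcons_path last_rcons IHp IHl addnS badj.
have : (size c < 3)%N.
  apply: acycD; apply/andP; split.
    by rewrite (cycle_path (b i)) (pathc n).2 -jE -bij; exact: (pathc n).1.
  rewrite map_inj_in_uniq ?iota_uniq//; move=> p q.
  rewrite !mem_iota /= !add0n => pn qn.
  case: (ltngtP p q) => // pq /= bpq; exfalso.
  - have [lt|ge] := ltnP q.+1 n; first by move: bpq; apply: inj; lia.
    have qE : (i + q.+1 = j)%N by lia.
    by apply: (inj i (i + p.+1)%N); [lia | lia | rewrite bij bpq qE].
  - have [lt|ge] := ltnP p.+1 n; first by move/esym: bpq; apply: inj; lia.
    have pE : (i + p.+1 = j)%N by lia.
    by apply: (inj i (i + q.+1)%N); [lia | lia | rewrite bij -bpq pE].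
rewrite size_mkseq => n3; have [n1|n2] : n = 1%N \/ n = 2%N by lia.
  by have := badj i; rewrite -addn1 -n1 -jE -bij; apply/negP/adj_irr.
by apply: (bnb i); rewrite -addn2 -n2 -jE bij.
Qed.

End nonbacktracking.

(* [low n v] says that [v] disappears within [n] rounds of pruning, where each
   round removes the vertices having at most one remaining neighbour. *)
Section pruning.
Context {R : realType} {D : discrete_space R}.
Implicit Types u v w : D.

Fixpoint low (n : nat) v : Prop :=
  if n is m.+1 then
    forall w w', adj v w -> adj v w' -> ~ low m w -> ~ low m w' -> w = w'
  else False.

Lemma lowS n v : low n v -> low n.+1 v.
Proof.
elim: n v => // n IHn v lv w w' vw vw' lw lw'; apply: lv => // [/IHn|/IHn] //.
Qed.

Lemma low_le n m v : (n <= m)%N -> low n v -> low m v.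
Proof. by move=> /subnK <-; elim: (m - n)%N => // k IHk /IHk; exact: lowS. Qed.

(** One of the two neighbours of [r i.+1] on the ray disappears before it. If that is [r i.+2],
    induction on n makes [r i.+1], and then [r i], disappear earlier still. Hence heights increase
    strictly along rays. *)
Lemma ray_low r n i : ray r -> low n (r i.+1) -> exists2 m, n = m.+1 & low m (r i).
Proof.
move=> [rinj radj]; elim: n i => // n IHn i lr; exists n => //.
apply: contrapT => Nlr; have Nlr2 : ~ low n (r i.+2).
  move=> /IHn[m nm lm]; have lr1 : low n (r i.+1) by rewrite nm; exact: lowS.
  have [m' mm' lm'] := IHn i lr1.
  by apply: Nlr; rewrite mm'; exact: lowS.
have /rinj/eqP : r i = r i.+2.
  by apply: lr => //; rewrite adj_sym; exact: radj.
lia.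
Qed.

(** Local finiteness gives one n such that every neighbour ever removed is removed within n rounds;
    as [v] survives round n + 1, two distinct neighbours remain. *)
Lemma core_neighbours v : (forall n, ~ low n v) ->
  exists w w', [/\ adj v w, adj v w', w <> w', forall n, ~ low n w &
    forall n, ~ low n w'].
Proof.
move=> Cv; apply: contrapT => H.
have [||n nP] := @finite_bound _ [set w | adj v w]
  (fun n w => low n w \/ forall n, ~ low n w) (finite_adj v).
- by move=> n w [/lowS|]; [left | right].
- move=> w _; have [[n lw]|/forallNP Nlw] := pselect (exists n, low n w).
    by exists n; left.
  by exists 0%N; right.
apply: (Cv n.+1) => w w' vw vw' lw lw'; apply: contrapT => ww'; apply: H.
exists w, w'; split=> //; first by case: (nP w vw).
by case: (nP w' vw').
Qed.

Hypothesis D_tree : one_ended_tree D.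

(** A vertex surviving all rounds has two neighbours that do so too; hence two walks without
    backtracking leave it through different neighbours. One followed backwards and then the other
    forwards form an injective walk, so they are rays meeting only at their start, against
    one-endedness. *)
Lemma exists_low v : exists n, low n v.
Proof.
have [_ acycD [_ one_end]] := D_tree.
apply: contrapT => /forallNP Cv.
pose C u := forall n, ~ low n u.
(* [f (u, w)] continues, among the vertices that are never removed, a walk that has just gone from
   [u] to [w]. *)
have /choice[f fP] : forall uv : D * D, exists w, C uv.2 ->
    [/\ adj uv.2 w, w <> uv.1 & C w].
  move=> [u w]; have [Cw|NCw] := pselect (C w); last by exists u.
  have [a [b [wa wb ab Ca Cb]]] := core_neighbours Cw.
  have [au|au] := pselect (a = u); last by exists a.
  by exists b => _; split=> // bu; apply: ab; rewrite au bu.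
pose walk (p : D * D) n := iter n (fun p => (p.2, f p)) p.
have walkP p : adj p.1 p.2 -> C p.2 -> forall n,
    adj (walk p n).1 (walk p n.+1).1 /\ (walk p n.+2).1 <> (walk p n).1.
  move=> p12 Cp; have inv n : adj (walk p n).1 (walk p n).2 /\ C (walk p n).2.
    by elim: n => //= n [_ /fP[]].
  by move=> n; have [an Cn] := inv n; split=> //=; case: (fP _ Cn).
have [a [b [va vb ab Ca Cb]]] := core_neighbours Cv.
pose r n := (walk (v, a) n).1; pose s n := (walk (v, b) n).1.
have radj n : adj (r n) (r n.+1) := (walkP (v, a) va Ca n).1.
have sadj n : adj (s n) (s n.+1) := (walkP (v, b) vb Cb n).1.
have rnb n : r n.+2 <> r n := (walkP (v, a) va Ca n).2.
have snb n : s n.+2 <> s n := (walkP (v, b) vb Cb n).2.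
(* [z] walks back from [r N] to the common start and then follows [s]. *)
have join N : exists z, [/\ z 0%N = r N, z 1%N <> r N.+1, forall k, z (N + k)%N = s k,
    forall i, adj (z i) (z i.+1) & forall i, z i.+2 <> z i].
  elim: N => [|N [z [z0 z1 zs zadj znb]]].
    by exists s; split=> //; rewrite /r /s /=; exact: nesym.
  exists (fun k => if k is k'.+1 then z k' else r N.+1); split=> //.
  - by rewrite z0; exact: nesym.
  - by case=> [|i] //; rewrite z0 adj_sym.
  - by case=> [|i] //.
have rs_disj i j : r i = s j -> i = 0%N /\ j = 0%N.
  have [z [z0 _ zs zadj znb]] := join i.
  rewrite -z0 -zs => /(nonbacktracking_inj acycD zadj znb); lia.
have [||i [j ij]] := one_end r s.
- by split=> //; exact: nonbacktracking_inj.
- by split=> //; exact: nonbacktracking_inj.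
(* Index 1 rather than 0 rules out the common starting point. *)
by have := rs_disj _ _ (ij 1%N); lia.
Qed.

Lemma exists_height : exists H : D -> nat, forall n v, low n v <-> (H v < n)%N.
Proof.
suff /choice[H HP] : forall v, exists h, forall n, low n v <-> (h < n)%N.
  by exists H => n v; exact: HP.
move=> v; have [n0 l0] := exists_low v.
have ex : exists n, `[< low n v >] by exists n0; apply/asboolP.
case: (ex_minnP ex) => -[|m] /asboolP lm mmin //; exists m => n; split.
  by move=> ln; apply: mmin; apply/asboolP.
by move=> /low_le; apply.
Qed.

Section with_height.
Variable H : D -> nat.
Hypothesis lowH : forall n v, low n v <-> (H v < n)%N.

Lemma height_upper_uniq v w w' : adj v w -> adj v w' ->
  (H v <= H w)%N -> (H v <= H w')%N -> w = w'.
Proof.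
move=> vw vw' Hw Hw'; have /lowH lv : (H v < (H v).+1)%N by [].
by apply: lv => // /lowH; rewrite ltnNge ?Hw ?Hw'.
Qed.

Lemma height_ray r i : ray r -> (H (r i) < H (r i.+1))%N.
Proof.
move=> rr; have /lowH lr : (H (r i.+1) < (H (r i.+1)).+1)%N by [].
by have [_ [<-] /lowH] := ray_low rr lr.
Qed.

Lemma height_ray_ge r i : ray r -> (i <= H (r i))%N.
Proof.
by move=> rr; elim: i => // i IHi; exact: leq_ltn_trans IHi (height_ray i rr).
Qed.

Inductive climbs (v : D) : D -> Prop :=
| climbs_refl : climbs v v
| climbs_step u w : adj u w -> (H u <= H w)%N -> climbs v w -> climbs v u.

Lemma climbs_height v u : climbs v u -> (H u <= H v)%N.
Proof. by elim=> // u' w _ uw _ /(leq_trans uw). Qed.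

(** Otherwise the vertices that climb to [v] are closed under adjacency, since a vertex has at most
    one neighbour at least as high as itself; by connectedness they are all the vertices, whereas
    heights are unbounded along a ray. *)
Lemma exists_higher v : exists2 w, adj v w & (H v < H w)%N.
Proof.
have [gd _ [[r rr] _]] := D_tree.
apply: contrapT => /forall2NP Nhigher.
have closed u w : climbs v u -> adj u w -> climbs v w.
  move=> cu uw; case: cu uw => [vw|u' w' uw' Huw' cw' uw].
    have [//|/negP] := Nhigher w; rewrite -leqNgt => Hw.
    by apply: (climbs_step _ Hw); [rewrite adj_sym | exact: climbs_refl].
  have [->//|ww'] := pselect (w = w').
  have [Huw|Hwu] := leqP (H u') (H w).
    by case: ww'; exact: height_upper_uniq uw uw' Huw Huw'.
  apply: (@climbs_step v w u'); [by rewrite adj_sym | exact: ltnW |].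
  exact: climbs_step uw' Huw' cw'.
have path_closed p u : climbs v u -> path adj u p -> climbs v (last u p).
  by elim: p u => //= w p IHp u cu /andP[uw]; apply: IHp; exact: closed cu uw.
have [[p [vp lastp _]] _] := gd v (r (H v).+1).
have := climbs_height (path_closed p v (climbs_refl v) vp).
by rewrite lastp leqNgt (height_ray_ge _ rr).
Qed.

Lemma exists_ray_from v : exists2 r, ray r & r 0%N = v.
Proof.
have /choice[f fP] : forall v, exists w, adj v w /\ (H v < H w)%N.
  by move=> u; have [w uw Huw] := exists_higher u; exists w.
exists (fun n => iter n f v) => //; split; last by move=> n; exact: (fP _).1.
have mono : {homo (fun n => H (iter n f v)) : m n / (m < n)%N}.
  by apply: homo_ltn => [m n p|n]; [exact: ltn_trans | exact: (fP _).2].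
move=> m n mn; case: (ltngtP m n) => // /mono; rewrite mn ltnn //.
Qed.

Lemma parentP v : adj v (parent v) /\ (H v < H (parent v))%N.
Proof.
rewrite /parent; case: xgetP => [w _ [r [rr <- <-]]|Nray].
  by split; [exact: rr.2 | exact: height_ray].
have [r rr r0] := exists_ray_from v.
by case: (Nray (r 1%N)); exists r.
Qed.

Lemma adj_parent v : adj v (parent v).
Proof. exact: (parentP v).1. Qed.

Lemma height_parent v : (H v < H (parent v))%N.
Proof. exact: (parentP v).2. Qed.

Lemma parent_uniq v w : adj v w -> (H v <= H w)%N -> parent v = w.
Proof.
move=> vw Hvw; apply: height_upper_uniq Hvw => //; first exact: adj_parent.
exact/ltnW/height_parent.
Qed.

Lemma adj_parentE v w : adj v w -> parent v = w \/ parent w = v.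
Proof.
move=> vw; have [Hvw|Hwv] := leqP (H v) (H w); first by left; exact: parent_uniq.
by right; apply: parent_uniq; [rewrite adj_sym | exact: ltnW].
Qed.

Lemma leaf_height v : leaf v <-> H v = 0%N.
Proof.
split=> [[w [vw wu]]|Hv].
  suff /lowH : low 1 v by case: (H v).
  by move=> a b /wu <- /wu <-.
have /lowH l1 : (H v < 1)%N by rewrite Hv.
exists (parent v); split; first exact: adj_parent.
by move=> w vw; apply: l1 => //; exact: adj_parent.
Qed.

Lemma leaf_no_child v w : leaf v -> parent w <> v.
Proof. by move=> /leaf_height Hv wv; have := height_parent w; rewrite wv Hv. Qed.

Lemma ray_parent (r : nat -> D) i : ray r -> r i.+1 = parent (r i).
Proof.
move=> rr; apply/esym/parent_uniq; first exact: rr.2.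
exact/ltnW/height_ray.
Qed.

Lemma ray_iter_parent (r : nat -> D) i : ray r -> r i = iter i parent (r 0%N).
Proof. by move=> rr; elim: i => // i IHi; rewrite ray_parent// IHi. Qed.

Lemma ray_of v : ray (fun n => iter n parent v).
Proof.
have [r rr r0] := exists_ray_from v.
rewrite (_ : (fun n => _) = r)//; apply/funext => i.
by rewrite (ray_iter_parent i rr) r0.
Qed.

Lemma height_iter_parent v n : (n <= H (iter n parent v))%N.
Proof. exact: (height_ray_ge n (ray_of v)). Qed.

End with_height.

End pruning.

(** * Integrals and mass transport *)

Section comparison_sets.
Context d (T : measurableType d) (R : realType) (f g : T -> R).
Hypotheses (mf : measurable_fun setT f) (mg : measurable_fun setT g).

Let measurable_bool (b : T -> bool) :
  measurable_fun setT b -> measurable [set x | b x].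
Proof.
move=> mb; rewrite (_ : [set x | b x] = setT `&` b @^-1` [set true]).
  exact: mb.
by rewrite setTI.
Qed.

Lemma measurable_set_ltr : measurable [set x | f x < g x].
Proof. exact/measurable_bool/measurable_fun_ltr. Qed.

Lemma measurable_set_ler : measurable [set x | f x <= g x].
Proof. exact/measurable_bool/measurable_fun_ler. Qed.

Lemma measurable_set_eqr : measurable [set x | f x = g x].
Proof.
rewrite (_ : [set x | f x = g x] = [set x | f x == g x]).
  exact/measurable_bool/measurable_fun_eqr.
by apply/seteqP; split=> x /= /eqP.
Qed.

End comparison_sets.

Section integral_full_set.
Context d (T : measurableType d) (R : realType) (mu : {measure set T -> \bar R}).
Variable E : set T.
Hypotheses (mE : measurable E) (muE : mu (~` E) = 0%E).
Local Open Scope ereal_scope.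
Import HBNNSimple.

(* The integral of a non-measurable nonnegative function is its lower integral,
   which is still insensitive to null sets. *)
Lemma le_integral_full (f g : T -> \bar R) : (forall x, 0 <= f x) ->
  (forall x, 0 <= g x) -> (forall x, E x -> f x <= g x) ->
  \int[mu]_x f x <= \int[mu]_x g x.
Proof.
move=> f0 g0 fg; rewrite !ge0_integralTE//.
apply: ge_ereal_sup => _ [h hf <-].
pose k : {nnsfun T >-> R} := mul_nnsfun h (indic_nnsfun R mE).
have -> : sintegral mu h = sintegral mu k.
  rewrite -!integralT_nnsfun; apply: ge0_ae_eq_integral => //.
  - exact/measurable_EFinP/measurable_funP.
  - exact/measurable_EFinP/measurable_funP.
  - by move=> x _; rewrite lee_fin.
  - by move=> x _; rewrite lee_fin.
  exists (~` E); split=> //; first exact: measurableC.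
  move=> x /= hk Ex; apply: hk => _.
  by rewrite /k /= /mindic indicE mem_set// mulr1.
apply: ereal_sup_ubound; exists k => // x /=.
rewrite /mindic indicE; have [|] := boolP (x \in E); rewrite ?inE => Ex.
  by rewrite mulr1; apply: le_trans (hf x) (fg _ _).
by rewrite mulr0.
Qed.

Lemma eq_integral_full (f g : T -> \bar R) : (forall x, E x -> f x = g x) ->
  \int[mu]_x f x = \int[mu]_x g x.
Proof.
have ge0_eq (u v : T -> \bar R) : (forall x, 0 <= u x) -> (forall x, 0 <= v x) ->
    (forall x, E x -> u x = v x) -> \int[mu]_x u x = \int[mu]_x v x.
  move=> u0 v0 uv; apply/eqP; rewrite eq_le.
  by apply/andP; split; apply: le_integral_full => // x /uv ->.
move=> fg; rewrite integralE [RHS]integralE.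
by congr (_ - _); apply: ge0_eq => // x Ex; rewrite ?funeposE ?funenegE fg.
Qed.

End integral_full_set.

Section vertex_esum.
Context {R : realType} {M : pseudoPMetricType R}.

Lemma esum_vertices (X : marked_space M) (o : X) (g : X -> R) (r : R) :
  (forall v, 0 <= g v) -> (forall v, r < dist o v -> g v = 0) ->
  (\esum_(v in [set: X]) (g v)%:E)%E = (\sum_(v \in [set: X]) g v)%:E.
Proof.
move=> g0 gr; pose B := [set v | dist o v <= r].
have finB : finite_set B := finite_balls _ _.
have -> : (\esum_(v in [set: X]) (g v)%:E = \esum_(v in B) (g v)%:E)%E.
  rewrite [RHS]esum_mkcond; apply: eq_esum => v _.
  have [//|] := boolP (v \in B); rewrite notin_setE /B /= => /negP.
  by rewrite -ltNge => /gr ->.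
rewrite esum_fset// => [|v _]; last by rewrite lee_fin.
rewrite fsumEFin//; congr EFin; apply: fsbig_widen => // v [_ /= /negP].
by rewrite -ltNge => /gr.
Qed.

Lemma vsum_ge0 (g : Dstar2 M -> R) x : (forall y, 0 <= g y) -> 0 <= vsum g x.
Proof. by move=> g0; apply: fsumr_ge0. Qed.

Context (P : probability (Dstar M) R) (P_unimodular : unimodular P).

(** [k] is the mass received at the origin. The bounded range turns both extended sums into finite
    ones. *)
Lemma mass_transport (g : Dstar2 M -> R) (k : Dstar M -> R) (r : R) :
  (forall x, 0 <= g x) -> measurable_fun setT g ->
  (forall x, r < dist2 x -> g x = 0) ->
  (forall x, k x = \sum_(v \in [set: rep x]) g (cls2 v (origin (rep x)))) ->
  (\int[P]_x (vsum g x)%:E = \int[P]_x (k x)%:E)%E.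
Proof.
move=> g0 mg gr kE; have := P_unimodular g0 mg.
under eq_integral => x _.
  rewrite (@esum_vertices _ (origin (rep x)) (fun v => g (cls2 (origin (rep x)) v)) r)//;
    last by move=> v rv; apply: gr; rewrite dist2_cls.
  over.
move=> ->; apply: eq_integral => x _.
rewrite (@esum_vertices _ (origin (rep x)) (fun v => g (cls2 v (origin (rep x)))) r)//.
  by rewrite -kE.
by move=> v rv; apply: gr; rewrite dist2_cls dist_sym.
Qed.

(** Let [N] be a null set containing the failures and let each vertex send mass 1 to every vertex of
    [N] within distance n. The mean mass sent equals the mean mass received, which is 0 since only
    roots in [N] receive any; hence almost surely no vertex lies in [N]. *)
Lemma saturated_full_set (Phi : Dstar M -> Prop) : {ae P, forall x, Phi x} ->
  exists Dom : set (marked_space M),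
    let E := [set x : Dstar M | Dom (rep x)] in
    [/\ forall (X Y : marked_space M) (h : X -> Y), marked_iso h -> Dom X -> Dom Y,
        measurable E, P E = 1%E,
        forall x, E x -> Phi x &
        forall x, E x -> forall v : rep x, E (cls v)].
Proof.
move=> [N [mN PN NPhi]].
pose Dom (X : marked_space M) := forall v : X, ~ N (cls v); exists Dom.
pose E := [set x : Dstar M | Dom (rep x)].
have Dom_iso (X Y : marked_space M) (h : X -> Y) : marked_iso h -> Dom X -> Dom Y.
  by move=> ih DX v; have [[k hk kh] _ _] := ih; rewrite -(kh v) (cls_iso _ ih).
pose g (n : nat) (x : Dstar2 M) : R :=
  \1_[set x | dist2 x <= n%:R] x * \1_N (second_pt x).
have g0 n x : 0 <= g n x by rewrite mulr_ge0.
have mg n : measurable_fun setT (g n).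
  apply: measurable_funM.
    apply: measurable_indic; apply: measurable_set_ler; last exact: measurable_cst.
    exact: measurable_dist2.
  apply: (measurableT_comp _ measurable_second_pt).
  exact: measurable_indic.
have gn n x : n%:R < dist2 x -> g n x = 0.
  by move=> nx; rewrite /g indicE memNset ?mul0r//=; apply/negP; rewrite -ltNge.
have EC : ~` E = \bigcup_n [set x | 0 < vsum (g n) x].
  apply/seteqP; split=> x /=.
    move=> /existsNP[v /contrapT Nv].
    exists (Num.truncn (dist (origin (rep x)) v)).+1 => //=.
    rewrite lt0r vsum_ge0// andbT; apply/negP => /eqP.
    rewrite (vsum_ball _ (gn _)) => vs0.
    have /eqP := pfsumr_eq0 (finite_balls _ _) (fun _ _ => g0 _ _) vs0
      (ltW (truncnS_gt (dist (origin (rep x)) v))).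
    rewrite /g !indicE !mem_set ?mulr1 ?oner_eq0//= ?second_pt_cls//.
    by rewrite dist2_cls ltW// truncnS_gt.
  move=> [n _ /= vg] Ex; have [v _ gv] := fsumr_gt0 [::] vg.
  case: (Ex v); apply: contrapT => Nv; move: gv; rewrite /g.
  by rewrite second_pt_cls [X in _ * X]indicE memNset ?mulr0 ?ltxx.
have mE : measurable E.
  rewrite -[E]setCK EC; apply: measurableC; apply: bigcup_measurable => n _.
  apply: measurable_set_ltr; first exact: measurable_cst.
  exact: (measurable_vsum (gn n)).
have PE : P (~` E) = 0%E.
  apply/negligibleP; first exact: measurableC.
  rewrite EC; apply: negligible_bigcup => n.
  have vg0 : (\int[P]_x (vsum (g n) x)%:E = 0)%E.
    pose k (x : Dstar M) : R := (\1_N x : R) * \sum_(v \in [set: rep x])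
      (\1_[set x | dist2 x <= n%:R] (cls2 v (origin (rep x))) : R).
    have kE x : k x = \sum_(v \in [set: rep x]) g n (cls2 v (origin (rep x))).
      rewrite /k mulr_fsumr; apply: eq_fsbigr => v _.
      by rewrite /g second_pt_cls cls_rep mulrC.
    rewrite (mass_transport (g0 n) (mg n) (gn n) kE).
    rewrite (@eq_integral_full _ _ _ _ (~` N) _ _ _ (fun=> 0%E)); first exact: integral0.
    - exact: measurableC.
    - by rewrite setCK.
    - by move=> x Nx; rewrite /k indicE memNset// mul0r.
  have : ae_eq P setT (fun x => (vsum (g n) x)%:E) (cst 0%E).
    apply/ae_eq_integral_abs => //.
      by apply/measurable_EFinP; exact: (measurable_vsum (gn n) (mg n)).
    rewrite -[RHS]vg0; apply: eq_integral => x _; rewrite gee0_abs// lee_fin.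
    exact: vsum_ge0.
  apply: negligibleS => x /= vx; apply/not_implyP; split=> // -[] vx0.
  by rewrite vx0 ltxx in vx.
split=> //.
- by apply/eqP; move/eqP: PE; rewrite probability_setC// sube_eq// add0e eq_sym.
- by move=> x Ex; apply: contrapT => /NPhi; have := Ex (origin (rep x)); rewrite cls_rep.
- move=> x Ex v; have [h ih _] := rep_cls_iso v; exact: Dom_iso ih Ex.
Qed.

End vertex_esum.

(** * The parent relation as a Borel kernel *)

Section parent_kernel.
Context {R : realType} {M : pseudoPMetricType R}.

Definition adj2 : set (Dstar2 M) := [set x | dist2 x = 1].

(* The Borel counterpart of [low]. *)
Fixpoint lowD (n : nat) : set (Dstar M) :=
  if n is m.+1 then
    [set x | vsum (fun y => \1_adj2 y * \1_(~` lowD m) (second_pt y)) x <= 1]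
  else set0.

(** Some pruning round has removed the first point and not the second: for neighbours in a one-ended
    tree, the second is then the parent of the first. Stated this way the relation is Borel on all
    doubly-pointed spaces. *)
Definition up2 : set (Dstar2 M) :=
  [set x | adj2 x /\ exists n, lowD n (first_pt x) /\ ~ lowD n (second_pt x)].
Definition down2 : set (Dstar2 M) :=
  [set x | adj2 x /\ exists n, lowD n (second_pt x) /\ ~ lowD n (first_pt x)].

Definition at_parent (a : Dstar M -> R) : Dstar M -> R :=
  vsum (fun y => \1_up2 y * a (second_pt y)).
Definition over_children (a : Dstar M -> R) : Dstar M -> R :=
  vsum (fun y => \1_down2 y * a (second_pt y)).

Lemma adj2_supp (A : set (Dstar2 M)) (f : Dstar2 M -> R) x :
  A `<=` adj2 -> 1 < dist2 x -> \1_A x * f x = 0.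
Proof.
move=> Aadj x1; rewrite indicE memNset ?mul0r// => /Aadj x1'.
by move: x1; rewrite x1' ltxx.
Qed.

Lemma measurable_adj2 : measurable adj2.
Proof.
exact: (measurable_set_eqr measurable_dist2 (measurable_cst _)).
Qed.

Lemma measurable_kernel_sum (A : set (Dstar2 M)) (f : Dstar2 M -> R) :
  A `<=` adj2 -> measurable A -> measurable_fun setT f ->
  measurable_fun setT (vsum (fun y => \1_A y * f y)).
Proof.
move=> Aadj mA mf; apply: (@measurable_vsum _ _ _ 1).
  by move=> x; exact: (adj2_supp f Aadj).
by apply: measurable_funM => //; exact: measurable_indic.
Qed.

Lemma measurable_lowD n : measurable (lowD n).
Proof.
elim: n => [|n IHn]; first exact: measurable0.
apply: measurable_set_ler; last exact: measurable_cst.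
apply: (@measurable_kernel_sum adj2 (\1_(~` lowD n) \o second_pt)) => //.
  exact: measurable_adj2.
apply: (measurableT_comp _ measurable_second_pt).
by apply: measurable_indic; exact: measurableC.
Qed.

Let measurable_pre (p : Dstar2 M -> Dstar M) A : measurable_fun setT p ->
  measurable A -> measurable (p @^-1` A).
Proof. by move=> mp mA; rewrite -[_ @^-1` _]setTI; exact: mp. Qed.

Lemma measurable_up2 : measurable up2.
Proof.
rewrite (_ : up2 = adj2 `&` \bigcup_n (first_pt @^-1` lowD n `&` second_pt @^-1` (~` lowD n))).
  apply: measurableI; first exact: measurable_adj2.
  apply: bigcup_measurable => n _; apply: measurableI; apply: measurable_pre.
  - exact: measurable_first_pt.
  - exact: measurable_lowD.
  - exact: measurable_second_pt.
  - by apply: measurableC; exact: measurable_lowD.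
by apply/seteqP; split=> x [ax [n]]; [move=> nx | move=> _ nx]; split=> //; exists n.
Qed.

Lemma measurable_down2 : measurable down2.
Proof.
rewrite (_ : down2 = adj2 `&` \bigcup_n (second_pt @^-1` lowD n `&` first_pt @^-1` (~` lowD n))).
  apply: measurableI; first exact: measurable_adj2.
  apply: bigcup_measurable => n _; apply: measurableI; apply: measurable_pre.
  - exact: measurable_second_pt.
  - exact: measurable_lowD.
  - exact: measurable_first_pt.
  - by apply: measurableC; exact: measurable_lowD.
by apply/seteqP; split=> x [ax [n]]; [move=> nx | move=> _ nx]; split=> //; exists n.
Qed.

Lemma measurable_at_parent a : measurable_fun setT a ->
  measurable_fun setT (at_parent a).
Proof.
move=> ma; apply: (@measurable_kernel_sum up2 (a \o second_pt));
  [by move=> x [] | exact: measurable_up2 |].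
exact: measurableT_comp ma measurable_second_pt.
Qed.

Lemma measurable_over_children a : measurable_fun setT a ->
  measurable_fun setT (over_children a).
Proof.
move=> ma; apply: (@measurable_kernel_sum down2 (a \o second_pt));
  [by move=> x [] | exact: measurable_down2 |].
exact: measurableT_comp ma measurable_second_pt.
Qed.

Lemma at_parent_ge0 a x : (forall y, 0 <= a y) -> 0 <= at_parent a x.
Proof. by move=> a0; apply: vsum_ge0 => y; rewrite mulr_ge0. Qed.

Lemma over_children_ge0 a x : (forall y, 0 <= a y) -> 0 <= over_children a x.
Proof. by move=> a0; apply: vsum_ge0 => y; rewrite mulr_ge0. Qed.

Lemma adj2_cls (X : marked_space M) (v w : X) : adj2 (cls2 v w) = adj v w :> Prop.
Proof. by rewrite /adj2 /= dist2_cls; apply/propext; split=> /eqP. Qed.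

(** The sum in [lowD] counts the neighbours that survive n rounds; it is at most 1 exactly when any
    two of them coincide. *)
Lemma lowD_cls (X : marked_space M) n (v : X) : lowD n (cls v) <-> low n v.
Proof.
elim: n v => [//|n IHn] v /=.
pose S := [set w | adj v w /\ ~ low n w].
have finS : finite_set S by apply: sub_finite_set (finite_adj v) => w [].
have -> : vsum (fun y => \1_adj2 y * \1_(~` lowD n) (second_pt y)) (cls v) =
    \sum_(w \in S) (1 : R).
  rewrite vsum_cls [RHS]fsbig_mkcond; apply: eq_fsbigr => w _.
  rewrite /patch second_pt_cls !indicE -!natrM mulnb.
  have -> : (cls2 v w \in adj2) && (cls w \in ~` lowD n) = (w \in S).
    apply/idP/idP => [/andP[/set_mem vw /set_mem lw]|/set_mem[vw lw]].
      by apply/mem_set; split; [rewrite -adj2_cls | move=> /IHn].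
    by apply/andP; split; apply/mem_set; [rewrite adj2_cls | move=> /IHn].
  by case: (w \in S).
split=> [S1 w w' vw vw' lw lw'|lv].
  apply: contrapT => ww'; move: S1.
  rewrite (fsbigD1 w)//= (fsbigD1 w')//=; last 2 first.
  - exact: finite_setD.
  - by split=> //; exact: nesym.
  have : 0 <= \sum_(j \in (S `\ w) `\ w') (1 : R) by apply: fsumr_ge0.
  by lra.
have [->|/set0P[w Sw]] := eqVneq S set0; first by rewrite fsbig_set0.
have -> : S = [set w].
  apply/seteqP; split=> [w' [vw' lw']|_ ->//].
  by case: Sw => vw lw; exact: lv.
by rewrite fsbig_set1.
Qed.

Section on_tree.
Variables (X : marked_space M) (X_tree : one_ended_tree X).

Lemma up2_cls (v w : X) : up2 (cls2 v w) <-> parent v = w.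
Proof.
have [H lowH] := exists_height X_tree; rewrite /up2 /= adj2_cls first_pt_cls second_pt_cls.
split=> [[vw [n []]]|<-].
  rewrite !lowD_cls !lowH => vn /negP; rewrite -leqNgt => nw.
  by apply: (parent_uniq X_tree lowH vw); exact/ltnW/(leq_trans vn nw).
split; first exact: (adj_parent X_tree lowH).
exists (H v).+1; rewrite !lowD_cls !lowH ltnS leqnn; split=> //.
by apply/negP; rewrite -leqNgt; exact: (height_parent X_tree lowH).
Qed.

Lemma down2_cls (v w : X) : down2 (cls2 v w) <-> parent w = v.
Proof.
rewrite -up2_cls /up2 /down2 /= !adj2_cls !first_pt_cls !second_pt_cls.
by rewrite adj_sym.
Qed.

Lemma at_parent_cls a (v : X) : at_parent a (cls v) = a (cls (parent v)).
Proof.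
rewrite /at_parent vsum_cls.
transitivity (\sum_(w \in [set parent v]) a (cls w)); last by rewrite fsbig_set1.
rewrite [RHS]fsbig_mkcond.
apply: eq_fsbigr => w _; rewrite /patch second_pt_cls indicE.
have -> : (cls2 v w \in up2) = (w \in [set parent v]).
  by apply/idP/idP; rewrite !inE up2_cls /= => ->.
by case: (w \in _); rewrite (mul1r, mul0r).
Qed.

Lemma over_children_cls a (v : X) :
  over_children a (cls v) = \sum_(w \in [set w | parent w = v]) a (cls w).
Proof.
rewrite /over_children vsum_cls [RHS]fsbig_mkcond.
apply: eq_fsbigr => w _; rewrite /patch second_pt_cls indicE.
have -> : (cls2 v w \in down2) = (w \in [set w | parent w = v]).
  by apply/idP/idP; rewrite !inE down2_cls /=.
by case: (w \in _); rewrite (mul1r, mul0r).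
Qed.

Lemma finite_children (v : X) : finite_set [set w | parent w = v].
Proof.
have [H lowH] := exists_height X_tree.
apply: sub_finite_set (finite_adj v) => w <-.
by rewrite /= adj_sym; exact: (adj_parent X_tree lowH).
Qed.

End on_tree.

Context (P : probability (Dstar M) R) (P_unimodular : unimodular P).

(** Transport of a(v) b(w) from [v] to [w] along [up2], whose transpose is [down2]: [at_parent] and
    [over_children] are adjoint. *)
Lemma mass_transport_parent (a b : Dstar M -> R) :
  (forall x, 0 <= a x) -> (forall x, 0 <= b x) ->
  measurable_fun setT a -> measurable_fun setT b ->
  (\int[P]_x (a x * at_parent b x)%:E = \int[P]_x (b x * over_children a x)%:E)%E.
Proof.
move=> a0 b0 ma mb.
pose g y := \1_up2 y * (a (first_pt y) * b (second_pt y)).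
have -> : (fun x => (a x * at_parent b x)%:E) = (fun x => (vsum g x)%:E).
  apply/funext => x; congr EFin; rewrite mulr_fsumr; apply: eq_fsbigr => v _.
  by rewrite /g first_pt_cls cls_rep mulrCA.
apply: (mass_transport P_unimodular (r := 1)).
- by move=> y; rewrite !mulr_ge0.
- apply: measurable_funM; first by apply: measurable_indic; exact: measurable_up2.
  apply: measurable_funM.
    exact: measurableT_comp ma measurable_first_pt.
  exact: measurableT_comp mb measurable_second_pt.
- move=> y; apply: (@adj2_supp up2 (fun y => a (first_pt y) * b (second_pt y))).
  by move=> ? [].
move=> x; rewrite mulr_fsumr; apply: eq_fsbigr => v _.
rewrite /g !first_pt_cls !second_pt_cls cls_rep mulrCA [b x * _]mulrC.
congr (_ * _); rewrite !indicE; congr (nat_of_bool _)%:R.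
by apply/idP/idP; rewrite !inE /up2 /down2 /= !adj2_cls !first_pt_cls !second_pt_cls
  adj_sym.
Qed.

End parent_kernel.

(** * The maximal flow *)

Section capacities.
Context {R : realType}.
Local Notation M := (nonnegR R).

Definition cond2 (x : Dstar2 M) : R := set_val (mark2 x).
Definition capacity : Dstar M -> R := vsum (fun y => \1_up2 y * cond2 y).
(** The first round removes the vertices with at most one neighbour; in a one-ended tree these are
    the leaves, since every vertex has a parent. *)
Definition leafD : set (Dstar M) := lowD 1.

Lemma cond2_cls (X : marked_space M) (u v : X) : cond2 (cls2 u v) = cond u v.
Proof. by rewrite /cond2 mark2_cls. Qed.

Lemma cond_ge0 (X : marked_space M) (u v : X) : 0 <= cond u v.
Proof. exact: (set_mem (valP (mark u v))). Qed.

Lemma measurable_cond2 : measurable_fun setT cond2.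
Proof.
apply: (@measurable_mark2 _ M set_val) => a e e0; exists e => // b ab.
by rewrite distrC ltW//; move: ab; rewrite /ball /= /initial_ball -ball_normE.
Qed.

Lemma measurable_capacity : measurable_fun setT capacity.
Proof.
apply: (@measurable_kernel_sum _ M up2 cond2); first by move=> x [].
- exact: measurable_up2.
- exact: measurable_cond2.
Qed.

Lemma capacity_ge0 x : 0 <= capacity x.
Proof. by apply: vsum_ge0 => y; rewrite mulr_ge0//; exact: cond_ge0. Qed.

Lemma measurable_leafD : measurable leafD.
Proof. exact: measurable_lowD. Qed.

(* [max_flow n x] is the largest flow from the leaves into the origin of [x]
   and through the edge above it, when the height of the origin is below [n]. *)
Fixpoint max_flow (n : nat) : Dstar M -> R :=
  if n is m.+1 then
    fun x => if x \in leafD then capacity x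
             else Num.min (capacity x) (over_children (max_flow m) x)
  else fun=> 0.

Lemma max_flowS n x : max_flow n.+1 x = if x \in leafD then capacity x
  else Num.min (capacity x) (over_children (max_flow n) x).
Proof. by []. Qed.

Lemma measurable_max_flow n : measurable_fun setT (max_flow n).
Proof.
elim: n => [|n IHn] /=; first exact: measurable_cst.
apply: measurable_fun_ifT.
- apply: (@measurable_fun_bool _ _ _ _ true).
  rewrite setTI (_ : _ @^-1` _ = leafD); first exact: measurable_leafD.
  by apply/seteqP; split=> x; [exact: set_mem | exact: mem_set].
- exact: measurable_capacity.
- apply: measurable_minr; first exact: measurable_capacity.
  exact: measurable_over_children.
Qed.

Lemma max_flow_ge0 n x : 0 <= max_flow n x.
Proof.
elim: n x => //= n IHn x; case: ifP => _; first exact: capacity_ge0.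
by rewrite le_min capacity_ge0 over_children_ge0.
Qed.

(* The product of [r] over the first [n] strict ancestors of the origin. *)
Fixpoint ancestor_prod (r : Dstar M -> R) (n : nat) : Dstar M -> R :=
  if n is m.+1 then at_parent (fun y => r y * ancestor_prod r m y) else fun=> 1.

Lemma measurable_ancestor_prod r n : measurable_fun setT r ->
  measurable_fun setT (ancestor_prod r n).
Proof.
move=> mr; elim: n => [|n IHn] /=; first exact: measurable_cst.
by apply: measurable_at_parent; exact: measurable_funM.
Qed.

Lemma ancestor_prod_ge0 r n x : (forall y, 0 <= r y) -> 0 <= ancestor_prod r n x.
Proof.
move=> r0; elim: n x => //= n IHn x; apply: at_parent_ge0 => y.
by rewrite mulr_ge0.
Qed.

Section on_tree.
Variables (X : marked_space M) (X_tree : one_ended_tree X).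
Variables (H : X -> nat) (lowH : forall n v, low n v <-> (H v < n)%N).

Lemma capacity_cls (v : X) : capacity (cls v) = cond v (parent v).
Proof.
rewrite /capacity vsum_cls.
transitivity (\sum_(w \in [set parent v]) cond v w); last by rewrite fsbig_set1.
rewrite [RHS]fsbig_mkcond; apply: eq_fsbigr => w _; rewrite /patch cond2_cls indicE.
have -> : (cls2 v w \in up2) = (w \in [set parent v]).
  by apply/idP/idP; rewrite !inE (up2_cls X_tree) /= => ->.
by case: (w \in _); rewrite (mul1r, mul0r).
Qed.

Lemma leafD_cls (v : X) : leafD (cls v) <-> leaf v.
Proof.
rewrite /leafD lowD_cls lowH (leaf_height X_tree lowH).
by case: (H v).
Qed.

(** Children are strictly lower, so n levels of recursion reach all the leaves below a vertex of
    height less than n. *)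
Lemma max_flow_stable n m (v : X) : (H v < n)%N -> (n <= m)%N ->
  max_flow m (cls v) = max_flow n (cls v).
Proof.
elim: n m v => // n IHn [//|m] v Hv nm /=; case: ifPn => // _.
congr Num.min; rewrite !(over_children_cls X_tree); apply: eq_fsbigr => w.
rewrite inE /= => wv; apply: IHn => //.
by have := height_parent X_tree lowH w; rewrite wv; lia.
Qed.

Lemma ancestor_prodE r n (v : X) :
  ancestor_prod r n (cls v) = \prod_(i < n) r (cls (iter i.+1 parent v)).
Proof.
elim: n v => [|n IHn] v; first by rewrite big_ord0.
rewrite big_ord_recl [LHS]/= (at_parent_cls X_tree) IHn; congr (_ * _).
by apply: eq_bigr => i _; rewrite lift0 [in RHS]iterSr.
Qed.

End on_tree.

End capacities.

Lemma measurable_lim_on (R : realType) d (T : measurableType d) (E : set T)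
    (u : nat -> T -> R) : measurable E -> (forall n, measurable_fun setT (u n)) ->
  (forall x, E x -> cvgn (u ^~ x)) ->
  measurable_fun setT (fun x => \1_E x * limn (u ^~ x)).
Proof.
move=> mE mu cu; apply: (@measurable_fun_cvg _ _ _ _ (fun n x => \1_E x * u n x)).
  by move=> n; apply: measurable_funM => //; exact: measurable_indic.
move=> x _; rewrite indicE; have [/set_mem Ex|_] := boolP (x \in E).
  under eq_fun do rewrite mul1r; rewrite mul1r; exact: cu.
under eq_fun do rewrite mul0r; rewrite mul0r; exact: cvg_cst.
Qed.

Section limit_flow.
Context {R : realType}.
Local Notation M := (nonnegR R).
Variables (E : set (Dstar M)) (mE : measurable E).
Hypothesis E_tree : forall x, E x -> one_ended_tree (rep x).
Hypothesis E_reroot : forall x, E x -> forall v : rep x, E (cls v).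

(** In the notation of the overview, [throughput] is h, [ratio] is rho, [survival] is the product of
    rho over all strict ancestors and [flow1] is f. The limits are multiplied by the indicator of
    [E], where they exist. *)
Definition throughput (x : Dstar M) : R := \1_E x * limn (max_flow ^~ x).

Definition ratio (x : Dstar M) : R :=
  if capacity x < over_children throughput x
  then capacity x / over_children throughput x else 1.

Definition survival (x : Dstar M) : R := \1_E x * limn (ancestor_prod ratio ^~ x).

Definition flow1 (x : Dstar M) : R := throughput x * survival x.

(** The flow as a mark on ordered pairs: an edge carries the value of its lower end in both
    directions. *)
Definition flow2 (y : Dstar2 M) : R :=
  \1_up2 y * flow1 (first_pt y) + \1_down2 y * flow1 (second_pt y).

Lemma max_flow_cvg x (v : rep x) (H : rep x -> nat) n : E x ->
  (forall n v, low n v <-> (H v < n)%N) -> (H v < n)%N ->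
  max_flow ^~ (cls v) @ \oo --> max_flow n (cls v).
Proof.
move=> Ex lowH vn; apply: cvg_near_cst; near=> m.
apply: (max_flow_stable (E_tree Ex) lowH vn); near: m; exact: nbhs_infty_ge.
Unshelve. all: by end_near. Qed.

Lemma throughput_cls x (v : rep x) (H : rep x -> nat) n : E x ->
  (forall n v, low n v <-> (H v < n)%N) -> (H v < n)%N ->
  throughput (cls v) = max_flow n (cls v).
Proof.
move=> Ex lowH vn; rewrite /throughput indicE mem_set ?mul1r; last exact: E_reroot.
by apply/cvg_lim => //; exact: max_flow_cvg lowH vn.
Qed.

Lemma measurable_throughput : measurable_fun setT throughput.
Proof.
apply: measurable_lim_on => //; first exact: measurable_max_flow.
move=> x Ex; have [H lowH] := exists_height (E_tree Ex).
have := max_flow_cvg Ex lowH (leqnn (H (origin (rep x))).+1).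
by rewrite cls_rep => cv; apply/cvg_ex; eexists; exact: cv.
Qed.

Lemma throughput_ge0 x : 0 <= throughput x.
Proof.
rewrite /throughput indicE; have [/set_mem Ex|_] := boolP (x \in E); last by rewrite mul0r.
rewrite mul1r; have [H lowH] := exists_height (E_tree Ex).
have := max_flow_cvg Ex lowH (leqnn (H (origin (rep x))).+1).
by rewrite cls_rep => /cvg_lim ->//; exact: max_flow_ge0.
Qed.

Lemma over_throughput_ge0 x : 0 <= over_children throughput x.
Proof. exact: over_children_ge0 throughput_ge0. Qed.

Lemma measurable_over_throughput : measurable_fun setT (over_children throughput).
Proof. exact: measurable_over_children measurable_throughput. Qed.

Lemma ratio_ge0 x : 0 <= ratio x.
Proof.
rewrite /ratio; case: ifP => // _.
by rewrite divr_ge0 ?capacity_ge0 ?over_throughput_ge0.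
Qed.

Lemma ratio_le1 x : ratio x <= 1.
Proof.
rewrite /ratio; case: ifP => // cS; rewrite ler_pdivrMr ?mul1r ?ltW//.
exact: le_lt_trans (capacity_ge0 x) cS.
Qed.

Lemma measurable_saturated :
  measurable [set x | capacity x < over_children throughput x].
Proof.
exact: (measurable_set_ltr measurable_capacity measurable_over_throughput).
Qed.

Lemma measurable_ratio : measurable_fun setT ratio.
Proof.
apply: measurable_fun_ifT.
- by apply: measurable_fun_ltr; [exact: measurable_capacity | exact: measurable_over_throughput].
(* The inverse is written as the power -1, a Borel function that agrees with it on nonnegative
   reals. *)
- rewrite (_ : (fun x => _) = fun x => capacity x * (over_children throughput x) `^ (-1)).
    apply: measurable_funM; first exact: measurable_capacity.
    exact: measurableT_comp (measurable_powR _) measurable_over_throughput.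
  by apply/funext => x; rewrite powR_inv1// over_throughput_ge0.
- exact: measurable_cst.
Qed.

Section at_vertices.
Variables (x : Dstar M) (Ex : E x).
Implicit Types v w : rep x.

Lemma throughput_leaf v : leaf v -> throughput (cls v) = capacity (cls v).
Proof.
move=> lv; have [H lowH] := exists_height (E_tree Ex).
rewrite (throughput_cls Ex lowH (leqnn (H v).+1)) /= mem_set//.
exact/(leafD_cls (E_tree Ex) lowH).
Qed.

Lemma throughput_node v : ~ leaf v -> throughput (cls v) =
  Num.min (capacity (cls v)) (over_children throughput (cls v)).
Proof.
move=> lv; have [H lowH] := exists_height (E_tree Ex).
rewrite (throughput_cls Ex lowH (leqnSn (H v).+1)) max_flowS memNset; last first.
  by move/(leafD_cls (E_tree Ex) lowH).
congr Num.min; rewrite !(over_children_cls (E_tree Ex)); apply: eq_fsbigr => w.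
move=> /set_mem wv; have {}wv : parent w = v := wv.
apply/esym; apply: (throughput_cls Ex lowH).
by have := height_parent (E_tree Ex) lowH w; rewrite wv; lia.
Qed.

Lemma throughput_le_capacity v : throughput (cls v) <= capacity (cls v).
Proof.
have [lv|lv] := pselect (leaf v); first by rewrite throughput_leaf.
by rewrite throughput_node// ge_min lexx.
Qed.

(** The reason for the choice of rho: it scales the offer S of the children exactly down to h,
    whether or not c < S. *)
Lemma throughput_ratio v : ~ leaf v ->
  over_children throughput (cls v) * ratio (cls v) = throughput (cls v).
Proof.
move=> lv; rewrite throughput_node// /ratio; case: ltP => cS.
  by rewrite mulrCA divff ?mulr1// gt_eqF// (le_lt_trans (capacity_ge0 _) cS).
by rewrite mulr1.
Qed.

Lemma throughput_saturated v : capacity (cls v) < over_children throughput (cls v) ->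
  throughput (cls v) = capacity (cls v).
Proof.
have [lv _|lv /ltW cS] := pselect (leaf v); first exact: throughput_leaf.
by rewrite throughput_node// (min_idPl cS).
Qed.

Lemma ancestor_prod_le r n m v : (forall y, 0 <= r y) -> (forall y, r y <= 1) ->
  (n <= m)%N -> ancestor_prod r m (cls v) <= ancestor_prod r n (cls v).
Proof.
move=> r0 r1 /subnKC <-; rewrite !(ancestor_prodE (E_tree Ex)) big_split_ord /=.
rewrite ler_piMr ?prodr_ge0// Num.Theory.prodr_ile1// => i _.
by rewrite r0 r1.
Qed.

Lemma survival_cvg v : ancestor_prod ratio ^~ (cls v) @ \oo --> survival (cls v).
Proof.
rewrite /survival indicE mem_set ?mul1r; last exact: E_reroot.
apply: nonincreasing_is_cvgn.
  by move=> n m nm; apply: ancestor_prod_le => //; [exact: ratio_ge0 | exact: ratio_le1].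
by exists 0 => _ [n _ <-]; apply: ancestor_prod_ge0; exact: ratio_ge0.
Qed.

Lemma survival_le n v : survival (cls v) <= ancestor_prod ratio n (cls v).
Proof.
have nincr : nonincreasing_seq (ancestor_prod ratio ^~ (cls v)).
  by move=> k m km; apply: ancestor_prod_le => //; [exact: ratio_ge0 | exact: ratio_le1].
have cv := @survival_cvg v; rewrite -(cvg_lim _ cv)//.
by apply: nonincreasing_cvgn_ge => //; apply/cvg_ex; eexists; exact: cv.
Qed.

Lemma survival_ge0 v : 0 <= survival (cls v).
Proof.
have cv := @survival_cvg v; rewrite -(cvg_lim _ cv)//; apply: limr_ge.
  by apply/cvg_ex; eexists; exact: cv.
by apply: nearW => n; apply: ancestor_prod_ge0; exact: ratio_ge0.
Qed.

Lemma survivalE v :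
  survival (cls v) = ratio (cls (parent v)) * survival (cls (parent v)).
Proof.
have cv := @survival_cvg v; rewrite -(cvg_lim _ cv)//; apply/cvg_lim => //.
rewrite -cvg_shiftS /=; under eq_fun do rewrite (at_parent_cls (E_tree Ex)).
by apply: cvgM; [exact: cvg_cst | exact: survival_cvg].
Qed.

Lemma flow1_ge0 v : 0 <= flow1 (cls v).
Proof. by rewrite mulr_ge0 ?throughput_ge0 ?survival_ge0. Qed.

Lemma survival_le1 v : survival (cls v) <= 1.
Proof. exact: (survival_le 0 v). Qed.

Lemma flow1_le_throughput v : flow1 (cls v) <= throughput (cls v).
Proof. by rewrite ler_piMr ?throughput_ge0 ?survival_le1. Qed.

Lemma flow1_le v : flow1 (cls v) <= cond v (parent v).
Proof.
rewrite -(capacity_cls (E_tree Ex)); apply: le_trans (throughput_le_capacity v).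
exact: flow1_le_throughput.
Qed.

(** For a child w of v the survival of w is rho(v) times that of v, and the sum of h over the
    children times rho(v) is h(v). *)
Lemma flow1_conservation v : ~ leaf v ->
  flow1 (cls v) = \sum_(w \in [set w | parent w = v]) flow1 (cls w).
Proof.
move=> lv; rewrite /flow1 -throughput_ratio// (over_children_cls (E_tree Ex)).
rewrite -mulrA mulr_fsuml; apply: eq_fsbigr => w; rewrite inE /= => wv.
by rewrite (survivalE w) wv.
Qed.

Lemma flow2_parent v : flow2 (cls2 v (parent v)) = flow1 (cls v).
Proof.
have [H lowH] := exists_height (E_tree Ex).
rewrite /flow2 first_pt_cls !indicE mem_set; last exact/(up2_cls (E_tree Ex)).
rewrite memNset ?mul1r ?mul0r ?addr0// => /(down2_cls (E_tree Ex)) pp.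
have := height_parent (E_tree Ex) lowH v.
by have := height_parent (E_tree Ex) lowH (parent v); rewrite pp; lia.
Qed.

Lemma flow2_child v : flow2 (cls2 (parent v) v) = flow1 (cls v).
Proof.
have [H lowH] := exists_height (E_tree Ex).
rewrite /flow2 second_pt_cls !indicE memNset; last first.
  move=> /(up2_cls (E_tree Ex)) pp.
  have := height_parent (E_tree Ex) lowH v.
  by have := height_parent (E_tree Ex) lowH (parent v); rewrite pp; lia.
by rewrite mem_set ?mul1r ?mul0r ?add0r//; exact/(down2_cls (E_tree Ex)).
Qed.

Lemma flow2_legal : edge_symmetric (@mark R _ (rep x)) ->
  @legal_flow_on R (rep x) (fun u v => flow2 (cls2 u v)).
Proof.
move=> sym; have [H lowH] := exists_height (E_tree Ex).
split=> [u v uv|u v uv|v lv].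
- by case: (adj_parentE (E_tree Ex) lowH uv) => <-; rewrite flow2_parent flow2_child.
- case: (adj_parentE (E_tree Ex) lowH uv) => [<-|vu].
    by rewrite flow2_parent flow1_ge0 flow1_le.
  by rewrite -vu flow2_child flow1_ge0 /cond sym ?vu//; have := flow1_le v; rewrite vu.
- rewrite flow2_parent flow1_conservation//; apply: eq_fsbigr => w.
  by rewrite inE /= => <-; rewrite flow2_parent.
Qed.

End at_vertices.

Lemma measurable_survival : measurable_fun setT survival.
Proof.
apply: measurable_lim_on => // [n|x Ex].
  exact: measurable_ancestor_prod measurable_ratio.
have := @survival_cvg _ Ex (origin (rep x)).
by rewrite cls_rep => cv; apply/cvg_ex; eexists; exact: cv.
Qed.

Lemma measurable_flow1 : measurable_fun setT flow1.
Proof. exact: measurable_funM measurable_throughput measurable_survival. Qed.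

Lemma measurable_flow2 : measurable_fun setT flow2.
Proof.
apply: measurable_funD; apply: measurable_funM.
- by apply: measurable_indic; exact: measurable_up2.
- exact: measurableT_comp measurable_flow1 measurable_first_pt.
- by apply: measurable_indic; exact: measurable_down2.
- exact: measurableT_comp measurable_flow1 measurable_second_pt.
Qed.

End limit_flow.

(** * Minimal cuts *)

Section cuts.
Context {R : realType}.
Local Notation M := (nonnegR R).
Variables (E : set (Dstar M)) (mE : measurable E).
Hypothesis E_tree : forall x, E x -> one_ended_tree (rep x).
Hypothesis E_reroot : forall x, E x -> forall v : rep x, E (cls v).
Local Notation ratio := (ratio E).
Local Notation throughput := (throughput E).
Local Notation survival := (survival E).

Definition ratio_below (m : nat) (y : Dstar M) : R :=
  if y \in lowD m then ratio y else 1.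

(** Stopping after m factors loses nothing on a tree: the n-th ancestor has height at least n, so
    from the m-th on the factors are 1. *)
Definition survival_below (m : nat) : Dstar M -> R :=
  ancestor_prod (ratio_below m) m.

(* The topmost edges, among those with lower end of height less than [m], at
   which the capacity limits the flow; the edges above leaves count as such. *)
Definition cutD (m : nat) : set (Dstar M) :=
  [set y | [/\ lowD m y, survival_below m y = 1 &
    leafD y \/ capacity y < over_children throughput y]].

Definition cut2 (m : nat) : set (Dstar2 M) :=
  (up2 `&` first_pt @^-1` cutD m) `|` (down2 `&` second_pt @^-1` cutD m).

Lemma ratio_below_ge0 m y : 0 <= ratio_below m y.
Proof. by rewrite /ratio_below; case: ifP => // _; exact: ratio_ge0. Qed.

Lemma ratio_below_le1 m y : ratio_below m y <= 1.
Proof. by rewrite /ratio_below; case: ifP => // _; exact: ratio_le1. Qed.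

Lemma ratio_le_below m y : ratio y <= ratio_below m y.
Proof. by rewrite /ratio_below; case: ifP => // _; exact: ratio_le1. Qed.

Lemma measurable_ratio_below m : measurable_fun setT (ratio_below m).
Proof.
apply: measurable_fun_ifT.
- apply: (@measurable_fun_bool _ _ _ _ true).
  rewrite setTI (_ : _ @^-1` _ = lowD m); first exact: measurable_lowD.
  by apply/seteqP; split=> x; [exact: set_mem | exact: mem_set].
- exact: measurable_ratio.
- exact: measurable_cst.
Qed.

Lemma survival_below_ge0 m y : 0 <= survival_below m y.
Proof. by apply: ancestor_prod_ge0; exact: ratio_below_ge0. Qed.

Lemma measurable_survival_below m : measurable_fun setT (survival_below m).
Proof. exact: measurable_ancestor_prod (measurable_ratio_below m). Qed.

Lemma measurable_cutD m : measurable (cutD m).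
Proof.
rewrite (_ : cutD m = lowD m `&` [set y | survival_below m y = 1] `&`
    (leafD `|` [set y | capacity y < over_children throughput y])).
  apply: measurableI.
    apply: measurableI; first exact: measurable_lowD.
    exact: (measurable_set_eqr (measurable_survival_below m) (measurable_cst _)).
  apply: measurableU; first exact: measurable_leafD.
  exact: measurable_saturated.
by apply/seteqP; split=> y [] //; case.
Qed.

Lemma measurable_cut2 m : measurable (cut2 m).
Proof.
apply: measurableU; apply: measurableI.
- exact: measurable_up2.
- rewrite -[_ @^-1` _]setTI; apply: measurable_first_pt => //.
  exact: measurable_cutD.
- exact: measurable_down2.
- rewrite -[_ @^-1` _]setTI; apply: measurable_second_pt => //.
  exact: measurable_cutD.
Qed.

Section at_vertices.
Variables (x : Dstar M) (Ex : E x).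
Variables (H : rep x -> nat) (lowH : forall n v, low n v <-> (H v < n)%N).
Implicit Types v w : rep x.
Local Notation anc n v := (iter n (@parent R (rep x)) v).

Let tree := E_tree Ex.

Lemma in_lowD m v : (cls v \in lowD m) = (H v < m)%N.
Proof.
by apply/idP/idP => [/set_mem/lowD_cls/lowH//|Hv]; apply/mem_set/lowD_cls/lowH.
Qed.

Lemma height_anc n v : (n <= H (anc n v))%N.
Proof. exact: (height_iter_parent tree lowH). Qed.

Lemma height_anc_le n k v : (n <= k)%N -> (H (anc n v) <= H (anc k v))%N.
Proof.
move=> /subnK <-; rewrite iterD; elim: (k - n)%N => //= i IHi.
exact: leq_trans IHi (ltnW (height_parent tree lowH _)).
Qed.

Lemma ancestor_prod_above m n v : (m <= n)%N ->
  ancestor_prod (ratio_below m) n (cls v) = survival_below m (cls v).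
Proof.
move=> /subnKC <-; rewrite /survival_below !(ancestor_prodE tree) big_split_ord /=.
rewrite [X in _ * X]big1 ?mulr1// => i _.
rewrite /ratio_below -iterS in_lowD ifN// -leqNgt.
by apply: leq_trans (height_anc _ _); rewrite leqW ?leq_addr.
Qed.

Lemma survival_below_parent m v : survival_below m (cls v) =
  ratio_below m (cls (parent v)) * survival_below m (cls (parent v)).
Proof. by rewrite -(ancestor_prod_above v (leqnSn m)) /= (at_parent_cls tree). Qed.

Lemma survival_le_below m v : survival (cls v) <= survival_below m (cls v).
Proof.
apply: le_trans (survival_le E_tree E_reroot Ex m v) _.
rewrite /survival_below !(ancestor_prodE tree); apply: ler_prod => i _.
by apply/andP; split; [exact: ratio_ge0 | exact: ratio_le_below].
Qed.

(** Heights increase upwards, so the first n factors are not truncated; the others are at most 1. *)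
Lemma survival_below_le m n v : (H (anc n v) < m)%N ->
  survival_below m (cls v) <= ancestor_prod ratio n (cls v).
Proof.
move=> nm; have nlem : (n <= m)%N by exact: ltnW (leq_ltn_trans (height_anc n v) nm).
have -> : ancestor_prod ratio n (cls v) = ancestor_prod (ratio_below m) n (cls v).
  rewrite !(ancestor_prodE tree); apply: eq_bigr => i _.
  by rewrite /ratio_below in_lowD ifT// (leq_ltn_trans _ nm)// height_anc_le.
apply: (ancestor_prod_le E_tree Ex) nlem; [exact: ratio_below_ge0 | exact: ratio_below_le1].
Qed.

(** The truncated product lies between the infinite one and, once m exceeds the height of the n-th
    ancestor, the product over n ancestors. *)
Lemma survival_below_cvg v :
  survival_below ^~ (cls v) @ \oo --> survival (cls v).
Proof.
apply/cvgrPdist_le => e e0.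
have /cvgrPdist_le/(_ e e0)[n _ /(_ n (leqnn n)) /= ne] :=
  @survival_cvg _ _ E_tree E_reroot _ Ex v.
near=> m; have mb : survival_below m (cls v) <= ancestor_prod ratio n (cls v).
  by apply: survival_below_le; near: m; exact: nbhs_infty_gt.
have sb := survival_le_below m v; move: ne; rewrite !ler_norml.
by move=> /andP[? ?]; apply/andP; split; lra.
Unshelve. all: by end_near. Qed.

Lemma cutD_capacity m v : cutD m (cls v) ->
  throughput (cls v) * survival_below m (cls v) = capacity (cls v).
Proof.
move=> [_ -> lc]; rewrite mulr1; case: lc => [/(leafD_cls tree lowH) lv|].
  exact: (throughput_leaf E_tree E_reroot Ex).
exact: (throughput_saturated E_tree E_reroot Ex).
Qed.

Lemma survival_below_eq1 m v : survival_below m (cls v) = 1 ->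
  ratio_below m (cls (parent v)) = 1 /\ survival_below m (cls (parent v)) = 1.
Proof.
rewrite survival_below_parent.
have := ratio_below_ge0 m (cls (parent v)); have := ratio_below_le1 m (cls (parent v)).
have := survival_below_ge0 m (cls (parent v)).
have : survival_below m (cls (parent v)) <= 1.
  exact: (ancestor_prod_le E_tree Ex _ (ratio_below_ge0 m) (ratio_below_le1 m) (leq0n m)).
by move: (ratio_below _ _) (survival_below _ _) => a b *; split; nra.
Qed.

(** The upper of two such vertices is not a leaf, so c < S there and its ratio is below 1; but this
    ratio is a factor of the truncated product of the lower one, which equals 1. *)
Lemma cutD_antichain m v j : cutD m (cls v) -> ~ cutD m (cls (anc j.+1 v)).
Proof.
move=> [_ sv _] [la _ lc]; have {lc} cS : capacity (cls (anc j.+1 v)) <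
    over_children throughput (cls (anc j.+1 v)).
  by case: lc => // /(leafD_cls tree lowH) /(leaf_no_child tree lowH (w := anc j v)).
have sj : survival_below m (cls (anc j v)) = 1.
  by elim: j {la cS} => //= j /survival_below_eq1[].
have [+ _] := survival_below_eq1 sj.
rewrite /ratio_below mem_set// /ratio ifT// => /eqP; rewrite lt_eqF//.
by rewrite ltr_pdivrMr ?mul1r//; exact: le_lt_trans (capacity_ge0 _) cS.
Qed.

(** The witness is the last ancestor of height less than m with c < S, or the leaf itself if there
    is none; heights bound the search by m. *)
Lemma cutD_separates m v : (0 < m)%N -> leaf v -> exists n, cutD m (cls (anc n v)).
Proof.
move=> m0 lv; pose p n := (H (anc n v) < m)%N && ((n == 0%N) ||
  (capacity (cls (anc n v)) < over_children throughput (cls (anc n v)))).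
have p0 : exists n, p n.
  by exists 0%N; rewrite /p /= ((leaf_height tree lowH v).1 lv) m0.
have pm n : p n -> (n <= m)%N.
  by move=> /andP[nm _]; exact: ltnW (leq_ltn_trans (height_anc n v) nm).
case: (ex_maxnP p0 pm) => n /andP[nm nlc] nmax; exists n; split.
- exact/lowD_cls/lowH.
- rewrite /survival_below (ancestor_prodE tree) big1// => i _.
  rewrite /ratio_below in_lowD -iterD; case: ifP => // im.
  rewrite /ratio ifF//; apply/negP => cS; have := nmax (i.+1 + n)%N.
  by rewrite /p im cS orbT => /(_ isT); lia.
- case/orP: nlc => [/eqP -> |]; last by right.
  by left; exact/(leafD_cls tree lowH).
Qed.

Lemma cut2_parent m v : (cls2 v (parent v) \in cut2 m) = (cls v \in cutD m).
Proof.
apply/idP/idP => [/set_mem|/set_mem cv].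
  rewrite /cut2 /= first_pt_cls second_pt_cls.
  move=> [[_ cv]|[/(down2_cls tree) pp _]]; first exact: mem_set.
  have := height_parent tree lowH v.
  by have := height_parent tree lowH (parent v); rewrite pp; lia.
apply/mem_set; left; split; first exact/(up2_cls tree).
by rewrite /= first_pt_cls.
Qed.

Lemma cut2_child m v : (cls2 (parent v) v \in cut2 m) = (cls v \in cutD m).
Proof.
apply/idP/idP => [/set_mem|/set_mem cv].
  rewrite /cut2 /= first_pt_cls second_pt_cls.
  move=> [[/(up2_cls tree) pp _]|[_ cv]]; last exact: mem_set.
  have := height_parent tree lowH v.
  by have := height_parent tree lowH (parent v); rewrite pp; lia.
apply/mem_set; right; split; first exact/(down2_cls tree).
by rewrite /= second_pt_cls.
Qed.

Lemma cut2_cut m : (0 < m)%N -> @cut_on R (rep x) (fun u v => cls2 u v \in cut2 m).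
Proof.
move=> m0; split=> [u v uv|r rr lr].
  by case: (adj_parentE tree lowH uv) => <-; rewrite cut2_parent cut2_child.
have [n nc] := cutD_separates m0 lr; exists n.
rewrite (ray_parent tree lowH n rr) cut2_parent mem_set//.
by rewrite (ray_iter_parent tree lowH n rr).
Qed.

Lemma iter_at_parent b n v :
  iter n at_parent b (cls v) = b (cls (anc n v)).
Proof. by elim: n v => // n IHn v; rewrite iterS (at_parent_cls tree) IHn -iterSr. Qed.

(** By the antichain property, at most one vertex among [v] and its ancestors is counted. *)
Lemma cutD_sum_le1 m N v :
  \sum_(n < N) iter n at_parent (\1_(cutD m) : Dstar M -> R) (cls v) <= 1.
Proof.
under eq_bigr do rewrite iter_at_parent.
have [[k ck]|Nc] := pselect (exists k, cutD m (cls (anc k v))); last first.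
  rewrite big1// => n _; rewrite indicE memNset// => cn.
  by apply: Nc; exists (n : nat).
apply: (@le_trans _ _ (\sum_(n < N) ((n : nat) == k)%:R)).
  apply: ler_sum => n _; rewrite indicE; case: eqVneq => [->|nk].
    by case: (_ \in _).
  rewrite memNset// => cn; case: (ltngtP n k) nk => // lt _.
    exfalso; apply: (cutD_antichain (j := (k - n.+1)%N) cn).
    by rewrite -iterD (_ : (_ + _)%N = k)//; lia.
  exfalso; apply: (cutD_antichain (j := (n - k.+1)%N) ck).
  by rewrite -iterD (_ : (_ + _)%N = n)//; lia.
have [kN|Nk] := ltnP k N.
  rewrite (bigD1 (Ordinal kN))//= eqxx big1 ?addr0// => n nk.
  by case: eqP => // nk'; move: nk; rewrite -val_eqE /= nk' eqxx.
rewrite big1// => n _; case: eqP => // nk; move: Nk.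
by rewrite -nk leqNgt ltn_ord.
Qed.

(** What a leaf sends in the flow truncated at height m. *)
Definition leaf_mass m (y : Dstar M) : R :=
  throughput y * survival_below m y * \1_leafD y.

(** The truncated flow is conserved at nodes of height less than m, so its value at [v] is the total
    sent by the leaves below [v], counted by generation; the condition N <= m keeps all these nodes
    in that range. *)
Lemma mass_sum m N v : (N <= m)%N -> (H v < N)%N ->
  \sum_(n < N) iter n over_children (leaf_mass m) (cls v) =
  throughput (cls v) * survival_below m (cls v).
Proof.
elim: N v => // N IHN v Nm vN; rewrite big_ord_recl.
under eq_bigr do rewrite lift0 iterS (over_children_cls tree).
have [lv|lv] := pselect (leaf v).
  rewrite /= /leaf_mass indicE mem_set ?mulr1; last exact/(leafD_cls tree lowH).
  rewrite big1 ?addr0// => i _; rewrite (_ : [set w | _] = set0) ?fsbig_set0//.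
  by apply/seteqP; split=> // w /=; exact: (leaf_no_child tree lowH).
rewrite /= {1}/leaf_mass indicE memNset ?mulr0 ?add0r; last first.
  by move/(leafD_cls tree lowH).
have -> : \sum_(i < N) \sum_(w \in [set w | parent w = v])
      iter i over_children (leaf_mass m) (cls w) =
    \sum_(w \in [set w | parent w = v]) \sum_(i < N)
      iter i over_children (leaf_mass m) (cls w).
  have finC : finite_set [set w | parent w = v] := finite_children tree v.
  rewrite [RHS]fsbig_finite// exchange_big; apply: eq_bigr => i _.
  by rewrite fsbig_finite.
rewrite -(throughput_ratio E_tree E_reroot Ex lv) (over_children_cls tree) -mulrA mulr_fsuml.
apply: eq_fsbigr => w /set_mem wv; have {}wv : parent w = v := wv.
have wN : (H w < N)%N.
  by have := height_parent tree lowH w; rewrite wv; lia.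
rewrite IHN//; last exact: ltnW.
rewrite survival_below_parent wv /ratio_below in_lowD ifT//.
exact: leq_trans vN Nm.
Qed.

End at_vertices.

Lemma measurable_leaf_mass m : measurable_fun setT (leaf_mass m).
Proof.
apply: measurable_funM; last by apply: measurable_indic; exact: measurable_leafD.
apply: measurable_funM; last exact: measurable_survival_below.
exact: measurable_throughput.
Qed.

Lemma leaf_mass_ge0 m y : 0 <= leaf_mass m y.
Proof.
apply: mulr_ge0 => //; apply: mulr_ge0; last exact: survival_below_ge0.
exact: throughput_ge0.
Qed.

End cuts.

(** * Duality *)

Section mass_chain.
Context {R : realType} {M : pseudoPMetricType R}.
Context (P : probability (Dstar M) R) (P_unimodular : unimodular P).
Implicit Types a b : Dstar M -> R.

Lemma measurable_iter_at_parent n b : measurable_fun setT b ->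
  measurable_fun setT (iter n at_parent b).
Proof. by move=> mb; elim: n => //= n IHn; exact: measurable_at_parent. Qed.

Lemma measurable_iter_over_children n a : measurable_fun setT a ->
  measurable_fun setT (iter n over_children a).
Proof. by move=> ma; elim: n => //= n IHn; exact: measurable_over_children. Qed.

Lemma iter_at_parent_ge0 n b x : (forall x, 0 <= b x) -> 0 <= iter n at_parent b x.
Proof. by move=> b0; elim: n x => //= n IHn x; exact: at_parent_ge0. Qed.

Lemma iter_over_children_ge0 n a x : (forall x, 0 <= a x) ->
  0 <= iter n over_children a x.
Proof. by move=> a0; elim: n x => //= n IHn x; exact: over_children_ge0. Qed.

Lemma mass_chain n a b : (forall x, 0 <= a x) -> (forall x, 0 <= b x) ->
  measurable_fun setT a -> measurable_fun setT b ->
  (\int[P]_x (iter n over_children a x * b x)%:E =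
   \int[P]_x (a x * iter n at_parent b x)%:E)%E.
Proof.
move=> a0 + ma; elim: n b => // n IHn b b0 mb.
under eq_integral do rewrite iterS mulrC.
rewrite -mass_transport_parent//.
- rewrite IHn; last exact: measurable_at_parent.
    by under eq_integral do rewrite -iterSr.
  by move=> x; exact: at_parent_ge0.
- by move=> x; exact: iter_over_children_ge0.
- exact: measurable_iter_over_children.
Qed.

(** One-step adjointness, iterated: gathering [a] from the descendants over fewer than N generations
    is dual to reading [b] at the ancestors. *)
Lemma mass_chain_sum N a b : (forall x, 0 <= a x) -> (forall x, 0 <= b x) ->
  measurable_fun setT a -> measurable_fun setT b ->
  (\int[P]_x ((\sum_(n < N) iter n over_children a x) * b x)%:E =
   \int[P]_x (a x * \sum_(n < N) iter n at_parent b x)%:E)%E.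
Proof.
move=> a0 b0 ma mb.
under eq_integral do rewrite mulr_suml -sumEFin.
under [RHS]eq_integral do rewrite mulr_sumr -sumEFin.
rewrite !ge0_integral_sum//.
- by apply: eq_bigr => n _; exact: mass_chain.
- move=> n; apply/measurable_EFinP/measurable_funM => //.
  exact: measurable_iter_at_parent.
- by move=> n x _; rewrite lee_fin mulr_ge0// iter_at_parent_ge0.
- move=> n; apply/measurable_EFinP/measurable_funM => //.
  exact: measurable_iter_over_children.
- by move=> n x _; rewrite lee_fin mulr_ge0// iter_over_children_ge0.
Qed.

End mass_chain.

Section duality.
Context {R : realType}.
Local Notation M := (nonnegR R).
Context (P : probability (Dstar M) R) (P_unimodular : unimodular P).
Variables (E : set (Dstar M)) (mE : measurable E) (PE : P (~` E) = 0%E).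
Hypothesis E_tree : forall x, E x -> one_ended_tree (rep x).
Hypothesis E_reroot : forall x, E x -> forall v : rep x, E (cls v).

(** On the cut the capacity is the truncated flow, hence the sum of the leaf masses below.
    Transported back to the leaves, each mass is counted at most once, as at most one cut edge lies
    above a leaf. *)
Lemma cut_bound m :
  (\int[P]_x (capacity x * \1_(cutD E m) x)%:E <=
   \int[P]_x (leaf_mass E m x)%:E)%E.
Proof.
have mcut : measurable (cutD E m) by exact: measurable_cutD.
have -> : (\int[P]_x (capacity x * \1_(cutD E m) x)%:E = \int[P]_x
    ((\sum_(n < m) iter n over_children (leaf_mass E m) x) * \1_(cutD E m) x)%:E)%E.
  apply: (eq_integral_full mE PE) => x Ex; congr EFin.
  rewrite indicE; have [/set_mem cx|_] := boolP (x \in cutD E m); last by rewrite !mulr0.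
  rewrite !mulr1; have [H lowH] := exists_height (E_tree Ex).
  have := @cutD_capacity _ E E_tree E_reroot x Ex H lowH m (origin (rep x)).
  have := @mass_sum _ E E_tree E_reroot x Ex H lowH m m (origin (rep x)) (leqnn m).
  rewrite -lowH -lowD_cls cls_rep => -> ; last by case: cx.
  by move=> /(_ cx) ->.
rewrite mass_chain_sum//.
- apply: (le_integral_full mE PE) => [x|x|x Ex].
  + rewrite lee_fin mulr_ge0 ?leaf_mass_ge0//; apply: sumr_ge0 => n _.
    exact: iter_at_parent_ge0.
  + by rewrite lee_fin leaf_mass_ge0.
  rewrite lee_fin ler_piMr ?leaf_mass_ge0//.
  have [H lowH] := exists_height (E_tree Ex).
  have := @cutD_sum_le1 _ E E_tree x Ex H lowH m m (origin (rep x)).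
  by rewrite cls_rep.
- exact: leaf_mass_ge0.
- exact: measurable_leaf_mass.
Qed.

Variable K : R.
Hypothesis E_bounded : forall x, E x -> forall v : rep x, leaf v ->
  cond v (parent v) <= K.

(** The absolute value accounts for the classes where the left-hand side is 0 while [K] could be
    negative. *)
Lemma leaf_throughput_le x : throughput E x * \1_leafD x <= `|K|.
Proof.
rewrite indicE; have [/set_mem lx|_] := boolP (x \in leafD); last by rewrite mulr0.
rewrite mulr1; have [Ex|NEx] := pselect (E x); last first.
  by rewrite /throughput indicE memNset// mul0r.
have [H lowH] := exists_height (E_tree Ex).
have lo : leaf (origin (rep x)).
  by apply/(leafD_cls (E_tree Ex) lowH); rewrite cls_rep.
have := throughput_leaf E_tree E_reroot Ex lo.
rewrite (capacity_cls (E_tree Ex)) cls_rep => ->.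
exact: le_trans (E_bounded Ex lo) (ler_norm K).
Qed.

(** Dominated by the constant |K|: truncated products are at most 1, and the throughput of a leaf is
    its conductance. *)
Lemma leaf_mass_cvg :
  (\int[P]_x (leaf_mass E m x)%:E)%E @[m --> \oo] -->
  (\int[P]_x (flow1 E x * \1_leafD x)%:E)%E.
Proof.
have below1 m x : E x -> survival_below E m x <= 1.
  move=> Ex; have := ancestor_prod_le E_tree Ex (origin (rep x))
    (ratio_below_ge0 E_tree m) (ratio_below_le1 E m) (leq0n m).
  by rewrite cls_rep.
have [|||||_ _ cvg_int] := @dominated_convergence _ _ _ P setT measurableT
  (fun m x => (leaf_mass E m x)%:E) (fun x => (flow1 E x * \1_leafD x)%:E)
  (cst `|K|%:E).
- by move=> m; apply/measurable_EFinP; exact: measurable_leaf_mass.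
- apply/measurable_EFinP/measurable_funM; first exact: measurable_flow1.
  by apply: measurable_indic; exact: measurable_leafD.
- apply: aeW => x _; apply/cvg_EFin; first by near=> m.
  have [Ex|NEx] := pselect (E x); last first.
    rewrite /flow1 /leaf_mass /throughput indicE memNset//=.
    under eq_fun do rewrite !mul0r; rewrite !mul0r; exact: cvg_cst.
  apply: cvgM; last exact: cvg_cst.
  apply: cvgM; first exact: cvg_cst.
  have [H lowH] := exists_height (E_tree Ex).
  have := @survival_below_cvg _ E E_tree E_reroot x Ex H lowH (origin (rep x)).
  by rewrite cls_rep.
- exact: finite_measure_integrable_cst.
- apply: aeW => x m _; rewrite lee_fin ger0_norm ?leaf_mass_ge0//.
  have [Ex|NEx] := pselect (E x); last first.
    by rewrite /leaf_mass /throughput indicE memNset//= !mul0r.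
  rewrite /leaf_mass mulrAC; apply: le_trans (leaf_throughput_le x).
  by rewrite ler_piMr ?below1// mulr_ge0// throughput_ge0.
exact: cvg_int.
Unshelve. all: by end_near. Qed.

Section weak.
Variables (phi pi : Dstar M -> R).
Hypotheses (phi0 : forall x, 0 <= phi x) (pi0 : forall x, 0 <= pi x).
Hypotheses (mphi : measurable_fun setT phi) (mpi : measurable_fun setT pi).
Hypothesis phi_capacity : forall x, E x -> phi x <= capacity x.
Hypothesis phi_conservation : forall x, E x -> forall v : rep x, ~ leaf v ->
  \sum_(w \in [set w | parent w = v]) phi (cls w) <= phi (cls v).
Hypothesis pi_separates : forall x, E x -> forall v : rep x, leaf v ->
  forall e, 0 < e -> exists N,
    1 - e <= \sum_(n < N) pi (cls (iter n (@parent R (rep x)) v)).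

Let mass (x : Dstar M) : R := phi x * \1_leafD x.

Let mass0 x : 0 <= mass x. Proof. by rewrite mulr_ge0. Qed.

Let mmass : measurable_fun setT mass.
Proof.
by apply: measurable_funM => //; apply: measurable_indic; exact: measurable_leafD.
Qed.

(** Conservation unrolled downwards: the leaves met within fewer than N generations contribute no
    more than what passes through [v]. *)
Let mass_sum_le N x : E x -> forall v : rep x,
  \sum_(n < N) iter n over_children mass (cls v) <= phi (cls v).
Proof.
move=> Ex; have tree := E_tree Ex; have [H lowH] := exists_height tree.
elim: N => [|N IHN] v; first by rewrite big_ord0.
rewrite big_ord_recl; under eq_bigr do rewrite lift0 iterS (over_children_cls tree).
have [lv|lv] := pselect (leaf v).
  rewrite big1 ?addr0; first by rewrite /= /mass indicE ler_piMr// lern1 leq_b1.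
  move=> i _; rewrite (_ : [set w | _] = set0) ?fsbig_set0//.
  by apply/seteqP; split=> // w /=; exact: (leaf_no_child tree lowH).
rewrite /= {1}/mass indicE memNset ?mulr0 ?add0r; last first.
  by move/(leafD_cls tree lowH).
apply: le_trans (phi_conservation Ex lv).
have finC : finite_set [set w | parent w = v] := finite_children tree v.
rewrite [leRHS]fsbig_finite//.
have -> : \sum_(i < N) \sum_(w \in [set w | parent w = v])
      iter i over_children mass (cls w) =
    \sum_(w <- finmap.enum_fset (fset_set [set w | parent w = v])) \sum_(i < N)
      iter i over_children mass (cls w).
  rewrite exchange_big; apply: eq_bigr => i _; exact: fsbig_finite.
by apply: ler_sum => w _; exact: IHN.
Qed.

Let partial_bound N :
  (\int[P]_x (mass x * \sum_(n < N) iter n at_parent pi x)%:E <=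
   \int[P]_x (capacity x * pi x)%:E)%E.
Proof.
rewrite -mass_chain_sum//; apply: (le_integral_full mE PE) => [x|x|x Ex].
- rewrite lee_fin mulr_ge0//; apply: sumr_ge0 => n _.
  exact: iter_over_children_ge0.
- by rewrite lee_fin mulr_ge0// capacity_ge0.
rewrite lee_fin ler_wpM2r//; apply: le_trans (phi_capacity Ex).
by have := mass_sum_le N Ex (origin (rep x)); rewrite cls_rep.
Qed.

(** Leaf masses are sent to their first N ancestors with weights [pi]. Capped at 1, the total weight
    above each leaf increases to 1, so monotone convergence recovers the full leaf mass; the
    uncapped integrals obey [partial_bound]. *)
Lemma weak_duality : (\int[P]_x (phi x * \1_leafD x)%:E <=
  \int[P]_x (capacity x * pi x)%:E)%E.
Proof.
pose s N x := \sum_(n < N) iter n at_parent pi x.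
have s_nd x : {homo s ^~ x : n m / (n <= m)%N >-> n <= m}.
  move=> n m /subnKC <-; rewrite /s big_split_ord /= lerDl; apply: sumr_ge0 => i _.
  exact: iter_at_parent_ge0.
have s0 N x : 0 <= s N x by apply: sumr_ge0 => n _; exact: iter_at_parent_ge0.
have ms N : measurable_fun setT (s N).
  apply: measurable_sum => n; exact: measurable_iter_at_parent.
pose u N x := (mass x * Num.min 1 (s N x))%:E.
have mu N : measurable_fun setT (u N).
  apply/measurable_EFinP/measurable_funM => //.
  exact: measurable_minr (measurable_cst _) (ms N).
have u0 N x : (0 <= u N x)%E by rewrite lee_fin mulr_ge0// le_min ler01 s0.
have u_nd x : {homo u ^~ x : n m / (n <= m)%N >-> (n <= m)%E}.
  move=> n m nm; rewrite lee_fin ler_wpM2l// le_min !ge_min lexx /=.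
  by rewrite (s_nd _ _ _ nm) orbT.
have := @monotone_convergence _ _ _ P setT measurableT u mu
  (fun n x _ => u0 n x) (fun x _ => u_nd x).
have lim_u x : E x -> limn (u ^~ x) = (mass x)%:E.
  move=> Ex; apply/cvg_lim => //; apply/cvg_EFin; first by near=> n.
  rewrite -[mass x]mulr1; have [lx|lx] := pselect (leafD x); last first.
    rewrite /mass indicE memNset// mulr0 mul0r.
    rewrite (_ : fine \o _ = fun=> 0); first exact: cvg_cst.
    by apply/funext => n; rewrite /u /= /mass indicE memNset// mulr0 mul0r.
  apply: cvgM; first exact: cvg_cst.
  have [H lowH] := exists_height (E_tree Ex).
  have lo : leaf (origin (rep x)).
    by apply/(leafD_cls (E_tree Ex) lowH); rewrite cls_rep.
  apply/cvgrPdist_le => e e0; have [N Ne] := pi_separates Ex lo e0.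
  have {}Ne : 1 - e <= s N x.
    rewrite (le_trans Ne)// /s ler_sum// => n _.
    have := @iter_at_parent _ E E_tree x Ex pi n (origin (rep x)).
    by rewrite cls_rep => ->.
  near=> n; have Nn : s N x <= s n x.
    by apply: s_nd; near: n; exact: nbhs_infty_ge.
  by rewrite ler_norml; case: (leP 1 (s n x)) => *; apply/andP; lra.
move=> lim_int.
have -> : (\int[P]_x (phi x * \1_leafD x)%:E = \int[P]_x limn (u ^~ x))%E.
  by apply: (eq_integral_full mE PE) => x Ex; rewrite lim_u.
rewrite lim_int; apply: lime_le.
  apply: ereal_nondecreasing_is_cvgn => n m nm.
  by apply: ge0_le_integral => // x _; exact: u_nd.
apply: nearW => N; apply: le_trans (partial_bound N).
apply: ge0_le_integral => // [|x _].
- by apply/measurable_EFinP; exact: measurable_funM mmass (ms N).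
- by rewrite lee_fin ler_wpM2l// ge_min lexx orbT.
Unshelve. all: by end_near. Qed.

End weak.
End duality.

(** * Processes *)

Section markings.
Context {R : realType} {M' : pseudoPMetricType R}.

Lemma measurable_marking_coord (X : discrete_space R) (u v : X) (phi : M' -> R) :
  (forall O, open O -> open (phi @^-1` O)) ->
  measurable_fun setT (fun z : marking X M' => phi (z u v)).
Proof.
move=> phiO; apply: (measurability _ (RGenOInfty.measurableE R)) => //.
move=> _ [_ [a ->] <-]; rewrite setTI; apply: sub_sigma_algebra.
exists u, v, (phi @^-1` [set y | a < y]); split; first exact/phiO/open_gt.
by apply/seteqP; split=> z /=; rewrite in_itv/= andbT.
Qed.

(** Finite balls of integer radius cover the space, so differing from [z0] at some pair is a
    countable union of cylinders. This makes almost sure statements under a Dirac law reduce to the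
    marking itself. *)
Lemma measurable_marking_set1 (X : discrete_space R) (o : X) (z0 : marking X M') :
  (forall a : M', open [set b | b <> a]) -> measurable [set z0].
Proof.
move=> M'O; rewrite -[[set z0]]setCK; apply: measurableC.
pose B n := [set u : X | dist o u <= n%:R].
rewrite (_ : ~` [set z0] = \bigcup_n \bigcup_(uv in B n `*` B n)
    [set z : marking X M' | z uv.1 uv.2 <> z0 uv.1 uv.2]).
  apply: bigcup_measurable => n _; apply: fin_bigcup_measurable.
    by apply: finite_setX; exact: finite_balls.
  move=> uv _; apply: sub_sigma_algebra.
  by exists uv.1, uv.2, [set b | b <> z0 uv.1 uv.2].
apply/seteqP; split=> z /=; last by move=> [n _ [uv _ /=]] zz0 zE; rewrite zE in zz0.
move=> zz0; have [u [v zuv]] : exists u v, z u v <> z0 u v.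
  apply: contrapT => H; apply: zz0; apply/funext => u; apply/funext => v.
  by apply: contrapT => zuv; apply: H; exists u, v.
pose n := (Num.truncn (Num.max (dist o u) (dist o v))).+1.
have := truncnS_gt (Num.max (dist o u) (dist o v)); rewrite gt_max => /andP[/ltW un /ltW vn].
by exists n => //; exists (u, v).
Qed.

Lemma ae_dirac_marking (X : discrete_space R) (o : X) (z0 : marking X M')
    (Q : marking X M' -> Prop) : (forall a : M', open [set b | b <> a]) -> Q z0 ->
  {ae (\d_z0 : probability (marking X M') R), forall z, Q z}.
Proof.
move=> M'O Qz0; have m0 := measurable_marking_set1 o z0 M'O.
exists (~` [set z0]); split; first exact: measurableC.
- by rewrite [LHS](@diracE _ _ R z0 (~` [set z0])) memNset//= => /(_ erefl).
- by move=> z /= NQz zz0; apply: NQz; rewrite zz0.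
Qed.

End markings.

Section dirac_process.
Context {R : realType} {M M' : pseudoPMetricType R}.
Context (P : probability (Dstar M) R).

Definition dirac_process (z2 : Dstar2 M -> M') : process M M' :=
  fun X => \d_((fun u v => z2 (cls2 u v)) : marking X M').

(** Equivariance is the invariance of [cls2] under isomorphisms; the probability of [A] is the
    indicator of its preimage by [decorated z2]. *)
Lemma equivariant_dirac (z2 : Dstar2 M -> M') (Dom : set (marked_space M)) :
  (forall (X Y : marked_space M) (h : X -> Y), marked_iso h -> Dom X -> Dom Y) ->
  measurable [set x : Dstar M | Dom (rep x)] ->
  P [set x : Dstar M | Dom (rep x)] = 1%E ->
  measurable_fun setT (decorated z2) ->
  equivariant_process P (dirac_process z2).
Proof.
move=> Dom_iso mE PE mz2; exists Dom; split=> //.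
  move=> X Y h ih _ A mA; rewrite [LHS]diracE [RHS]diracE; congr (nat_of_bool _)%:R%:E.
  have zE : (fun u v : X => z2 (cls2 (h u) (h v))) = (fun u v => z2 (cls2 u v)).
    by apply/funext => u; apply/funext => v; rewrite cls2_iso.
  by apply/idP/idP => /set_mem Az; apply/mem_set; move: Az; rewrite /= zE.
move=> A mA; apply: (@measurable_funS _ _ _ _ setT) => //.
rewrite (_ : (fun x => _) = EFin \o \1_(decorated z2 @^-1` A)).
  apply/measurable_EFinP; apply: measurable_indic.
  by rewrite -[_ @^-1` _]setTI; exact: mz2.
by apply/funext => x /=; rewrite [LHS]diracE indicE.
Qed.

End dirac_process.

(** * Mean value of a random marking on the edge to the parent *)

Section edge_mean.
Context {R : realType} {M M' : pseudoPMetricType R}.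
Variable phi : M' -> R.
Hypothesis phi_open : forall O, open O -> open (phi @^-1` O).
Hypothesis phi_ball : forall (a : M') (e : R), 0 < e -> exists2 e' : R, 0 < e' &
  forall b, ball a e' b -> `|phi b - phi a| <= e.

(** The parent relation is that of the original space, so the extra mark is forgotten before [up2]
    is tested. *)
Definition mark_above : Dstar (M * M')%type -> R :=
  vsum (fun y => \1_(forget2 @^-1` up2) y * phi (mark2 y).2).

Lemma measurable_mark_above : measurable_fun setT mark_above.
Proof.
apply: (@measurable_vsum _ _ _ 1) => [y y1|].
  rewrite indicE memNset ?mul0r// => -[+ _]; rewrite /adj2 /= /forget2 dist2_cls.
  by move=> y1'; move: y1; rewrite /dist2 /= y1' ltxx.
apply: measurable_funM.
  apply: measurable_indic; rewrite -[_ @^-1` _]setTI.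
  by apply: measurable_forget2 => //; exact: measurable_up2.
apply: (@measurable_mark2 _ _ (fun m : M * M' => phi m.2)) => a e e0.
have [e' e'0 phie] := phi_ball a.2 e0.
by exists e' => // b [_ /phie].
Qed.

Lemma forget2_add_mark (X : marked_space M) (z : X -> X -> M') (o v : X) :
  forget2 (@cls2 R _ (add_mark z) o v) = cls2 o v.
Proof. by rewrite forget2_cls -(cls2_iso _ _ (add_mark_iso z)). Qed.

Lemma mark_above_cls (X : marked_space M) (z : X -> X -> M') (o : X) :
  one_ended_tree X -> mark_above (@cls R _ (add_mark z) o) = phi (z o (parent o)).
Proof.
move=> tree; rewrite /mark_above vsum_cls.
transitivity (\sum_(w \in [set parent o]) phi (z o w)); last by rewrite fsbig_set1.
rewrite [RHS]fsbig_mkcond; apply: eq_fsbigr => w _; rewrite /patch mark2_cls indicE.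
have -> : (@cls2 R _ (add_mark z) o w \in forget2 @^-1` up2) = (w \in [set parent o]).
  have -> : (@cls2 R _ (add_mark z) o w \in forget2 @^-1` up2) = (cls2 o w \in up2).
    by apply/idP/idP => /set_mem uo; apply/mem_set; move: uo;
      rewrite /= forget2_add_mark.
  apply/idP/idP => /set_mem.
    by move=> /(up2_cls tree) <-; exact: mem_set.
  by move=> /= ->; apply/mem_set/(up2_cls tree).
by case: (w \in _); rewrite (mul1r, mul0r).
Qed.

Variables (Z : process M M') (Dom : set (marked_space M)).
Hypothesis mDom : measurable [set x : Dstar M | Dom (rep x)].
Hypothesis Z_iso : forall (X Y : marked_space M) (h : X -> Y), marked_iso h ->
  Dom X -> forall A : set (marking X M'), measurable A ->
  Z X A = Z Y [set z : marking Y M' | A (fun x x' => z (h x) (h x'))].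
Hypothesis Z_measurable : forall A : set (Dstar (M * M')%type), measurable A ->
  measurable_fun [set x : Dstar M | Dom (rep x)] (fun x : Dstar M =>
    Z (rep x) [set z : marking (rep x) M' | A (@cls R _ (add_mark z) (origin (rep x)))]).
Variables (E : set (Dstar M)) (mE : measurable E).
Hypothesis E_Dom : forall x, E x -> Dom (rep x).
Hypothesis E_tree : forall x, E x -> one_ended_tree (rep x).
Hypothesis E_reroot : forall x, E x -> forall v : rep x, E (cls v).

(** The positive part keeps the integrand nonnegative for every law; on legal flows and on cut-sets
    it equals the mark. *)
Definition edge_val (X : marked_space M) (v : X) (z : marking X M') : R :=
  Num.max 0 (phi (z v (parent v))).

Definition edge_mean (x : Dstar M) : \bar R :=
  if x \in E then (\int[Z (rep x)]_z (edge_val (origin (rep x)) z)%:E)%E else 0%E.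

Lemma edge_mean_ge0 x : (0 <= edge_mean x)%E.
Proof.
rewrite /edge_mean; case: ifP => // _.
by apply: integral_ge0 => z _; rewrite lee_fin le_max lexx.
Qed.

Lemma measurable_edge_val (X : marked_space M) (v : X) :
  measurable_fun setT (@edge_val X v).
Proof.
apply: measurable_maxr; first exact: measurable_cst.
exact: measurable_marking_coord.
Qed.

Let coord (x : Dstar M) (z : marking (rep x) M') : R :=
  phi (z (origin (rep x)) (parent (origin (rep x)))).

Let measurable_coord x : measurable_fun setT (@coord x).
Proof. exact: measurable_marking_coord. Qed.

Let law (x : Dstar M) : {measure set R -> \bar R} :=
  if x \in E then
    @measure_function_pushforward__canonical__measure_function_Measure _ _ _ _ _
      (Z (rep x)) (@coord x) (@measurable_coord x)
  else \d_(0 : R).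

(** The law of the mark above the root is a kernel: its mass on [U] is the probability that
    [mark_above] falls in [U], measurable in the class by the definition of an equivariant
    process. *)
Lemma measurable_edge_mean : measurable_fun setT edge_mean.
Proof.
have -> : edge_mean = (fun x => \int[law x]_y (Num.max 0 y)%:E)%E.
  have mmax : measurable_fun setT (fun y : R => (Num.max 0 y)%:E).
    by apply/measurable_EFinP; apply: measurable_maxr => //; exact: measurable_cst.
  apply/funext => x; rewrite /edge_mean /law; case: ifP => _.
    rewrite ge0_integral_pushforward//; last by move=> y _; rewrite lee_fin le_max lexx.
  by rewrite integral_dirac//= diracE mem_set// mul1e maxxx.
apply: measurable_fun_integral_kernel; last 2 first.
- by move=> y; rewrite lee_fin le_max lexx.
- by apply/measurable_EFinP; apply: measurable_maxr => //; exact: measurable_cst.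
move=> U mU; pose A := mark_above @^-1` U.
have mA : measurable A.
  by rewrite -[A]setTI; exact: measurable_mark_above.
have lawE : (fun x => law x U) = (fun x => if x \in E then
    Z (rep x) [set z : marking (rep x) M' | A (@cls R _ (add_mark z) (origin (rep x)))]
    else \d_(0 : R) U).
  apply/funext => x; rewrite /law; case: ifPn => // /set_mem Ex.
  rewrite /= /pushforward; congr (Z _ _); apply/seteqP; split=> z;
    by rewrite /A /= mark_above_cls//; exact: E_tree.
rewrite lawE; apply: (measurable_fun_if measurableT).
- apply: (@measurable_fun_bool _ _ _ _ true).
  rewrite setTI (_ : _ @^-1` _ = E)//.
  by apply/seteqP; split=> x; [exact: set_mem | exact: mem_set].
- rewrite setTI; apply: measurable_funS (Z_measurable mA) => //.
  by move=> x /set_mem /E_Dom.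
- exact: measurable_cst.
Qed.

(** At [cls v] the mean is taken on another representative; equivariance carries the law over along
    the isomorphism [h], which commutes with [parent]. All means then refer to one tree and can be
    added. *)
Lemma edge_mean_cls x : E x -> forall v : rep x,
  edge_mean (cls v) = (\int[Z (rep x)]_z (edge_val v z)%:E)%E.
Proof.
move=> Ex v; rewrite /edge_mean mem_set; last exact: E_reroot.
have [h ih ho] := rep_cls_iso v.
pose T (z : marking (rep (cls v)) M') : marking (rep x) M' :=
  fun u w => z (h u) (h w).
have mT : measurable_fun setT T.
  apply: (@measurability _ _ _ _ setT T (@marking_cylinders (rep x) M')) => //.
  move=> _ [_ [u [w [U [oU ->]]]] <-]; rewrite setTI; apply: sub_sigma_algebra.
  by exists (h u), (h w), U.
have hp : h (parent v) = parent (origin (rep (cls v))).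
  apply/esym/(up2_cls (E_tree (E_reroot Ex v))).
  by rewrite -ho (cls2_iso _ _ ih); apply/(up2_cls (E_tree Ex)).
rewrite [RHS](eq_measure_integral (@measure_function_pushforward__canonical__measure_function_Measure
   _ _ _ _ _ (Z (rep (cls v))) T mT)); last first.
  by move=> A mA _; exact: (Z_iso ih (E_Dom Ex) mA).
rewrite ge0_integral_pushforward//.
- by apply: eq_integral => z _; rewrite /edge_val /= /T hp ho.
- by apply/measurable_EFinP; exact: measurable_edge_val.
- by move=> z _; rewrite lee_fin le_max lexx.
Qed.

End edge_mean.

Lemma ae_full_set d (T : measurableType d) (R : realType) (mu : {measure set T -> \bar R})
    (Q : T -> Prop) : {ae mu, forall x, Q x} ->
  exists A : set T, [/\ measurable A, mu (~` A) = 0%E & forall x, A x -> Q x].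
Proof.
move=> [N [mN muN NQ]]; exists (~` N); rewrite setCK; split=> //.
  exact: measurableC.
by move=> x Nx; apply: contrapT => /NQ.
Qed.

Lemma ae_probability1 d (T : measurableType d) (R : realType) (P : probability T R)
    (A : set T) : measurable A -> P A = 1%E -> {ae P, forall x, A x}.
Proof.
move=> mA PA; exists (~` A); split=> //; first exact: measurableC.
by rewrite probability_setC// PA subee.
Qed.

Section process_means.
Context {R : realType}.
Local Notation M := (nonnegR R).
Context (P : probability (Dstar M) R).
Variables (E : set (Dstar M)) (mE : measurable E) (PE : P (~` E) = 0%E).
Hypothesis E_tree : forall x, E x -> one_ended_tree (rep x).
Hypothesis E_reroot : forall x, E x -> forall v : rep x, E (cls v).

Lemma leafD_origin x : E x -> leafD x <-> leaf (origin (rep x)).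
Proof.
move=> Ex; have [H lowH] := exists_height (E_tree Ex).
by rewrite -(leafD_cls (E_tree Ex) lowH) cls_rep.
Qed.

Lemma capacity_origin x : E x ->
  capacity x = cond (origin (rep x)) (parent (origin (rep x))).
Proof. by move=> Ex; rewrite -(capacity_cls (E_tree Ex)) cls_rep. Qed.

Section flow.
Variable f : process M R.
Local Notation mean := (edge_mean (fun r : R => r) f E).
Hypothesis mean_cls : forall x, E x -> forall v : rep x,
  mean (cls v) = (\int[f (rep x)]_z (edge_val (fun r : R => r) v z)%:E)%E.
Hypothesis f_legal : forall x, E x -> {ae f (rep x), forall z, legal_flow_on z}.

Let measurable_id_val (X : marked_space M) (v : X) :
  measurable_fun setT (fun z : marking X R => (edge_val (fun r : R => r) v z)%:E).
Proof. by apply/measurable_EFinP; exact: measurable_edge_val. Qed.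

Lemma flow_mean_le x : E x -> forall v : rep x, (mean (cls v) <= (capacity (cls v))%:E)%E.
Proof.
move=> Ex v; have [A [mA fA AQ]] := ae_full_set (f_legal Ex).
rewrite mean_cls// (capacity_cls (E_tree Ex)).
have -> : (cond v (parent v))%:E = (\int[f (rep x)]_z (cst (cond v (parent v))%:E) z)%E.
  by rewrite integral_cst// [X in (_ * X)%E](probability_setT (f (rep x))) mule1.
have [H lowH] := exists_height (E_tree Ex).
apply: (le_integral_full mA fA) => [z|z|z Az].
- by rewrite lee_fin le_max lexx.
- by rewrite lee_fin cond_ge0.
have [_ /(_ v (parent v) (adj_parent (E_tree Ex) lowH v)) /andP[z0 zc] _] := AQ z Az.
by rewrite lee_fin /edge_val ge_max zc cond_ge0.
Qed.

Lemma flow_mean_conservation x : E x -> forall v : rep x, ~ leaf v ->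
  (\sum_(w \in [set w | parent w = v]) mean (cls w))%E = mean (cls v).
Proof.
move=> Ex v lv; have [A [mA fA AQ]] := ae_full_set (f_legal Ex).
have [H lowH] := exists_height (E_tree Ex).
have finC := finite_children (E_tree Ex) v.
under eq_fsbigr => w _ do rewrite mean_cls//.
rewrite mean_cls// -ge0_integral_fsum//; last first.
  by move=> w z _; rewrite lee_fin le_max lexx.
apply: (eq_integral_full mA fA) => z Az; rewrite fsumEFin//; congr EFin.
have [_ z_bounds z_cons] := AQ z Az.
have valE w : edge_val (fun r : R => r) w z = z w (parent w).
  have /andP[z0 _] := z_bounds w (parent w) (adj_parent (E_tree Ex) lowH w).
  exact/max_idPr.
rewrite valE z_cons//; apply: eq_fsbigr => w /set_mem wv.
by rewrite valE; congr (z w _).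
Qed.

Lemma flow_normE :
  flow_norm P f = (\int[P]_x (fine (mean x) * \1_leafD x)%:E)%E.
Proof.
apply: (eq_integral_full mE PE) => x Ex.
have [A [mA fA AQ]] := ae_full_set (f_legal Ex).
have [H lowH] := exists_height (E_tree Ex).
pose o := origin (rep x).
transitivity (\int[f (rep x)]_z ((edge_val (fun r : R => r) o z)%:E *
    ((\1_leafD x : R))%:E))%E.
  apply: (eq_integral_full mA fA) => z Az; rewrite -EFinM; congr EFin.
  congr (_ * _); last first.
    rewrite !indicE; congr (nat_of_bool _)%:R.
    by apply/idP/idP => /set_mem lo; apply/mem_set/(leafD_origin Ex).
  have [_ /(_ o (parent o) (adj_parent (E_tree Ex) lowH o)) /andP[z0 _] _] := AQ z Az.
  by rewrite /edge_val; apply/esym/max_idPr.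
have meanx : mean x = (\int[f (rep x)]_z (edge_val (fun r : R => r) o z)%:E)%E.
  by rewrite /edge_mean mem_set.
rewrite ge0_integralZr//; last by move=> z _; rewrite lee_fin le_max lexx.
rewrite -meanx EFinM fineK// ge0_fin_numE ?edge_mean_ge0//.
apply: le_lt_trans (ltry (capacity x)).
by have := flow_mean_le Ex o; rewrite cls_rep.
Qed.

End flow.

Section cut.
Variable Pi : process M bool.
Local Notation b2r := (fun b : bool => b%:R : R).
Local Notation mean := (edge_mean b2r Pi E).
Hypothesis mean_cls : forall x, E x -> forall v : rep x,
  mean (cls v) = (\int[Pi (rep x)]_z (edge_val b2r v z)%:E)%E.
Hypothesis Pi_cut : forall x, E x -> {ae Pi (rep x), forall z, cut_on z}.

Lemma cut_mean_le1 x : (mean x <= 1)%E.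
Proof.
rewrite /edge_mean; case: ifP => // _.
have -> : (1 = \int[Pi (rep x)]_z (cst 1%E) z)%E.
  by rewrite integral_cst// [X in (_ * X)%E](probability_setT (Pi (rep x))) mule1.
apply: ge0_le_integral => //.
- by move=> z _; rewrite lee_fin le_max lexx.
- apply/measurable_EFinP; apply: measurable_edge_val => O _; exact: discrete_open.
- by move=> z _; rewrite lee_fin ge_max ler01 lern1 leq_b1.
Qed.

Lemma cut_mean_fin x : mean x \is a fin_num.
Proof.
rewrite ge0_fin_numE ?edge_mean_ge0//; apply: le_lt_trans (cut_mean_le1 x) _.
exact: ltry.
Qed.

(** Almost surely the cut-set meets the ray of ancestors of the leaf, so the mean number of its
    edges on that ray is at least 1. This is the sum of an infinite series, hence the slack e for
    partial sums. *)
Lemma cut_mean_separates x : E x -> forall v : rep x, leaf v ->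
  forall e, 0 < e -> exists N,
    1 - e <= \sum_(n < N) fine (mean (cls (iter n (@parent R (rep x)) v))).
Proof.
move=> Ex v lv e e0; pose a n := iter n (@parent R (rep x)) v.
have [A [mA fA AQ]] := ae_full_set (Pi_cut Ex).
have [H lowH] := exists_height (E_tree Ex).
have ray_a : ray a := ray_of (E_tree Ex) lowH v.
have mval n : measurable_fun setT (fun z : marking (rep x) bool => (edge_val b2r (a n) z)%:E).
  apply/measurable_EFinP; apply: measurable_edge_val => O _; exact: discrete_open.
have val0 n (z : marking (rep x) bool) : (0 <= (edge_val b2r (a n) z)%:E)%E.
  by rewrite lee_fin le_max lexx.
have ge1 : (1 <= \sum_(n <oo) mean (cls (a n)))%E.
  have -> : (\sum_(n <oo) mean (cls (a n)) =
      \int[Pi (rep x)]_z \sum_(n <oo) (edge_val b2r (a n) z)%:E)%E.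
    rewrite integral_nneseries//.
    by apply: eq_eseriesr => n _; rewrite mean_cls.
  have -> : (1 = \int[Pi (rep x)]_z (cst 1%E) z)%E.
    by rewrite integral_cst// [X in (_ * X)%E](probability_setT (Pi (rep x))) mule1.
  apply: (le_integral_full mA fA) => [//|z|z Az]; first exact: nneseries_ge0.
  have [_ sep] := AQ z Az; have [n zn] := sep _ ray_a lv.
  apply: le_trans (nneseries_lim_ge n.+1 _) => //.
  rewrite big_nat_recr//= -[leLHS]add0e; apply: leeD; first exact: sume_ge0.
  rewrite lee_fin /edge_val.
  have -> : parent (a n) = a n.+1 by [].
  by rewrite zn le_max lexx orbT.
apply: contrapT => /forallNP small; have : (\sum_(n <oo) mean (cls (a n)) <= (1 - e)%:E)%E.
  apply: lime_le; first by apply: is_cvg_nneseries => n _ _; exact: edge_mean_ge0.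
  apply: nearW => N; rewrite big_mkord.
  under eq_bigr do rewrite -(fineK (cut_mean_fin _)).
  by rewrite sumEFin lee_fin; have /negP := small N; rewrite -ltNge => /ltW.
by move=> /(le_trans ge1); rewrite lee_fin; lra.
Qed.

Lemma cut_capacityE :
  cut_capacity P Pi = (\int[P]_x (capacity x * fine (mean x))%:E)%E.
Proof.
apply: (eq_integral_full mE PE) => x Ex; pose o := origin (rep x).
rewrite -capacity_origin// EFinM fineK ?cut_mean_fin//.
have -> : mean x = (\int[Pi (rep x)]_z (edge_val b2r o z)%:E)%E.
  by rewrite /edge_mean mem_set.
rewrite -ge0_integralZl_EFin//.
- apply: eq_integral => z _; rewrite -EFinM; congr (_ * _)%:E.
  by rewrite /edge_val; apply/esym/max_idPr.
- by move=> z _; rewrite lee_fin le_max lexx.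
- apply/measurable_EFinP; apply: measurable_edge_val => O _; exact: discrete_open.
- exact: capacity_ge0.
Qed.

End cut.
End process_means.

(** * The maximum over flows equals the infimum over cut-sets *)

Section max_flow_min_cut.
Context {R : realType}.
Local Notation M := (nonnegR R).
Context (P : probability (Dstar M) R) (P_unimodular : unimodular P).
Hypothesis P_tree : {ae P, forall x, one_ended_tree (rep x) /\
                                     edge_symmetric (@mark R _ (rep x))}.

(** The two processes come with different domains; on a common set [E] closed under rerooting, their
    means satisfy the hypotheses of [weak_duality]. *)
Lemma flow_norm_le_cut_capacity (f : process M R) (Pi : process M bool) :
  legal_equivariant_flow P f -> equivariant_cutset P Pi ->
  (flow_norm P f <= cut_capacity P Pi)%E.
Proof.
move=> [[Df [_ [mDf PDf] f_iso f_meas]] f_legal].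
move=> [[Dc [_ [mDc PDc] c_iso c_meas]] Pi_cut].
pose Phi x := [/\ one_ended_tree (rep x), Df (rep x), Dc (rep x),
  {ae f (rep x), forall z, legal_flow_on z} & {ae Pi (rep x), forall z, cut_on z}].
have aePhi : {ae P, forall x, Phi x}.
  apply: filterS (filterI P_tree (filterI (filterI (ae_probability1 mDf PDf)
    (ae_probability1 mDc PDc)) (filterI f_legal Pi_cut))).
  by move=> x [[? _] [[? ?] [? ?]]]; split.
have [Dom [_ mE PE EPhi E_reroot]] := saturated_full_set P_unimodular aePhi.
set E := [set x | Dom (rep x)] in mE PE EPhi E_reroot.
have PE0 : P (~` E) = 0%E by rewrite probability_setC// PE subee.
have E_tree x : E x -> one_ended_tree (rep x) by case/EPhi.
have E_Df x : E x -> Df (rep x) by case/EPhi.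
have E_Dc x : E x -> Dc (rep x) by case/EPhi.
have E_legal x : E x -> {ae f (rep x), forall z, legal_flow_on z} by case/EPhi.
have E_cut x : E x -> {ae Pi (rep x), forall z, cut_on z} by case/EPhi.
pose b2r (b : bool) : R := b%:R.
have b2r_open O : open O -> open (b2r @^-1` O) by move=> _; exact: discrete_open.
have b2r_ball (a : bool) (e : R) : 0 < e -> exists2 e' : R, 0 < e' &
    forall b, ball a e' b -> `|b2r b - b2r a| <= e.
  by move=> e0; exists e => // b <-; rewrite subrr normr0 ltW.
pose idr (r : R) := r.
have idr_ball (a : R) (e : R) : 0 < e -> exists2 e' : R, 0 < e' &
    forall b, ball a e' b -> `|idr b - idr a| <= e.
  by move=> e0; exists e => // b; rewrite -ball_normE /= distrC => /ltW.
have fmean_cls := edge_mean_cls (phi := idr) (fun _ => id) f_iso E_Df E_tree E_reroot.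
have cmean_cls := edge_mean_cls b2r_open c_iso E_Dc E_tree E_reroot.
rewrite (flow_normE mE PE0 E_tree fmean_cls E_legal) (cut_capacityE mE PE0 E_tree).
have fin x : E x -> forall v : rep x, edge_mean idr f E (cls v) \is a fin_num.
  move=> Ex v; rewrite ge0_fin_numE ?edge_mean_ge0//.
  exact: le_lt_trans (flow_mean_le E_tree fmean_cls E_legal Ex v) (ltry _).
apply: (weak_duality P_unimodular mE PE0 E_tree) => [x|x|||x Ex|x Ex v lv|x Ex v lv e e0].
- exact/fine_ge0/edge_mean_ge0.
- exact/fine_ge0/edge_mean_ge0.
- apply: measurableT_comp => //.
  exact: (measurable_edge_mean (fun _ => id) idr_ball mDf f_meas mE E_Df E_tree).
- apply: measurableT_comp => //.
  exact: (measurable_edge_mean b2r_open b2r_ball mDc c_meas mE E_Dc E_tree).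
- have := fin x Ex (origin (rep x)).
  have := flow_mean_le E_tree fmean_cls E_legal Ex (origin (rep x)).
  by rewrite cls_rep => lec finx; rewrite -lee_fin fineK.
- rewrite -lee_fin fineK; last exact: fin.
  rewrite -(flow_mean_conservation E_tree fmean_cls E_legal Ex lv) -fsumEFin; last first.
    exact: finite_children (E_tree _ Ex) v.
  by under eq_fsbigr => w _ do rewrite fineK ?fin//.
- exact: (cut_mean_separates E_tree cmean_cls E_cut Ex lv e0).
Qed.

Hypothesis P_bounded : exists K : R,
  {ae P, forall x, forall v : rep x, leaf v -> cond v (parent v) <= K}.

(** The capacities of the cut-sets [Pi m] are at most the leaf masses, which tend to the norm of
    [f]; together with weak duality this identifies the infimum, and the maximality of [f]
    follows. *)
Lemma max_flow_min_cut : exists f : process M R,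
  [/\ legal_equivariant_flow P f,
      forall f' : process M R, legal_equivariant_flow P f' ->
        (flow_norm P f' <= flow_norm P f)%E &
      flow_norm P f =
        ereal_inf [set cut_capacity P Pi | Pi in equivariant_cutset P]].
Proof.
have [K aeK] := P_bounded.
pose Phi x := [/\ one_ended_tree (rep x), edge_symmetric (@mark R _ (rep x)) &
  forall v : rep x, leaf v -> cond v (parent v) <= K].
have aePhi : {ae P, forall x, Phi x}.
  by apply: filterS (filterI P_tree aeK) => x [[? ?] ?]; split.
have [Dom [Dom_iso mE PE EPhi E_reroot]] := saturated_full_set P_unimodular aePhi.
set E := [set x | Dom (rep x)] in mE PE EPhi E_reroot.
have PE0 : P (~` E) = 0%E by rewrite probability_setC// PE subee.
have E_tree x : E x -> one_ended_tree (rep x) by case/EPhi.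
have E_sym x : E x -> edge_symmetric (@mark R _ (rep x)) by case/EPhi.
have E_bounded x : E x -> forall v : rep x, leaf v -> cond v (parent v) <= K by case/EPhi.
have aeE := ae_probability1 mE PE.
pose f : process M R := dirac_process (flow2 E).
pose Pi m : process M bool := dirac_process (fun y : Dstar2 M => y \in cut2 E m).
have f_legal : legal_equivariant_flow P f.
  split.
    apply: (equivariant_dirac Dom_iso mE PE); apply: measurable_decorated.
    exact: measurable_flow2.
  apply: filterS aeE => x Ex; apply: (ae_dirac_marking (origin (rep x))).
    by move=> a; rewrite (_ : [set b | b <> a] = ~` [set a])//; apply: closed_openC;
      exact: closed_eq.
  exact: (flow2_legal E_tree E_reroot Ex (E_sym _ Ex)).
have fE : flow_norm P f = (\int[P]_x (flow1 E x * \1_leafD x)%:E)%E.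
  apply: (eq_integral_full mE PE0) => x Ex; have [H lowH] := exists_height (E_tree _ Ex).
  rewrite integral_dirac//; last first.
    apply/measurable_EFinP; apply: measurable_funM; last exact: measurable_cst.
    exact: (measurable_marking_coord _ _ (phi := fun r : R => r)).
  rewrite diracE mem_set// mul1e (flow2_parent E_tree Ex) cls_rep.
  congr (_ * _)%:E; rewrite !indicE; congr (nat_of_bool _)%:R.
  by apply/idP/idP => /set_mem lo; apply/mem_set/(leafD_origin E_tree Ex).
(* No vertex has height less than 0, so the cut for m = 0 is empty. *)
have Pi_cut m : (0 < m)%N -> equivariant_cutset P (Pi m).
  move=> m0; split.
    apply: (equivariant_dirac Dom_iso mE PE); apply: measurable_decorated_bool.
    exact: measurable_cut2.
  apply: filterS aeE => x Ex; apply: (ae_dirac_marking (origin (rep x))).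
    by move=> a; exact: discrete_open.
  have [H lowH] := exists_height (E_tree _ Ex).
  exact: (cut2_cut E_tree Ex lowH m0).
have PiE m : cut_capacity P (Pi m) = (\int[P]_x (capacity x * \1_(cutD E m) x)%:E)%E.
  apply: (eq_integral_full mE PE0) => x Ex; have [H lowH] := exists_height (E_tree _ Ex).
  rewrite integral_dirac//; last first.
    apply/measurable_EFinP; apply: measurable_funM; first exact: measurable_cst.
    apply: (measurable_marking_coord _ _ (phi := fun b : bool => b%:R : R)) => O _.
    exact: discrete_open.
  rewrite diracE mem_set// mul1e (capacity_origin E_tree Ex) (cut2_parent E_tree Ex lowH).
  by rewrite indicE cls_rep.
have le_inf : (flow_norm P f <= ereal_inf [set cut_capacity P Pi | Pi in equivariant_cutset P])%E.
  by apply: le_ereal_inf_tmp => _ [Pi' cPi' <-]; exact: flow_norm_le_cut_capacity.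
have inf_le : (ereal_inf [set cut_capacity P Pi | Pi in equivariant_cutset P] <= flow_norm P f)%E.
  rewrite fE; have cvg_f := @leaf_mass_cvg _ P E mE E_tree E_reroot K E_bounded.
  apply: (@cvge_ge _ _ _ R _ _ _ _ cvg_f).
  near=> m; apply: le_trans (cut_bound P_unimodular mE PE0 E_tree E_reroot m).
  rewrite -PiE; apply: ereal_inf_lbound; exists (Pi m) => //; apply: Pi_cut.
  by near: m; exact: nbhs_infty_gt.
have f_inf : flow_norm P f = ereal_inf [set cut_capacity P Pi | Pi in equivariant_cutset P].
  by apply/eqP; rewrite eq_le le_inf inf_le.
exists f; split=> // f' f'_legal; rewrite f_inf.
by apply: le_ereal_inf_tmp => _ [Pi' cPi' <-]; exact: flow_norm_le_cut_capacity.
Unshelve. all: by end_near. Qed.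

End max_flow_min_cut.

Theorem theorem7p14 (R : realType)
    (P : probability (Dstar (nonnegR R)) R)
    (P_unimodular : unimodular P)
    (P_tree : {ae P, forall x, one_ended_tree (rep x) /\
                               edge_symmetric (@mark R _ (rep x))})
    (P_bounded : exists K : R,
       {ae P, forall x, forall v : rep x, leaf v -> cond v (parent v) <= K}) :
  exists f : process (nonnegR R) R,
    [/\ legal_equivariant_flow P f,
        forall f' : process (nonnegR R) R, legal_equivariant_flow P f' ->
          (flow_norm P f' <= flow_norm P f)%E &
        flow_norm P f =
          ereal_inf [set cut_capacity P Pi | Pi in equivariant_cutset P]].
Proof. exact: max_flow_min_cut. Qed.
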